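(* Let $\tfrac12\le\theta<1$, let $\chi:T^*\mathbb{R}^d\to T^*\mathbb{R}^d$ be a linear symplectic map, let $U$ be the unitary transform associated to $\chi$, and let $u\in\mathcal{S}'_\theta(\mathbb{R}^d)$. Then for $(x_0,\xi_0)\in\mathbb{R}^{2d}\setminus\{0\}$, $$(x_0,\xi_0)\in\mathrm{WF}^\theta_{\mathrm{gl}}(u)\iff\chi(x_0,\xi_0)\in\mathrm{WF}^\theta_{\mathrm{gl}}(Uu).$$
   Context: $\mathcal{S}_\theta(\mathbb{R}^d)$ is the union over $C>0$ of the Banach spaces of all $f\in C^\infty(\mathbb{R}^d)$ with $\sup_{\alpha,\beta\in\mathbb{N}^d}\sup_{x} C^{-|\alpha|-|\beta|}(\alpha!\,\beta!)^{-\theta}|x^\alpha\partial^\beta f(x)|<\infty$, with the inductive limit topology. $\mathcal{S}_\theta'(\mathbb{R}^d)$ is its topological dual; $\langle\cdot,\cdot\rangle$ is the bilinear duality pairing. $T^*\mathbb{R}^d$ is identified with $\mathbb{R}^{2d}$; a subset of $\mathbb{R}^{2d}\setminus\{0\}$ is conic if it is invariant under multiplication of all $2d$ coordinates by positive reals. Global wave front set: for $u\in\mathcal{S}_\theta'(\mathbb{R}^d)$, a point $(x_0,\xi_0)\in\mathbb{R}^{2d}\setminus\{0\}$ is not in $\mathrm{WF}^\theta_{\mathrm{gl}}(u)$ iff there are an open conic neighbourhood $\Gamma'$ of $(x_0,\xi_0)$ and $C,\varepsilon>0$ with $|\langle u_y, e^{-i\langle y,\xi\rangle-\frac12|y-x|^2}\rangle|\le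 C e^{-\varepsilon(|x|^{1/\theta}+|\xi|^{1/\theta})}$ for all $(x,\xi)\in\Gamma'$. The unitary (metaplectic) transform $U:L^2(\mathbb{R}^d)\to L^2(\mathbb{R}^d)$ associated to $\chi$ is the unitary operator, unique up to a constant factor of modulus one, with $U^{-1}a^w(x,D)U=(a\circ\chi)^w(x,D)$ for all symbols $a\in\mathcal{S}(\mathbb{R}^{2d})$, where $a^w(x,D)f(x)=(2\pi)^{-d}\iint e^{i\langle x-y,\xi\rangle}a(\tfrac{x+y}2,\xi)f(y)\,dy\,d\xi$ is the Weyl quantization. It restricts to an isomorphism of $\mathcal{S}_\theta(\mathbb{R}^d)$ and extends (by duality) to an isomorphism of $\mathcal{S}'_\theta(\mathbb{R}^d)$. *)

(* Defs.v *)
From HB Require Import structures.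
From mathcomp Require Import all_boot all_order all_algebra.
From mathcomp Require Import all_classical all_reals all_analysis.
From mathcomp.real_closed Require Import complex.

Set Implicit Arguments.
Unset Strict Implicit.
Unset Printing Implicit Defensive.

Import Order.TTheory GRing.Theory Num.Theory.
Import numFieldNormedType.Exports.
Import ComplexField.Normc.

Local Open Scope classical_set_scope.
Local Open Scope ring_scope.
Local Open Scope complex_scope.

(* R^n is 'rV[R]_n, with sigma-algebra generated by the coordinates, which is
   the Borel sigma-algebra. *)
Section measurable_rV.
Context {R : realType}.
Variable n : nat.

Let coord (i : 'I_n) (x : 'rV[R]_n) : measurableTypeR R := x ord0 i.

Let rV_set0 : g_sigma_preimage coord set0.
Proof. exact: sigma_algebra0. Qed.

Let rV_setC A : g_sigma_preimage coord A -> g_sigma_preimage coord (~` A).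
Proof. exact: sigma_algebraC. Qed.

Let rV_bigcup (F : (set 'rV[R]_n)^nat) :
  (forall i, g_sigma_preimage coord (F i)) ->
  g_sigma_preimage coord (\bigcup_i (F i)).
Proof. exact: sigma_algebra_bigcup. Qed.

HB.instance Definition _ := @isMeasurable.Build default_measure_display
  'rV[R]_n (g_sigma_preimage coord) rV_set0 rV_setC rV_bigcup.

Lemma measurable_coord_rV (i : 'I_n) :
  measurable_fun setT (fun x : 'rV[R]_n => x ord0 i : measurableTypeR R).
Proof.
move=> _ Y mY; rewrite setTI; apply: sub_sigma_algebra => /=.
rewrite -bigcup_seq/=; exists i => /=; first by rewrite mem_index_enum.
by exists Y => //; rewrite setTI.
Qed.

Lemma measurable_fun_rV d (T : measurableType d) (f : T -> 'rV[R]_n) :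
  (forall i, measurable_fun setT
     (fun t => f t ord0 i : measurableTypeR R)) ->
  measurable_fun setT f.
Proof.
move=> mf; apply: (@measurability _ _ _ _ _ _
  (\big[setU/set0]_(i < n) preimage_set_system setT (coord i) measurable)) => //.
move=> _ [B + <-]; rewrite -bigcup_seq/= => -[i _ [C mC <-]].
by rewrite !setTI; have := mf i measurableT C mC; rewrite setTI.
Qed.

End measurable_rV.

Section lebesgue_rV.
Context {R : realType}.
Local Open Scope ereal_scope.

Definition cons_rV n (p : measurableTypeR R * 'rV[R]_n) : 'rV[R]_n.+1 :=
  \row_j oapp (fun k => p.2 ord0 k) p.1 (unlift ord0 j).

Definition uncons_rV n (x : 'rV[R]_n.+1) : measurableTypeR R * 'rV[R]_n :=
  (x ord0 ord0, \row_j x ord0 (lift ord0 j)).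

Lemma cons_rVK n : cancel (@cons_rV n) (@uncons_rV n).
Proof.
move=> [t x]; rewrite /uncons_rV /cons_rV /= mxE unlift_none /=.
by congr pair; apply/rowP => j; rewrite !mxE liftK.
Qed.

Lemma measurable_cons_rV n : measurable_fun setT (@cons_rV n).
Proof.
apply: measurable_fun_rV => i; under eq_fun do rewrite mxE.
case: (unlift ord0 i) => [j|] /=; last exact: measurable_fst.
by apply: measurableT_comp (measurable_coord_rV j) _; exact: measurable_snd.
Qed.

Lemma measurable_uncons_rV n : measurable_fun setT (@uncons_rV n).
Proof.
apply/measurable_fun_pairP; split; first exact: measurable_coord_rV.
apply: measurable_fun_rV => i /=; under eq_fun do rewrite mxE.
exact: measurable_coord_rV.
Qed.

Section cons_measure.
Context {n : nat} (m : {sigma_finite_measure set 'rV[R]_n -> \bar R}).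

Definition cons_measure : set 'rV[R]_n.+1 -> \bar R :=
  pushforward (@lebesgue_measure R \x m) (@cons_rV n).

Let cons_measure0 : cons_measure set0 = 0.
Proof. by apply: measure0; exact: measurable_cons_rV. Qed.

Let cons_measure_ge0 A : 0 <= cons_measure A.
Proof. by apply: measure_ge0; exact: measurable_cons_rV. Qed.

Let cons_measure_sigma_additive : semi_sigma_additive cons_measure.
Proof. by apply: measure_semi_sigma_additive; exact: measurable_cons_rV. Qed.

HB.instance Definition _ := isMeasure.Build _ _ _ cons_measure
  cons_measure0 cons_measure_ge0 cons_measure_sigma_additive.

Let cons_measure_sigma_finite : sigma_finite setT cons_measure.
Proof.
have /sigma_finiteP[F [TF ndF Foo]] := sigma_finiteT (@lebesgue_measure R).
have /sigma_finiteP[G [TG ndG Goo]] := sigma_finiteT m.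
exists (fun k => @uncons_rV n @^-1` (F k `*` G k)).
  rewrite -preimage_bigcup (_ : \bigcup_i _ = setT) ?preimage_setT//.
  rewrite -subTset => -[t x] _.
  have [i _ Fit] : (\bigcup_i F i) t by rewrite -TF.
  have [j _ Gjx] : (\bigcup_i G i) x by rewrite -TG.
  exists (maxn i j) => //; split => /=.
    by move: Fit; exact/subsetPset/ndF/leq_maxl.
  by move: Gjx; exact/subsetPset/ndG/leq_maxr.
move=> k; have [? ?] := Foo k; have [? ?] := Goo k; split.
  rewrite -[X in measurable X]setTI; apply: measurable_uncons_rV => //.
  exact: measurableX.
rewrite /cons_measure /pushforward -comp_preimage.
rewrite (_ : _ \o _ = id); last by apply/funext => p; exact: cons_rVK.
by rewrite preimage_id product_measure1E// lte_mul_pinfty// ge0_fin_numE.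
Qed.

HB.instance Definition _ := Measure_isSigmaFinite.Build _ _ _ cons_measure
  cons_measure_sigma_finite.

End cons_measure.

Fixpoint lebesgue_rV n : {sigma_finite_measure set 'rV[R]_n -> \bar R} :=
  if n is n'.+1 then cons_measure (lebesgue_rV n') else \d_(0%R : 'rV[R]_0).

Lemma measurable_box n (A : 'I_n -> set (measurableTypeR R)) :
  (forall i, measurable (A i)) ->
  measurable [set x : 'rV[R]_n | forall i, A i (x ord0 i)].
Proof.
move=> mA; rewrite (_ : [set _ | _] =
    \bigcap_(i in [set: 'I_n]) ((fun x : 'rV[R]_n => x ord0 i) @^-1` A i)).
  apply: fin_bigcap_measurable => // i _.
  have := measurable_coord_rV i measurableT (mA i).
  by rewrite setTI.
by apply/seteqP; split => [x Ax i _|x Ax i]; [exact: Ax|exact: (Ax i I)].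
Qed.

Lemma lebesgue_rV_box n (A : 'I_n -> set (measurableTypeR R)) :
  (forall i, measurable (A i)) ->
  lebesgue_rV n [set x | forall i, A i (x ord0 i)] =
  \prod_(i < n) lebesgue_measure (A i).
Proof.
elim: n A => [|n IHn] A mA.
  rewrite big_ord0 /= diracE mem_set//; by case.
rewrite big_ord_recl -IHn; last by move=> i; exact: mA.
rewrite -product_measure1E//; last first.
  by apply: (@measurable_box n (fun i => A (lift ord0 i))) => i; exact: mA.
transitivity ((lebesgue_measure \x lebesgue_rV n) (@cons_rV n @^-1`
  [set x | forall i, A i (x ord0 i)])) => //.
congr (product_measure1 _ _ _).
apply/seteqP; split => -[t x] /= => [Ax|[At Ax] i].
  split => [|i]; first by have := Ax ord0; rewrite mxE unlift_none.
  by have := Ax (lift ord0 i); rewrite mxE liftK.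
by rewrite mxE; case: unliftP => [j|] ->.
Qed.

End lebesgue_rV.

Section complex_functions.
Context {R : realType}.
Implicit Type t : R.

Definition cis t : R[i] := cos t +i* sin t.

Definition complex_integral d (T : measurableType d)
    (mu : {measure set T -> \bar R}) (f : T -> R[i]) : R[i] :=
  (\int[mu]_x complex.Re (f x)) +i* (\int[mu]_x complex.Im (f x)).

Variable n : nat.
Implicit Types (x y : 'rV[R]_n) (f g : 'rV[R]_n -> R[i]).

Definition dot x y : R := \sum_(i < n) x ord0 i * y ord0 i.

(* The norm of the library on 'rV[R]_n is the sup norm. *)
Definition enorm x : R := Num.sqrt (dot x x).

Definition pderiv (i : 'I_n) f : 'rV[R]_n -> R[i] := fun x =>
  'D_(delta_mx ord0 i) (fun y => complex.Re (f y)) x +i*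
  'D_(delta_mx ord0 i) (fun y => complex.Im (f y)) x.

Definition smooth f := forall (s : seq 'I_n) (g := foldr pderiv f s),
  [/\ continuous (fun y => complex.Re (g y)), continuous (fun y => complex.Im (g y)) &
      forall i x, derivable (fun y => complex.Re (g y)) x (delta_mx ord0 i) /\
                  derivable (fun y => complex.Im (g y)) x (delta_mx ord0 i)].

Implicit Types alpha beta : 'I_n -> nat.

Definition mdeg alpha : nat := (\sum_(i < n) alpha i)%N.
Definition mfact alpha : nat := (\prod_(i < n) (alpha i)`!)%N.
Definition mpow x alpha : R := \prod_(i < n) x ord0 i ^+ alpha i.
Definition mderiv beta f : 'rV[R]_n -> R[i] :=
  foldr (fun i => iter (beta i) (pderiv i)) f (enum 'I_n).

Definition schwartz f := smooth f /\
  forall alpha beta, exists M : R, forall x,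
    `|mpow x alpha| * normc (mderiv beta f x) <= M.

End complex_functions.

Section gelfand_shilov.
Context {R : realType} (n : nat) (theta : R).
Implicit Types (f g : 'rV[R]_n -> R[i]) (V W : set ('rV[R]_n -> R[i])).

Definition gs_norm (C : R) f : \bar R := ereal_sup
  [set e | exists alpha beta x,
    e = (C ^- (mdeg alpha + mdeg beta)
         * (mfact alpha * mfact beta)%:R `^ (- theta)
         * (`|mpow x alpha| * normc (mderiv beta f x)))%:E].

Definition gs_step (C : R) : set ('rV[R]_n -> R[i]) :=
  [set f | smooth f /\ (gs_norm C f < +oo)%E].

Definition gelfand_shilov : set ('rV[R]_n -> R[i]) :=
  [set f | exists2 C : R, 0 < C & gs_step C f].

Definition absolutely_convex W := forall f g (a b : R[i]),
  W f -> W g -> normc a + normc b <= 1 -> W (fun x => a * f x + b * g x).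

(* Inductive limit topology in the category of locally convex spaces: a base
   at 0 is given by the absolutely convex sets whose trace on each step of the
   union is a neighbourhood of 0 in this step. *)
Definition gs_nbhs f V := exists W,
  [/\ W `<=` gelfand_shilov, absolutely_convex W,
      forall C : R, 0 < C -> exists2 r : R, 0 < r &
        forall h, gs_step C h -> (gs_norm C h <= r%:E)%E -> W h &
      forall h, W h -> V (fun x => f x + h x)].

(* A functional on the Gelfand-Shilov space is encoded by a function on all
   functions, whose values outside the Gelfand-Shilov space are irrelevant. *)
Definition gs_dual (u : ('rV[R]_n -> R[i]) -> R[i]) :=
  (forall f g (c : R[i]), gelfand_shilov f -> gelfand_shilov g ->
     u (fun x => c * f x + g x) = c * u f + u g) /\
  (forall f (e : R), gelfand_shilov f -> 0 < e ->
     gs_nbhs f [set g | normc (u g - u f) < e]).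

End gelfand_shilov.

Section wave_front_set.
Context {R : realType} (d : nat) (theta : R).

(* T^*R^d is 'rV[R]_(d + d), with position x = lsubmx z and frequency
   xi = rsubmx z. *)
Implicit Types (z : 'rV[R]_(d + d)).

Definition gauss_packet z (y : 'rV[R]_d) : R[i] :=
  cis (- dot y (rsubmx z)) * (expR (- (2^-1 * enorm (y - lsubmx z) ^+ 2)))%:C.

Definition conic (G : set 'rV[R]_(d + d)) :=
  ~ G 0 /\ forall z (t : R), 0 < t -> G z -> G (t *: z).

Definition WFgl (u : ('rV[R]_d -> R[i]) -> R[i]) : set 'rV[R]_(d + d) :=
  [set z0 | z0 != 0 /\
    ~ exists G (C e : R), [/\ open G, conic G, G z0, 0 < C /\ 0 < e &
        forall z, G z -> normc (u (gauss_packet z)) <=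
          C * expR (- e * (enorm (lsubmx z) `^ theta^-1
                           + enorm (rsubmx z) `^ theta^-1))]].

End wave_front_set.

Section L2.
Context {R : realType} (d : nat).
Notation leb := (lebesgue_rV (R := R) d).
Notation fct := ('rV[R]_d -> R[i]).
Implicit Types (f g h : fct) (U : fct -> fct).

(* Elements of L^2 are represented by functions modulo a.e. equality, and
   operators on L^2 by maps on representatives. *)
Definition L2 : set fct := [set f |
  [/\ measurable_fun setT (fun x : 'rV[R]_d => complex.Re (f x) : R),
      measurable_fun setT (fun x : 'rV[R]_d => complex.Im (f x) : R) &
      (\int[leb]_x ((normc (f x)) ^+ 2)%:E < +oo)%E]].

Definition aeq f g := {ae leb, forall x, f x = g x}.

Definition L2_inner f g : R[i] :=
  complex_integral leb (fun x => f x * conjc (g x)).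

Definition unitary_L2 U :=
  [/\ forall f, L2 f -> L2 (U f),
      forall f g, L2 f -> L2 g -> aeq f g -> aeq (U f) (U g),
      forall f g (c : R[i]), L2 f -> L2 g ->
        aeq (U (fun x => c * f x + g x)) (fun x => c * U f x + U g x),
      forall f g, L2 f -> L2 g -> L2_inner (U f) (U g) = L2_inner f g &
      forall g, L2 g -> exists2 f, L2 f & aeq (U f) g].

Definition inv_L2 U g : fct := xget (fun=> 0) [set f | L2 f /\ aeq (U f) g].

Definition weyl (a : 'rV[R]_(d + d) -> R[i]) f : fct := fun x =>
  (((2 * pi) ^- d)%:C *
   complex_integral (leb \x leb)%E (fun p : 'rV[R]_d * 'rV[R]_d =>
     let: (y, xi) := p in
     cis (dot (x - y) xi) * a (row_mx (2^-1 *: (x + y)) xi) * f y)).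

Definition symplectic_form (z w : 'rV[R]_(d + d)) : R :=
  dot (rsubmx z) (lsubmx w) - dot (lsubmx z) (rsubmx w).

Definition symplectic (chi : 'rV[R]_(d + d) -> 'rV[R]_(d + d)) :=
  forall z w, symplectic_form (chi z) (chi w) = symplectic_form z w.

(* U^{-1} a^w(x,D) U = (a \o chi)^w(x,D) for all Schwartz symbols a. *)
Definition metaplectic (chi : 'rV[R]_(d + d) -> 'rV[R]_(d + d)) U :=
  unitary_L2 U /\
  forall a f, schwartz a -> L2 f ->
    aeq (inv_L2 U (weyl a (U f))) (weyl (a \o chi) f).

(* For the bilinear pairing, the transpose of U on L^2 is
   f |-> conj (U^{-1} (conj f)). On the Gelfand-Shilov space, the value is the
   representative lying in this space (unique, since continuous). *)
Definition transpose_gs (theta : R) U f : fct := xget (fun=> 0)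
  [set g | gelfand_shilov theta g /\
           aeq g (fun x => conjc (inv_L2 U (fun y => conjc (f y)) x))].

(* Extension of U by duality: <U u, f> = <u, U^T f>. *)
Definition dual_ext (theta : R) U (u : fct -> R[i]) : fct -> R[i] :=
  fun f => u (transpose_gs theta U f).

End L2.

(* Main.v *)
Require Import Defs.
From mathcomp Require Import all_boot all_order all_algebra.
From mathcomp Require Import all_classical all_reals all_analysis.
From mathcomp.real_closed Require Import complex.
From mathcomp Require Import measurable_realfun ring lra.

(* The packet P(A, B; z), z = (x, xi), is exp(-<(A + iB)(y - x), y - x>/2 - i xi.y), with A
   positive definite; the wave front set tests u on the packets P(1, 0; z). The operator
   with Weyl symbol exp(-|z - w|^2) has rank one, with range spanned by the conjugate of
   P(1, 0; w). Since |chi(x, xi)|^2 = <Pi x, x> + <p(xi + xS), xi + xS> with Pi = p^-1 and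
   S symmetric, the symbol composed with chi also quantizes to a rank one operator, with
   range spanned by P(Pi, S; x, -xi), where (x, xi) = chi^-1 w. Hence U^-1 maps the first
   function to a multiple of the second, and by unitarity the modulus of the factor does
   not depend on w. So testing Uu on P(1, 0; chi z) amounts to testing u on P(Pi, -S; z).

   It remains to see that decay of z |-> |<u, P(A, B; z)>| in a cone does not depend on
   (A, B). Any two windows are joined by steps A + iB -> A + iB - tau^2 l^T l with tau
   complex. Such a step multiplies the packet by exp(tau^2 a^2/2), a = l.(y - x), the limit
   of cosh(tau a/sqrt n)^n, which is the mean of exp(eta tau a) over a binomial variable
   eta; and exp(eta tau a) P(A, B; z) is P(A, B; z + eta v) times a factor of modulus at
   most exp(kappa eta^2/2) with kappa < 1. The moments of exp(g eta^2), g < 1/2, are bounded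
   uniformly in n, so the decay passes to the new window in a smaller cone. *)

Set Implicit Arguments.
Unset Strict Implicit.
Unset Printing Implicit Defensive.

Import Order.TTheory GRing.Theory Num.Theory.
Import numFieldNormedType.Exports.
Import ComplexField.Normc.

Local Open Scope classical_set_scope.
Local Open Scope ring_scope.
Local Open Scope complex_scope.

(** * Gaussian packets and Gelfand-Shilov estimates *)

(** The functional [u] is only linear and continuous for an inductive limit topology, so it cannot
    simply be moved under an integral. This is why a binomial mean takes the place of the Gaussian
    mean that would produce exp(tau^2 a^2/2): [u] commutes with finite sums. In exchange, the limit
    in n has to be taken inside one step of the inductive limit. It is elementary only as uniform
    convergence; Gevrey bounds uniform in n, combined with Landau's inequality between derivatives,
    upgrade it to convergence in a step with a doubled constant. Shifts by eta v with eta large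
    leave the cone where decay is known. There [u] is bounded on packets by exp(delta |z|^(1/theta))
    for every delta > 0, and since 1/theta <= 2 this growth is at most Gaussian in eta, with a small
    constant. The room 1 - kappa absorbs it; kappa < 1 follows from positivity of A - t1^2 l^T l,
    which is therefore demanded at every step. No formula for [U] enters: its action on packets is
    read off from the intertwining relation for Gaussian symbols. *)

Section complex_exponential.
Context {R : realType}.
Implicit Types (a b t : R) (z w : R[i]).

Definition cexp a b : R[i] := cis b * (expR a)%:C.

Lemma cexpE a b : cexp a b = (expR a * cos b) +i* (expR a * sin b).
Proof. by rewrite /cexp /cis; simpc; rewrite [_ * expR a]mulrC [sin b * _]mulrC. Qed.

Lemma cexpD a b a' b' : cexp (a + a') (b + b') = cexp a b * cexp a' b'.
Proof.
by rewrite !cexpE; simpc; rewrite expRD cosD sinD; congr (_ +i* _); ring.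
Qed.

Lemma cexp0 : cexp 0 0 = 1.
Proof. by rewrite cexpE expR0 cos0 sin0 !mul1r. Qed.

Lemma normcE2 z : normc z = Num.sqrt (complex.Re z ^+ 2 + complex.Im z ^+ 2).
Proof. by case: z. Qed.

Lemma normc_ge0 z : 0 <= normc z.
Proof. by rewrite normcE2 sqrtr_ge0. Qed.

Lemma normc_cis b : normc (cis b) = 1.
Proof. by rewrite /= cos2Dsin2 sqrtr1. Qed.

Lemma normc_real a : normc a%:C = `|a|.
Proof. by rewrite /= expr0n /= addr0 sqrtr_sqr. Qed.

Lemma normc_cexp a b : normc (cexp a b) = expR a.
Proof. by rewrite normcM normc_cis mul1r normc_real ger0_norm ?expR_ge0. Qed.

Lemma normc_conjc z : normc (conjc z) = normc z.
Proof. by case: z => a b /=; rewrite sqrrN. Qed.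

Lemma conjc_cexp a b : conjc (cexp a b) = cexp a (- b).
Proof. by rewrite !cexpE /= cosN sinN mulrN. Qed.

Lemma Re_le_normc z : `|complex.Re z| <= normc z.
Proof.
by rewrite normcE2 -sqrtr_sqr ler_wsqrtr// lerDl sqr_ge0.
Qed.

Lemma Im_le_normc z : `|complex.Im z| <= normc z.
Proof.
by rewrite normcE2 -sqrtr_sqr ler_wsqrtr// lerDr sqr_ge0.
Qed.

Lemma normc_le_ReIm z : normc z <= `|complex.Re z| + `|complex.Im z|.
Proof.
rewrite normcE2 -[leRHS]ger0_norm ?addr_ge0// -sqrtr_sqr ler_wsqrtr//.
rewrite sqrrD !real_normK ?num_real// [leRHS]addrAC lerDl.
by rewrite mulrn_wge0 ?mulr_ge0.
Qed.

Lemma normc_sum (I : Type) (r : seq I) (P : pred I) (F : I -> R[i]) :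
  normc (\sum_(i <- r | P i) F i) <= \sum_(i <- r | P i) normc (F i).
Proof.
elim/big_ind2: _ => [|x a y b xa yb|//]; first by rewrite normc0.
exact: le_trans (le_normcD _ _) (lerD xa yb).
Qed.

Lemma normcX z k : normc (z ^+ k) = normc z ^+ k.
Proof. by elim: k => [|k IH]; rewrite ?normc1// !exprS normcM IH. Qed.

Lemma cReD z w : complex.Re (z + w) = complex.Re z + complex.Re w.
Proof. by case: z w => [? ?] [? ?]. Qed.
Lemma cImD z w : complex.Im (z + w) = complex.Im z + complex.Im w.
Proof. by case: z w => [? ?] [? ?]. Qed.
Lemma cReN z : complex.Re (- z) = - complex.Re z. Proof. by case: z. Qed.
Lemma cImN z : complex.Im (- z) = - complex.Im z. Proof. by case: z. Qed.
Lemma cReM z w : complex.Re (z * w) =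
  complex.Re z * complex.Re w - complex.Im z * complex.Im w.
Proof. by case: z w => [? ?] [? ?]. Qed.
Lemma cImM z w : complex.Im (z * w) =
  complex.Re z * complex.Im w + complex.Im z * complex.Re w.
Proof. by case: z w => [? ?] [? ?]. Qed.

Lemma complexP z w :
  complex.Re z = complex.Re w -> complex.Im z = complex.Im w -> z = w.
Proof. by case: z w => [a b] [c d] /= -> ->. Qed.

End complex_exponential.

(** * Partial derivatives and smoothness of complex-valued functions *)

Section partial_derivatives.
Context {R : realType} (n : nat).
Implicit Types (f g : 'rV[R]_n -> R[i]) (i : 'I_n).
Local Notation e_ := (delta_mx (ord0 : 'I_1)).

(** [pderiv] is total and takes a default value where no derivative exists; this relation carries
    existence along with the value, and [has_pderivE] then allows substitution. *)
Definition has_pderiv i f f' := forall y,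
  is_derive y (e_ i) (fun y => complex.Re (f y)) (complex.Re (f' y)) /\
  is_derive y (e_ i) (fun y => complex.Im (f y)) (complex.Im (f' y)).

Definition ccontinuous f := continuous (fun y => complex.Re (f y)) /\
  continuous (fun y => complex.Im (f y)).

Lemma has_pderivE i f f' : has_pderiv i f f' -> pderiv i f = f'.
Proof.
move=> ff'; apply/funext => y; have [re im] := ff' y.
by apply: complexP; rewrite /pderiv /= derive_val.
Qed.

Lemma has_pderiv_lin i c f f' g g' : has_pderiv i f f' -> has_pderiv i g g' ->
  has_pderiv i (fun y => c * f y + g y) (fun y => c * f' y + g' y).
Proof.
move=> ff' gg' y; have [fr fi] := ff' y; have [gr gi] := gg' y; split.
  rewrite (_ : (fun _ => _) = (fun y => complex.Re c * complex.Re (f y) -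
    complex.Im c * complex.Im (f y) + complex.Re (g y))); last first.
    by apply/funext => z; rewrite cReD cReM.
  by apply: is_derive_eq; rewrite cReD cReM.
rewrite (_ : (fun _ => _) = (fun y => complex.Re c * complex.Im (f y) +
  complex.Im c * complex.Re (f y) + complex.Im (g y))); last first.
  by apply/funext => z; rewrite cImD cImM.
by apply: is_derive_eq; rewrite cImD cImM.
Qed.

Lemma has_pderivM i f f' g g' : has_pderiv i f f' -> has_pderiv i g g' ->
  has_pderiv i (fun y => f y * g y) (fun y => f' y * g y + f y * g' y).
Proof.
move=> ff' gg' y; have [fr fi] := ff' y; have [gr gi] := gg' y; split.
  rewrite (_ : (fun _ => _) = (fun y => complex.Re (f y) * complex.Re (g y) -
    complex.Im (f y) * complex.Im (g y))); last first.
    by apply/funext => z; rewrite cReM.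
  by apply: is_derive_eq; rewrite cReD !cReM /GRing.scale /=; ring.
rewrite (_ : (fun _ => _) = (fun y => complex.Re (f y) * complex.Im (g y) +
  complex.Im (f y) * complex.Re (g y))); last first.
  by apply/funext => z; rewrite cImM.
by apply: is_derive_eq; rewrite cImD !cImM /GRing.scale /=; ring.
Qed.

Lemma has_pderiv_cst i (c : R[i]) : has_pderiv i (fun=> c) (fun=> 0).
Proof. by move=> y; split; exact: is_derive_cst. Qed.

(** Both difference quotients coincide, so directional derivatives on row vectors reduce to
    one-variable ones, for which the derivation rules are found by inference. *)
Lemma is_derive_line (f : 'rV[R]_n -> R) (y v : 'rV[R]_n) (df : R) :
  is_derive (0 : R) 1 (fun t => f (t *: v + y)) df -> is_derive y v f df.
Proof.
have E : (fun h : R => h^-1 *: (f (h *: v + y) - f y)) =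
    (fun h : R => h^-1 *: (f ((h *: (1 : R) + 0) *: v + y) - f (0 *: v + y))).
  by apply/funext => h; rewrite scale0r add0r addr0 /GRing.scale /= mulr1.
move=> [ex val]; split.
  by rewrite /derivable E; exact: ex.
by rewrite /derive E; exact: val.
Qed.

Lemma is_derive_coord i j (y : 'rV[R]_n) :
  is_derive y (e_ i) (fun y => y ord0 j) (i == j)%:R.
Proof.
apply: is_derive_line.
rewrite (_ : (fun _ => _) = (fun t : R => t * (i == j)%:R + y ord0 j)).
  by apply: is_derive_eq; rewrite /GRing.scale /= mulr0 add0r addr0 mulr1.
by apply/funext => t; rewrite !mxE eqxx /= eq_sym.
Qed.

Lemma continuous_funD (T : topologicalType) (f g : T -> R) :
  continuous f -> continuous g -> continuous (fun y => f y + g y).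
Proof. by move=> cf cg y; apply: (@continuousD _ _ _ f g y); [exact: cf|exact: cg]. Qed.

Lemma continuous_funN (T : topologicalType) (f : T -> R) :
  continuous f -> continuous (fun y => - f y).
Proof. by move=> cf y; apply: (@continuousN _ _ _ f y); exact: cf. Qed.

Lemma continuous_funM (T : topologicalType) (f g : T -> R) :
  continuous f -> continuous g -> continuous (fun y => f y * g y).
Proof. by move=> cf cg y; apply: (@continuousM _ _ f g y); [exact: cf|exact: cg]. Qed.

Lemma ccontinuousM f g : ccontinuous f -> ccontinuous g ->
  ccontinuous (fun y => f y * g y).
Proof.
move=> [fr fi] [gr gi]; split.
  under eq_fun do rewrite cReM.
  apply: continuous_funD; first exact: continuous_funM.
  by apply/continuous_funN/continuous_funM.
under eq_fun do rewrite cImM.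
by apply: continuous_funD; exact: continuous_funM.
Qed.

Lemma ccontinuousD f g : ccontinuous f -> ccontinuous g ->
  ccontinuous (fun y => f y + g y).
Proof.
move=> [fr fi] [gr gi]; split.
  by under eq_fun do rewrite cReD; exact: continuous_funD.
by under eq_fun do rewrite cImD; exact: continuous_funD.
Qed.

Lemma ccontinuous_lin c f g : ccontinuous f -> ccontinuous g ->
  ccontinuous (fun y => c * f y + g y).
Proof.
move=> cf cg; apply: ccontinuousD => //; apply: ccontinuousM => //.
by split; exact: cst_continuous.
Qed.

(** A class closed under differentiation contains all iterated derivatives of its members, so
    smoothness follows without any formula for these derivatives. *)
Lemma smooth_coind (S : set ('rV[R]_n -> R[i])) :
  (forall f, S f -> ccontinuous f /\
     forall i, exists2 f', S f' & has_pderiv i f f') ->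
  forall f, S f -> smooth f.
Proof.
move=> SS.
have Sd i f : S f -> S (pderiv i f).
  by move=> /SS[_ /(_ i)[f1 Sf1 fE]]; rewrite (has_pderivE fE).
have Sfold f s : S f -> S (foldr (@pderiv R n) f s).
  by move=> Sf; elim: s => //= i s IH; exact: Sd.
move=> f Sf s g; have [[cr ci] D] := SS _ (Sfold f s Sf).
by split => // i x; have [f' _ /(_ x)[]] := D i; split; exact: ex_derive.
Qed.

Lemma smooth_has_pderiv f i : smooth f -> has_pderiv i f (pderiv i f).
Proof.
move=> sf y; have [_ _ /(_ i y)[Dr Di]] := sf [::].
by split; [exact: (derivableP Dr)|exact: (derivableP Di)].
Qed.

Lemma smooth_pderiv f i : smooth f -> smooth (pderiv i f).
Proof. by move=> sf s; rewrite -[foldr _ _ _](foldr_rcons); exact: (sf (rcons s i)). Qed.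

Lemma smooth_foldr f s : smooth f -> smooth (foldr (@pderiv R n) f s).
Proof. move=> sf; elim: s => [|i s IH]; [exact: sf|exact: smooth_pderiv]. Qed.

Lemma smooth_ccontinuous f : smooth f -> ccontinuous f.
Proof. by move=> /(_ [::])[]. Qed.

Lemma smooth_lin c f g : smooth f -> smooth g -> smooth (fun y => c * f y + g y).
Proof.
move=> sf sg; apply: (@smooth_coind
  [set h | exists f g, [/\ smooth f, smooth g & h = fun y => c * f y + g y]]);
  last by exists f, g.
move=> _ [f1 [g1 [sf1 sg1 ->]]]; split.
  by apply: ccontinuous_lin; exact: smooth_ccontinuous.
move=> i; exists (fun y => c * pderiv i f1 y + pderiv i g1 y).
  exists (pderiv i f1), (pderiv i g1).
  by split; [exact: smooth_pderiv|exact: smooth_pderiv|].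
by apply: has_pderiv_lin; exact: smooth_has_pderiv.
Qed.

Lemma smooth_cst (c : R[i]) : smooth (fun _ : 'rV[R]_n => c).
Proof.
apply: (@smooth_coind [set h | exists c, h = fun=> c]); last by exists c.
move=> _ [{}c ->]; split; first by split; exact: cst_continuous.
by move=> i; exists (fun=> 0); [exists 0|exact: has_pderiv_cst].
Qed.

Lemma foldr_pderiv_lin c f g s : smooth f -> smooth g ->
  foldr (@pderiv R n) (fun y => c * f y + g y) s =
  fun y => c * foldr (@pderiv R n) f s y + foldr (@pderiv R n) g s y.
Proof.
move=> sf sg; elim: s => //= i s ->.
by apply/has_pderivE/has_pderiv_lin; exact/smooth_has_pderiv/smooth_foldr.
Qed.

Lemma foldr_pderiv_cst0 s : foldr (@pderiv R n) (fun=> 0) s = fun=> 0.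
Proof. by elim: s => //= i s ->; exact/has_pderivE/has_pderiv_cst. Qed.

Lemma smooth_sum (I : Type) (r : seq I) (F : I -> 'rV[R]_n -> R[i]) :
  (forall k, smooth (F k)) -> smooth (fun y => \sum_(k <- r) F k y).
Proof.
move=> sF; elim: r => [|k r IH].
  rewrite (_ : (fun _ => _) = (fun=> 0)); first exact: smooth_cst.
  by apply/funext => y; rewrite big_nil.
rewrite (_ : (fun _ => _) = (fun y => 1 * F k y + \sum_(k <- r) F k y)).
  apply: smooth_lin; [exact: sF|exact: IH].
by apply/funext => y; rewrite big_cons mul1r.
Qed.

End partial_derivatives.

(** * Growth of the iterated derivatives of a Gaussian *)

Section gaussian_derivatives.
Context {R : realType} (n : nat).
Implicit Types (f g : 'rV[R]_n -> R[i]) (i j : 'I_n) (s : seq 'I_n).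
Local Notation D := (foldr (@pderiv R n)).

(** The polynomial multiples of [f0], generated so as to avoid a type of polynomials in several
    variables. If the first derivatives of [f0] lie in this class, as for a Gaussian, the class is
    stable under differentiation and [smooth_coind] applies. *)
Inductive polymul (f0 : 'rV[R]_n -> R[i]) : ('rV[R]_n -> R[i]) -> Prop :=
| polymul_base : polymul f0 f0
| polymul_lin c f g : polymul f0 f -> polymul f0 g ->
    polymul f0 (fun y => c * f y + g y)
| polymul_coord i f : polymul f0 f -> polymul f0 (fun y => (y ord0 i)%:C * f y).

Lemma polymul0 f0 : polymul f0 (fun=> 0).
Proof.
rewrite (_ : (fun=> 0) = (fun y => - 1 * f0 y + f0 y)); last first.
  by apply/funext => y; rewrite mulN1r addNr.
by apply: polymul_lin; exact: polymul_base.
Qed.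

Lemma polymulZ f0 c f : polymul f0 f -> polymul f0 (fun y => c * f y).
Proof.
move=> pf; rewrite (_ : (fun _ => _) = (fun y => c * f y + 0)).
  by apply: polymul_lin => //; exact: polymul0.
by apply/funext => y; rewrite addr0.
Qed.

Lemma polymul_sum f0 (I : Type) (r : seq I) F :
  (forall k, polymul f0 (F k)) -> polymul f0 (fun y => \sum_(k <- r) F k y).
Proof.
move=> pF; elim: r => [|k r IH].
  rewrite (_ : (fun _ => _) = (fun=> 0)); first exact: polymul0.
  by apply/funext => y; rewrite big_nil.
rewrite (_ : (fun _ => _) = (fun y => 1 * F k y + \sum_(k <- r) F k y)).
  exact: polymul_lin.
by apply/funext => y; rewrite big_cons mul1r.
Qed.

Lemma polymul_smooth f0 : ccontinuous f0 ->
  (forall i, exists2 f', polymul f0 f' & has_pderiv i f0 f') ->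
  forall f, polymul f0 f -> smooth f.
Proof.
move=> c0 d0; apply: smooth_coind => f; elim => [|c {}f g _ [cf df] _ [cg dg]|j {}f pf [cf df]].
- by split.
- split; first exact: ccontinuous_lin.
  move=> i; have [f' pf' ff'] := df i; have [g' pg' gg'] := dg i.
  exists (fun y => c * f' y + g' y); first exact: polymul_lin.
  exact: has_pderiv_lin.
- have cj : ccontinuous (fun y : 'rV[R]_n => (y ord0 j)%:C).
    by split; [exact: coord_continuous|exact: cst_continuous].
  split; first exact: ccontinuousM.
  move=> i; have [f' pf' ff'] := df i.
  exists (fun y => ((i == j)%:R)%:C * f y + (y ord0 j)%:C * f' y).
    by apply: polymul_lin => //; exact: polymul_coord.
  apply: (has_pderivM (f' := fun=> ((i == j)%:R)%:C)) => // y; split.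
    exact: is_derive_coord.
  exact: is_derive_cst.
Qed.

(** Each pair records one letter of [s] and the word left after removing that occurrence. This
    indexes the Leibniz terms in which one derivative falls on an affine factor; terms with two such
    derivatives vanish. *)
Fixpoint deletions (s : seq 'I_n) : seq ('I_n * seq 'I_n) :=
  if s is j :: s' then (j, s') :: [seq (p.1, j :: p.2) | p <- deletions s']
  else [::].

Lemma size_deletions s : size (deletions s) = size s.
Proof. by elim: s => //= j s IH; rewrite size_map IH. Qed.

Lemma deletions_size s p : p \in deletions s -> size p.2 = (size s).-1.
Proof.
elim: s p => //= j s IH p; rewrite in_cons => /orP[/eqP->//|/mapP[q qs ->]] /=.
by rewrite (IH _ qs); case: s qs {IH}.
Qed.

Lemma leibniz_affine (l : 'rV[R]_n -> R[i]) (c : 'I_n -> R[i]) f s :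
  (forall j, has_pderiv j l (fun=> c j)) -> smooth f ->
  D (fun y => l y * f y) s =
  fun y => l y * D f s y + \sum_(p <- deletions s) c p.1 * D f p.2 y.
Proof.
move=> dl sf; elim: s => [|j s IH].
  by apply/funext => y /=; rewrite big_nil addr0.
rewrite [LHS]/= IH; apply: has_pderivE.
rewrite [X in has_pderiv _ _ X](_ : _ = (fun y => 1 *
    (c j * D f s y + l y * D f (j :: s) y) +
    \sum_(p <- deletions s) c p.1 * D f (j :: p.2) y)); last first.
  apply/funext => y; rewrite mul1r big_cons big_map /=.
  by rewrite [c j * _ + _ in RHS]addrC addrA.
rewrite [X in has_pderiv _ X _](_ : _ = (fun y => 1 * (l y * D f s y) +
    \sum_(p <- deletions s) c p.1 * D f p.2 y)); last first.
  by apply/funext => y; rewrite mul1r.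
apply: has_pderiv_lin.
  by apply: has_pderivM => //; exact/smooth_has_pderiv/smooth_foldr.
elim: (deletions s) => [|p r IHr].
  rewrite (_ : (fun _ => _) = (fun=> 0)); last first.
    by apply/funext => y; rewrite big_nil.
  rewrite [X in has_pderiv _ _ X](_ : _ = (fun=> 0)); last first.
    by apply/funext => y; rewrite big_nil.
  exact: has_pderiv_cst.
rewrite (_ : (fun _ => _) = (fun y => c p.1 * D f p.2 y +
    \sum_(p <- r) c p.1 * D f p.2 y)); last first.
  by apply/funext => y; rewrite big_cons.
rewrite [X in has_pderiv _ _ X](_ : _ = (fun y => c p.1 * D f (j :: p.2) y +
    \sum_(p <- r) c p.1 * D f (j :: p.2) y)); last first.
  by apply/funext => y; rewrite big_cons.
by apply: has_pderiv_lin => //; exact/smooth_has_pderiv/smooth_foldr.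
Qed.

(** If N(m) bounds the derivatives of order m, the Leibniz rule gives N(m+1) <= T N(m) + m K N(m-1),
    the recurrence of Hermite polynomials. The product satisfies it because sqrt(K m) sqrt(K (m+1))
    >= K m. It grows like sqrt(m!), which fits every theta >= 1/2. *)
Lemma foldr_pderiv_gaussian_le f (l : 'I_n -> 'rV[R]_n -> R[i])
    (c : 'I_n -> 'I_n -> R[i]) (T K : R) (y : 'rV[R]_n) s :
  smooth f -> (forall i, has_pderiv i f (fun y => l i y * f y)) ->
  (forall i j, has_pderiv j (l i) (fun=> c i j)) ->
  (forall i, normc (l i y) <= T) -> (forall i j, normc (c i j) <= K) ->
  0 <= T -> 0 <= K ->
  normc (D f s y) <=
    (\prod_(i < size s) (T + Num.sqrt (K * i.+1%:R))) * normc (f y).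
Proof.
move=> sf df dl lT cK T0 K0.
have P0 m : 0 <= \prod_(i < m) (T + Num.sqrt (K * i.+1%:R)).
  by apply: prodr_ge0 => i _; rewrite addr_ge0 ?sqrtr_ge0.
have [m] := ubnP (size s); elim: m s => // m IH s.
case/lastP: s => [|s j]; first by rewrite big_ord0 mul1r.
rewrite size_rcons ltnS => sm.
(* The innermost derivative is peeled off: it turns [f] into [l j * f], to which the remaining,
   shorter word of derivatives is applied. *)
rewrite foldr_rcons (has_pderivE (df j)) (leibniz_affine _ (dl j) sf).
rewrite big_ord_recr /= [leRHS]mulrAC [leRHS]mulrDr.
apply: le_trans (le_normcD _ _) _; apply: lerD.
  rewrite normcM mulrC.
  by apply: ler_pM; rewrite ?normc_ge0//; exact: IH.
case: s sm => [|j0 s] sm.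
  rewrite big_nil normc0; apply: mulr_ge0; last exact: sqrtr_ge0.
  by apply: mulr_ge0; [exact: P0|exact: normc_ge0].
apply: le_trans (normc_sum _ _ _) _.
apply: (@le_trans _ _ (\sum_(p <- deletions (j0 :: s)) K *
    ((\prod_(i < size s) (T + Num.sqrt (K * i.+1%:R))) * normc (f y)))).
  rewrite [leLHS]big_seq [leRHS]big_seq; apply: ler_sum => p ps; rewrite normcM.
  have sp := deletions_size ps; rewrite /= in sp.
  apply: ler_pM; rewrite ?normc_ge0// -sp; apply: IH.
  by rewrite sp; exact: ltnW.
rewrite big_const_seq iter_addr_0 count_predT size_deletions /= big_ord_recr /=.
rewrite -[leLHS]mulr_natl mulrA; set P := \prod_(i < _) _; have N0 : 0 <= normc (f y) by exact: normc_ge0.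
move: (normc (f y)) N0 => N N0.
rewrite [leRHS](_ : _ = ((T + Num.sqrt (K * (size s).+1%:R)) *
  Num.sqrt (K * (size s).+2%:R)) * (P * N)); last by ring.
apply: ler_wpM2r; first by rewrite mulr_ge0//; exact: P0.
apply: (@le_trans _ _ (Num.sqrt (K * (size s).+1%:R) * Num.sqrt (K * (size s).+1%:R))).
  by rewrite -expr2 sqr_sqrtr ?mulr_ge0// mulrC.
by apply: ler_pM; rewrite ?sqrtr_ge0// ?lerDr// ler_wsqrtr// ler_wpM2l// ler_nat.
Qed.

End gaussian_derivatives.

(** * Powers against factorials and exponentials *)

Section scalar_estimates.
Context {R : realType}.
Implicit Types (t x y theta delta : R) (k m : nat).

Lemma exprn_le_fact_expR x k : 0 <= x -> x ^+ k <= k`!%:R * expR x.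
Proof.
move=> x0; case: k => [|k]; first by rewrite fact0 mul1r expr0 -expR0 ler_expR.
rewrite -ler_pdivrMl ?ltr0n ?fact_gt0// mulrC.
by apply: le_trans (expR_ge1Dxn k x0); rewrite lerDr.
Qed.

(** This is s^k <= k! e^s at s = (delta/theta) t^(1/theta), raised to the power theta, since t =
    (theta/delta)^theta s^theta. Adding 1 to that constant secures 1 <= C. *)
Lemma exprn_le_gevrey theta delta : 0 < theta -> 0 < delta ->
  exists2 C : R, 1 <= C & forall t k, 0 <= t ->
    t ^+ k <= C ^+ k * k`!%:R `^ theta * expR (delta * t `^ theta^-1).
Proof.
move=> th0 d0; set c := (theta / delta) `^ theta.
have c0 : 0 <= c by exact: powR_ge0.
exists (1 + c); first by rewrite lerDl.
move=> t k t0; set s := delta / theta * t `^ theta^-1.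
have s0 : 0 <= s by rewrite !mulr_ge0 ?powR_ge0// ?invr_ge0 ltW.
have tE : t = c * s `^ theta.
  have sE : theta / delta * s = t `^ theta^-1.
    by rewrite /s; field; rewrite !gt_eqF.
  have td0 : 0 <= theta / delta by rewrite divr_ge0// ltW.
  by rewrite /c -(powRM _ td0 s0) sE -powRrM mulVf ?gt_eqF// powRr1.
have -> : delta * t `^ theta^-1 = s * theta.
  by rewrite /s mulrAC divfK ?gt_eqF.
rewrite expRM {1}tE exprMn -mulrA; apply: ler_pM; rewrite ?exprn_ge0 ?powR_ge0//.
  by apply: lerXn2r; rewrite ?nnegrE ?addr_ge0// lerDr.
rewrite -powRM ?expR_ge0// -powR_mulrn ?powR_ge0// powRAC powR_mulrn//.
apply: ge0_ler_powR; rewrite ?nnegrE ?mulr_ge0 ?exprn_ge0 ?expR_ge0//.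
  exact: ltW.
exact: exprn_le_fact_expR.
Qed.

(** The previous estimate with exponent 1/2 instead of [theta], followed by (k!)^(1/2) <=
    (k!)^theta. Here theta >= 1/2 makes Gaussians admissible test functions. *)
Lemma exprn_le_gevrey_sqr theta delta : 2^-1 <= theta -> 0 < delta ->
  exists2 C : R, 1 <= C & forall t k, 0 <= t ->
    t ^+ k <= C ^+ k * k`!%:R `^ theta * expR (delta * t ^+ 2).
Proof.
move=> th d0; have h0 : 0 < 2^-1 :> R by rewrite invr_gt0.
have [C C1 H] := exprn_le_gevrey h0 d0; exists C => // t k t0.
apply: le_trans (H _ _ t0) _; rewrite invrK powR_mulrn//.
rewrite ler_wpM2r ?expR_ge0// ler_wpM2l ?exprn_ge0 ?(le_trans ler01)//.
by rewrite ler_powR// -[1]/(1%:R) ler_nat fact_gt0.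
Qed.

Lemma exprn_add2 x y k : 0 <= x -> 0 <= y ->
  (x + y) ^+ k <= 2 ^+ k * (x ^+ k + y ^+ k).
Proof.
move=> x0 y0; wlog xy : x y x0 y0 / x <= y.
  by move=> H; case: (leP x y) => [/H->//|/ltW/H]; rewrite addrC [y ^+ k + _]addrC; apply.
apply: (@le_trans _ _ (2 ^+ k * y ^+ k)).
  by rewrite -exprMn lerXn2r ?nnegrE ?addr_ge0 ?mulr_ge0//; lra.
by rewrite ler_wpM2l ?exprn_ge0// lerDr exprn_ge0.
Qed.

Lemma powR_add2 x y r : 0 <= x -> 0 <= y -> 0 <= r ->
  (x + y) `^ r <= 2 `^ r * (x `^ r + y `^ r).
Proof.
move=> x0 y0 r0; wlog xy : x y x0 y0 / x <= y.
  by move=> H; case: (leP x y) => [/H->//|/ltW/H]; rewrite addrC [y `^ r + _]addrC; apply.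
apply: (@le_trans _ _ (2 `^ r * y `^ r)).
  by rewrite -powRM// ge0_ler_powR ?nnegrE ?addr_ge0 ?mulr_ge0//; lra.
by rewrite ler_wpM2l ?powR_ge0// lerDr powR_ge0.
Qed.

(** With r = 1/theta it turns the weights |x|^(1/theta) into quadratic ones, which Gaussian moments
    can absorb. *)
Lemma powR_le1sqr x r : 0 <= x -> 0 <= r -> r <= 2 -> x `^ r <= 1 + x ^+ 2.
Proof.
move=> x0 r0 r2; case: (leP x 1) => x1.
  apply: (@le_trans _ _ (1 `^ r)); last by rewrite powR1 lerDl sqr_ge0.
  by rewrite ge0_ler_powR ?nnegrE.
apply: (@le_trans _ _ (x `^ 2)); first by rewrite ler_powR// ltW.
by rewrite powR_mulrn// lerDr.
Qed.

End scalar_estimates.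

(** * Scalar product, sup norm and quadratic forms *)

Section dot_product.
Context {R : realType} (n : nat).
Implicit Types (x y z : 'rV[R]_n) (A : 'M[R]_n) (i j : 'I_n) (t : R).

Lemma dotC x y : dot x y = dot y x.
Proof. by apply: eq_bigr => i _; rewrite mulrC. Qed.

Lemma dotDl x y z : dot (x + y) z = dot x z + dot y z.
Proof. by rewrite /dot -big_split; apply: eq_bigr => i _; rewrite !mxE mulrDl. Qed.

Lemma dotDr x y z : dot x (y + z) = dot x y + dot x z.
Proof. by rewrite dotC dotDl !(dotC x). Qed.

Lemma dotZl t x y : dot (t *: x) y = t * dot x y.
Proof. by rewrite /dot mulr_sumr; apply: eq_bigr => i _; rewrite !mxE mulrA. Qed.

Lemma dotZr t x y : dot x (t *: y) = t * dot x y.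
Proof. by rewrite dotC dotZl dotC. Qed.

Lemma dotNl x y : dot (- x) y = - dot x y.
Proof. by rewrite -scaleN1r dotZl mulN1r. Qed.

Lemma dotNr x y : dot x (- y) = - dot x y.
Proof. by rewrite dotC dotNl dotC. Qed.

Lemma dot0l x : dot 0 x = 0.
Proof. by rewrite -(scale0r 0) dotZl mul0r. Qed.

Lemma dot0r x : dot x 0 = 0.
Proof. by rewrite dotC dot0l. Qed.

Definition dotE := (dotDl, dotDr, dotZl, dotZr, dotNl, dotNr, dot0l, dot0r).

Lemma dot_mulmx x y A : dot (x *m A) y = dot x (y *m A^T).
Proof.
rewrite /dot; under eq_bigr do rewrite mxE mulr_suml.
rewrite exchange_big; apply: eq_bigr => i _; rewrite mxE mulr_sumr.
by apply: eq_bigr => j _; rewrite mxE; ring.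
Qed.

Lemma dot_delta x i : dot x (delta_mx ord0 i) = x ord0 i.
Proof.
rewrite /dot (bigD1 i)//= big1 => [|j ji].
  by rewrite mxE !eqxx mulr1 addr0.
by rewrite mxE eqxx /= (negbTE ji) mulr0.
Qed.

Lemma dotxx_ge0 x : 0 <= dot x x.
Proof. by apply: sumr_ge0 => i _; rewrite -expr2 sqr_ge0. Qed.

Lemma coord_le_norm x i : `|x ord0 i| <= `|x|.
Proof.
rewrite [leRHS]mx_normrE; exact: (le_bigmax _ (fun p => `|x p.1 p.2|) (ord0, i)).
Qed.

Lemma entry_le_norm A i j : `|A i j| <= `|A|.
Proof.
rewrite [leRHS]mx_normrE; exact: (le_bigmax _ (fun p => `|A p.1 p.2|) (i, j)).
Qed.

Lemma norm_le_coord x t : 0 <= t -> (forall i, `|x ord0 i| <= t) -> `|x| <= t.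
Proof.
move=> t0 xt; rewrite [leLHS]mx_normrE; apply: bigmax_le => // -[i j] _ /=.
by rewrite ord1.
Qed.

Lemma norm_dot_le x y : `|dot x y| <= n%:R * `|x| * `|y|.
Proof.
apply: le_trans (ler_norm_sum _ _ _) _.
apply: (@le_trans _ _ (\sum_(i < n) `|x| * `|y|)).
  by apply: ler_sum => i _; rewrite normrM ler_pM ?coord_le_norm.
by rewrite sumr_const card_ord -[leLHS]mulr_natl mulrA.
Qed.

Lemma sqr_norm_le_dot x : `|x| ^+ 2 <= dot x x.
Proof.
rewrite -[leRHS]sqr_sqrtr ?dotxx_ge0// lerXn2r ?nnegrE ?sqrtr_ge0//.
apply: norm_le_coord => [|i]; first exact: sqrtr_ge0.
rewrite -sqrtr_sqr ler_wsqrtr// /dot (bigD1 i)//= -expr2 lerDl.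
by apply: sumr_ge0 => j _; rewrite -expr2 sqr_ge0.
Qed.

Lemma norm_mulmx_le x A : `|x *m A| <= n%:R * `|x| * `|A|.
Proof.
apply: norm_le_coord => [|i]; first by rewrite !mulr_ge0.
rewrite mxE; apply: le_trans (ler_norm_sum _ _ _) _.
apply: (@le_trans _ _ (\sum_(j < n) `|x| * `|A|)).
  by apply: ler_sum => j _; rewrite normrM ler_pM ?coord_le_norm ?entry_le_norm.
by rewrite sumr_const card_ord -[leLHS]mulr_natl mulrA.
Qed.

Definition qform A x : R := dot (x *m A) x.

(** The explicit constant [m] is what the Gaussian estimates consume; having it in the definition
    spares a compactness argument on the sphere. *)
Definition posdef A := A^T = A /\
  exists2 m : R, 0 < m & forall x, m * dot x x <= qform A x.

Lemma qformD A x y : A^T = A ->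
  qform A (x + y) = qform A x + 2 * dot (x *m A) y + qform A y.
Proof.
move=> As; rewrite /qform mulmxDl !dotE [dot (y *m A) x]dot_mulmx As.
by rewrite [dot y _]dotC; ring.
Qed.

Lemma qformZ A t x : qform A (t *: x) = t ^+ 2 * qform A x.
Proof. by rewrite /qform -scalemxAl !dotE mulrA. Qed.

Lemma qform1 x : qform 1%:M x = dot x x.
Proof. by rewrite /qform mulmx1. Qed.

Lemma qformDm A (B : 'M[R]_n) x : qform (A + B) x = qform A x + qform B x.
Proof. by rewrite /qform mulmxDr dotDl. Qed.

Lemma qformZm t A x : qform (t *: A) x = t * qform A x.
Proof. by rewrite /qform -scalemxAr dotZl. Qed.

End dot_product.

Section packet.
Context {R : realType} (n : nat).
Implicit Types (x xi y z : 'rV[R]_n) (A B : 'M[R]_n) (i j : 'I_n) (t : R).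
Local Notation D := (foldr (@pderiv R n)).
Local Notation e_ := (delta_mx (ord0 : 'I_1)).

Definition packet A B x xi y : R[i] :=
  cexp (- (2^-1 * qform A (y - x))) (- (dot xi y + 2^-1 * qform B (y - x))).

Lemma normc_packet A B x xi y :
  normc (packet A B x xi y) = expR (- (2^-1 * qform A (y - x))).
Proof. exact: normc_cexp. Qed.

Lemma is_derive_comp1 (g : 'rV[R]_n -> R) (h : R -> R) y v (dg dh : R) :
  is_derive (g y) 1 h dh -> is_derive y v g dg ->
  is_derive y v (fun y => h (g y)) (dh * dg).
Proof.
move=> hh [gd gv]; apply: is_derive_line.
have gl : is_derive (0 : R) 1 (fun t => g (t *: v + y)) dg.
  have E : (fun k : R => k^-1 *: (g ((k *: (1 : R) + 0) *: v + y) - g (0 *: v + y))) =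
      (fun k : R => k^-1 *: (g (k *: v + y) - g y)).
    by apply/funext => k; rewrite scale0r add0r addr0 /GRing.scale /= mulr1.
  split; first by rewrite /derivable E; exact: gd.
  by rewrite /derive E; exact: gv.
apply: (@is_derive1_comp _ h (fun t => g (t *: v + y))) => //.
by rewrite scale0r add0r.
Qed.

Lemma has_pderiv_cexp i (g1 g2 d1 d2 : 'rV[R]_n -> R) :
  (forall y, is_derive y (e_ i) g1 (d1 y)) ->
  (forall y, is_derive y (e_ i) g2 (d2 y)) ->
  has_pderiv i (fun y => cexp (g1 y) (g2 y))
    (fun y => (d1 y +i* d2 y) * cexp (g1 y) (g2 y)).
Proof.
move=> D1 D2 y.
have De : is_derive y (e_ i) (fun y => expR (g1 y)) (expR (g1 y) * d1 y).
  exact: (is_derive_comp1 (is_derive_expR _) (D1 y)).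
have Dc : is_derive y (e_ i) (fun y => cos (g2 y)) (- sin (g2 y) * d2 y).
  exact: (is_derive_comp1 (is_derive_cos _) (D2 y)).
have Ds : is_derive y (e_ i) (fun y => sin (g2 y)) (cos (g2 y) * d2 y).
  exact: (is_derive_comp1 (is_derive_sin _) (D2 y)).
split.
  rewrite (_ : (fun _ => _) = (fun y => expR (g1 y) * cos (g2 y))); last first.
    by apply/funext => z; rewrite cexpE.
  by apply: is_derive_eq; rewrite cexpE /GRing.scale /=; ring.
rewrite (_ : (fun _ => _) = (fun y => expR (g1 y) * sin (g2 y))); last first.
  by apply/funext => z; rewrite cexpE.
by apply: is_derive_eq; rewrite cexpE /GRing.scale /=; ring.
Qed.

Lemma is_derive_qform A x y i : A^T = A ->
  is_derive y (e_ i) (fun y => qform A (y - x)) (2 * ((y - x) *m A) ord0 i).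
Proof.
move=> As; apply: is_derive_line.
rewrite (_ : (fun _ => _) = (fun t : R => t ^+ 2 * qform A (e_ i) +
    t * (2 * ((y - x) *m A) ord0 i) + qform A (y - x))); last first.
  apply/funext => t; have -> : t *: e_ i + y - x = (y - x) + t *: e_ i.
    by rewrite -addrA addrC.
  by rewrite qformD// qformZ dotZr dot_delta; ring.
by apply: is_derive_eq; rewrite /GRing.scale /=; ring.
Qed.

Lemma is_derive_dot xi y i : is_derive y (e_ i) (fun y => dot xi y) (xi ord0 i).
Proof.
apply: is_derive_line.
rewrite (_ : (fun _ => _) = (fun t : R => t * xi ord0 i + dot xi y)).
  by apply: is_derive_eq; rewrite /GRing.scale /=; ring.
by apply/funext => t; rewrite !dotE dot_delta.
Qed.

(** The logarithmic derivative of the packet. It is affine in [y], with the entries of -(A + iB) as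
    constant derivatives, which is the situation of [foldr_pderiv_gaussian_le]. *)
Definition packet_slope A B x xi i y : R[i] :=
  - ((y - x) *m A) ord0 i +i* - (xi ord0 i + ((y - x) *m B) ord0 i).

Lemma has_pderiv_packet A B x xi i : A^T = A -> B^T = B ->
  has_pderiv i (packet A B x xi) (fun y => packet_slope A B x xi i y * packet A B x xi y).
Proof.
move=> As Bs; apply: has_pderiv_cexp => y.
  have := is_derive_qform x y i As => Dq.
  by apply: is_derive_eq; rewrite /GRing.scale /=; field.
have := is_derive_qform x y i Bs => Dq; have Dd := is_derive_dot xi y i.
by apply: is_derive_eq; rewrite /GRing.scale /=; field.
Qed.

Lemma is_derive_mulmx A x y i j :
  is_derive y (e_ j) (fun y => ((y - x) *m A) ord0 i) (A j i).
Proof.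
apply: is_derive_line.
rewrite (_ : (fun _ => _) = (fun t : R => t * A j i + ((y - x) *m A) ord0 i)).
  by apply: is_derive_eq; rewrite /GRing.scale /=; ring.
apply/funext => t; have -> : t *: e_ j + y - x = t *: e_ j + (y - x).
  by rewrite addrA.
by rewrite mulmxDl -scalemxAl -rowE !mxE.
Qed.

Lemma has_pderiv_packet_slope A B x xi i j :
  has_pderiv j (packet_slope A B x xi i) (fun=> - A j i +i* - B j i).
Proof.
move=> y; rewrite /packet_slope /=.
have := is_derive_mulmx A x y i j; have := is_derive_mulmx B x y i j => DB DA.
by split; apply: is_derive_eq; rewrite ?add0r.
Qed.

Lemma continuous_funsum (T : topologicalType) (I : Type) (r : seq I) (F : I -> T -> R) :
  (forall k, continuous (F k)) -> continuous (fun p => \sum_(k <- r) F k p).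
Proof.
move=> cF; elim: r => [|k r IH].
  by under eq_fun do rewrite big_nil; exact: cst_continuous.
by under eq_fun do rewrite big_cons; exact: continuous_funD.
Qed.

Lemma continuous_coordB i x : continuous (fun y : 'rV[R]_n => (y - x) ord0 i).
Proof.
under eq_fun do rewrite !mxE.
by apply: continuous_funD; [exact: coord_continuous|exact: cst_continuous].
Qed.

Lemma continuous_dot xi : continuous (dot xi).
Proof.
apply: continuous_funsum => i; apply: continuous_funM; first exact: cst_continuous.
exact: coord_continuous.
Qed.

Lemma continuous_qform A x : continuous (fun y : 'rV[R]_n => qform A (y - x)).
Proof.
apply: continuous_funsum => i; apply: continuous_funM; last exact: continuous_coordB.
under eq_fun do rewrite mxE.
apply: continuous_funsum => j; apply: continuous_funM; last exact: cst_continuous.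
exact: continuous_coordB.
Qed.

Lemma continuous_fun_comp (T : topologicalType) (f : T -> R) (h : R -> R) :
  continuous h -> continuous f -> continuous (fun p => h (f p)).
Proof.
by move=> ch cf y; apply: (@continuous_comp _ _ _ f h); [exact: cf|exact: ch].
Qed.

Lemma ccontinuous_cexp (g1 g2 : 'rV[R]_n -> R) : continuous g1 -> continuous g2 ->
  ccontinuous (fun y => cexp (g1 y) (g2 y)).
Proof.
move=> c1 c2; have ce := continuous_fun_comp (@continuous_expR R) c1.
split; under eq_fun do rewrite cexpE /=; apply: continuous_funM => //.
  exact: (continuous_fun_comp (@continuous_cos R) c2).
exact: (continuous_fun_comp (@continuous_sin R) c2).
Qed.

Lemma ccontinuous_packet A B x xi : ccontinuous (packet A B x xi).
Proof.
have cq (C : 'M[R]_n) : continuous (fun y : 'rV[R]_n => 2^-1 * qform C (y - x)).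
  by apply: continuous_funM; [exact: cst_continuous|exact: continuous_qform].
apply: ccontinuous_cexp; first exact: continuous_funN.
apply: continuous_funN; apply: continuous_funD => //; exact: continuous_dot.
Qed.

Lemma smooth_packet A B x xi : A^T = A -> B^T = B -> smooth (packet A B x xi).
Proof.
move=> As Bs; apply: (@polymul_smooth _ _ (packet A B x xi)); last first.
- exact: polymul_base.
- move=> i; exists (fun y => packet_slope A B x xi i y * packet A B x xi y);
    last exact: has_pderiv_packet.
  rewrite (_ : (fun _ => _) = (fun y => \sum_j (- A j i +i* - B j i) *
      ((y ord0 j)%:C * packet A B x xi y) +
      packet_slope A B x xi i 0 * packet A B x xi y)).
    rewrite (_ : (fun _ => _) = (fun y => 1 * \sum_j (- A j i +i* - B j i) *
      ((y ord0 j)%:C * packet A B x xi y) +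
      packet_slope A B x xi i 0 * packet A B x xi y)); last first.
      by apply/funext => y; rewrite mul1r.
    apply: polymul_lin; last by apply: polymulZ; exact: polymul_base.
    apply: polymul_sum => j; apply: polymulZ; apply: polymul_coord.
    exact: polymul_base.
  apply/funext => y; under eq_bigr do rewrite mulrA.
  rewrite -mulr_suml -mulrDl; congr (_ * _).
  have -> : \sum_j (- A j i +i* - B j i) * (y ord0 j)%:C =
      - (y *m A) ord0 i +i* - (y *m B) ord0 i.
    rewrite !mxE -!sumrN; elim/big_ind3: _ => //= [a1 a2 a3 b1 b2 b3 -> ->|j _].
      by simpc.
    by simpc; congr (_ +i* _); ring.
  rewrite /packet_slope !mulmxBl !mul0mx; simpc; rewrite !mxE.
  by congr (_ +i* _); ring.
- exact: ccontinuous_packet.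
Qed.

(** Gelfand-Shilov seminorms with words of derivatives, powers of the sup norm and factorials of
    total orders in place of multi-indices. [gevrey_bound_gs] returns to multi-indices at the cost
    of a factor in [C]. *)
Definition gevrey_bound (theta C M : R) (f : 'rV[R]_n -> R[i]) := forall s k y,
  `|y| ^+ k * normc (D f s y) <=
    M * C ^+ (k + size s) * (k`! * (size s)`!)%:R `^ theta.

Lemma normc_pderiv_packet_le A B x xi s y : A^T = A -> B^T = B ->
  let K := `|A| + `|B| in
  normc (D (packet A B x xi) s y) <=
  (n%:R * K * `|y - x| + `|xi| + Num.sqrt (K * (size s)%:R)) ^+ size s *
  expR (- (2^-1 * qform A (y - x))).
Proof.
move=> As Bs; set K := `|A| + `|B|; rewrite /=; have K0 : 0 <= K by rewrite addr_ge0.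
set T := n%:R * K * `|y - x| + `|xi|.
have T0 : 0 <= T by rewrite addr_ge0// !mulr_ge0.
rewrite -(normc_packet A B x xi).
apply: (le_trans (@foldr_pderiv_gaussian_le _ _ _ (packet_slope A B x xi)
  (fun i j => - A j i +i* - B j i) T K y s _ _ _ _ _ T0 K0)).
- exact: smooth_packet.
- by move=> i; exact: has_pderiv_packet.
- exact: has_pderiv_packet_slope.
- move=> i; apply: le_trans (normc_le_ReIm _) _; rewrite /= !normrN.
  apply: (@le_trans _ _ (n%:R * `|y - x| * `|A| + (`|xi| + n%:R * `|y - x| * `|B|))).
    apply: lerD; first by apply: le_trans (coord_le_norm _ _) _; exact: norm_mulmx_le.
    apply: le_trans (ler_normD _ _) _; apply: lerD; first exact: coord_le_norm.
    by apply: le_trans (coord_le_norm _ _) _; exact: norm_mulmx_le.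
  by rewrite le_eqVlt; apply/orP; left; apply/eqP; rewrite /T /K; ring.
- move=> i j; apply: le_trans (normc_le_ReIm _) _; rewrite /= !normrN.
  by apply: lerD; exact: entry_le_norm.
apply: ler_wpM2r; first exact: normc_ge0.
apply: (@le_trans _ _ (\prod_(i < size s) (T + Num.sqrt (K * (size s)%:R)))).
  apply: ler_prod => i _; rewrite addr_ge0 ?sqrtr_ge0//= lerD2l ler_wsqrtr//.
  by rewrite ler_wpM2l// ler_nat.
by rewrite prodr_const card_ord.
Qed.

End packet.

Section packet_bound.
Context {R : realType} (n : nat).
Implicit Types (x xi y z : 'rV[R]_n) (A B : 'M[R]_n) (i j : 'I_n) (t : R).
Local Notation D := (foldr (@pderiv R n)).

Lemma expR_qform_le A (m : R) y : 0 < m -> (forall y, m * dot y y <= qform A y) ->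
  let G := expR (m / 4 * `|y| ^+ 2) in expR (- (2^-1 * qform A y)) <= (G * G)^-1.
Proof.
move=> m0 Am /=; rewrite -expRD -expRN ler_expR lerN2 -mulrDl.
have h : m * `|y| ^+ 2 <= qform A y.
  by apply: le_trans (Am y); rewrite ler_wpM2l ?sqr_norm_le_dot// ltW.
by lra.
Qed.

Lemma gevrey_product_eq (a b c d e f g : R) : g != 0 ->
  2 * (a * b * (c * g)) * (3 * (d * e * (f * g)) * (g * g)^-1) =
  6 * (c * f) * (a * d) * (b * e).
Proof. by move=> g0; field. Qed.

Lemma gevrey_factor_le (a b F E E' : R) k : 0 <= a -> a <= b -> 0 <= F ->
  0 <= E -> 1 <= E' -> a ^+ k * F * E <= b ^+ k * F * (E * E').
Proof.
move=> a0 ab F0 E0 E1; have b0 := le_trans a0 ab.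
apply: ler_pM; first by rewrite mulr_ge0 ?exprn_ge0.
- exact: E0.
- by apply: ler_pM; rewrite ?exprn_ge0 ?lexx// lerXn2r.
- by rewrite ler_peMr.
Qed.

(** The decay of the packet is at least G^-2 with G = exp(m |y - x|^2/4): one factor G pays for
    |y|^k, the other for the derivatives. The remaining powers of |x| and |xi| are paid by the
    exponential weights. As [C] is the same for all centres, one continuity estimate for [u] serves
    all packets. *)
Lemma gevrey_bound_packet theta delta A B : 2^-1 <= theta -> 0 < delta ->
  posdef A -> B^T = B ->
  exists C M : R, [/\ 1 <= C, 0 < M & forall x xi, gevrey_bound theta C
    (M * expR (delta * (`|x| `^ theta^-1 + `|xi| `^ theta^-1))) (packet A B x xi)].
Proof.
move=> th d0 [As [m m0 Am]] Bs.
have th0 : 0 < theta by apply: lt_le_trans th; rewrite invr_gt0.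
have m80 : 0 < m / 4 by rewrite divr_gt0.
have [C1 C11 H1] := exprn_le_gevrey th0 d0.
have [C2 C21 H2] := exprn_le_gevrey_sqr th m80.
have [C3 C31 H3] := @exprn_le_gevrey_sqr R theta 1 th ltr01.
set K := `|A| + `|B|; have K0 : 0 <= K by rewrite addr_ge0.
set L := n%:R * K; have L0 : 0 <= L by rewrite mulr_ge0.
have C10 := le_trans ler01 C11; have C20 := le_trans ler01 C21.
have C30 := le_trans ler01 C31; have E0 := @expR_ge0 R.
set C4 := C3 * expR K.
have C40 : 0 <= C4 by rewrite mulr_ge0.
(* The Gevrey bound at t^2 = K p, whose exponential exp(K p) is a p-th power; this plays the role of
   Stirling's formula. *)
have HK p : Num.sqrt (K * p%:R) ^+ p <= C4 ^+ p * p`!%:R `^ theta.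
  apply: le_trans (H3 _ _ (sqrtr_ge0 _)) _.
  by rewrite mul1r sqr_sqrtr ?mulr_ge0// exprMn expRM_natr mulrAC.
have LC0 : 0 <= L * C2 by rewrite mulr_ge0.
(* Every use of [exprn_add2] costs a factor 2 per power: one use for |y|, one or two for the three
   terms that bound the derivatives. *)
have [C [Cge1 [CC1 CC2 CLC CCC1 CC4]]] : exists C : R, 1 <= C /\ [/\ 2 * C1 <= C,
    2 * C2 <= C, 2 * (2 * (L * C2)) <= C, 2 * (2 * C1) <= C & 2 * C4 <= C].
  by exists (4 * (1 + C1 + C2 + C4 + L * C2)); split; [|split]; lra.
have C0 := le_trans ler01 Cge1.
(* 6 = 2 * 3: two terms in the bound of |y|^k, three in the bound of the derivatives. *)
exists C, 6; split=> // x xi s k y; set p := size s; set Y := y - x.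
set X := `|x| `^ theta^-1; set Xi := `|xi| `^ theta^-1.
have X0 : 0 <= X by exact: powR_ge0.
have Xi0 : 0 <= Xi by exact: powR_ge0.
set G := expR (m / 4 * `|Y| ^+ 2).
have G1 : 1 <= G by rewrite -expR0 ler_expR mulr_ge0 ?exprn_ge0// ltW.
have eX1 : 1 <= expR (delta * X) by rewrite -expR0 ler_expR mulr_ge0// ltW.
have eXi1 : 1 <= expR (delta * Xi) by rewrite -expR0 ler_expR mulr_ge0// ltW.
have F0 q : 0 <= (q`!%:R : R) `^ theta by exact: powR_ge0.
have B1 : `|y| ^+ k <= 2 * (C ^+ k * k`!%:R `^ theta * (expR (delta * X) * G)).
  apply: (@le_trans _ _ ((`|x| + `|Y|) ^+ k)).
    rewrite lerXn2r ?nnegrE ?addr_ge0//.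
    by apply: le_trans (ler_normD _ _); rewrite /Y addrC subrK.
  apply: le_trans (exprn_add2 _ _ _) _ => //.
  rewrite mulr_natl mulr2n mulrDr; apply: lerD.
    apply: (@le_trans _ _ (2 ^+ k * (C1 ^+ k * k`!%:R `^ theta * expR (delta * X)))).
      by rewrite ler_wpM2l ?exprn_ge0//; exact: H1.
    rewrite (mulrA (2 ^+ k)) (mulrA (2 ^+ k)) -exprMn.
    by apply: gevrey_factor_le; [rewrite mulr_ge0|exact: CC1|exact: F0|exact: E0|exact: G1].
  apply: (@le_trans _ _ (2 ^+ k * (C2 ^+ k * k`!%:R `^ theta * G))).
    by rewrite ler_wpM2l ?exprn_ge0//; exact: H2.
  rewrite (mulrA (2 ^+ k)) (mulrA (2 ^+ k)) -exprMn (mulrC (expR _) G).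
  by apply: gevrey_factor_le; [rewrite mulr_ge0|exact: CC2|exact: F0|exact: E0|exact: eX1].
have B2 : (L * `|Y| + `|xi| + Num.sqrt (K * p%:R)) ^+ p <=
    3 * (C ^+ p * p`!%:R `^ theta * (expR (delta * Xi) * G)).
  have LY0 : 0 <= L * `|Y| by exact: mulr_ge0.
  have LX0 : 0 <= L * `|Y| + `|xi| by exact: addr_ge0.
  apply: le_trans (exprn_add2 p LX0 (sqrtr_ge0 _)) _.
  rewrite mulrDr (natrD R 2 1 : 3 = 2 + 1).
  rewrite [leRHS]mulrDl mul1r; apply: lerD; last first.
    apply: (@le_trans _ _ (2 ^+ p * (C4 ^+ p * p`!%:R `^ theta))).
      by apply: ler_wpM2l; [exact: exprn_ge0|exact: HK].
    rewrite [leLHS]mulrA -exprMn -[leLHS]mulr1 -[expR (delta * Xi) * G]mul1r.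
    by apply: gevrey_factor_le; [rewrite mulr_ge0|exact: CC4|exact: F0|exact: ler01|exact: mulr_ege1].
  apply: (@le_trans _ _ (2 ^+ p * (2 ^+ p * ((L * `|Y|) ^+ p + `|xi| ^+ p)))).
    by apply: ler_wpM2l; [exact: exprn_ge0|exact: (exprn_add2 p LY0 (normr_ge0 xi))].
  rewrite mulr_natl mulr2n !mulrDr; apply: lerD.
    apply: (@le_trans _ _ (2 ^+ p * (2 ^+ p * (L ^+ p * (C2 ^+ p * p`!%:R `^ theta * G))))).
      do 2! (apply: ler_wpM2l; first exact: exprn_ge0).
      by rewrite exprMn; apply: ler_wpM2l; [exact: exprn_ge0|exact: H2].
    rewrite (_ : 2 ^+ p * _ = (2 * (2 * (L * C2))) ^+ p * p`!%:R `^ theta * G).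
      rewrite (mulrC (expR _) G); apply: gevrey_factor_le; [|exact: CLC|exact: F0|exact: E0|exact: eXi1].
      by rewrite !mulr_ge0.
    by rewrite !exprMn; ring.
  apply: (@le_trans _ _ (2 ^+ p * (2 ^+ p * (C1 ^+ p * p`!%:R `^ theta * expR (delta * Xi))))).
    do 2! (apply: ler_wpM2l; first exact: exprn_ge0).
    exact: H1.
  rewrite (_ : 2 ^+ p * _ = (2 * (2 * C1)) ^+ p * p`!%:R `^ theta * expR (delta * Xi)).
    by apply: gevrey_factor_le; [rewrite !mulr_ge0|exact: CCC1|exact: F0|exact: E0|exact: G1].
  by rewrite !exprMn; ring.
have B3 : expR (- (2^-1 * qform A Y)) <= (G * G)^-1 by exact: expR_qform_le.
have G0 : 0 < G by exact: lt_le_trans ltr01 G1.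
apply: (@le_trans _ _ (2 * (C ^+ k * k`!%:R `^ theta * (expR (delta * X) * G)) *
    (3 * (C ^+ p * p`!%:R `^ theta * (expR (delta * Xi) * G)) * (G * G)^-1))).
  apply: ler_pM; [exact: exprn_ge0|exact: normc_ge0|exact: B1|].
  apply: le_trans (normc_pderiv_packet_le _ _ _ _ As Bs) _.
  apply: ler_pM; [|exact: E0|exact: B2|exact: B3].
  by apply: exprn_ge0; rewrite addr_ge0 ?sqrtr_ge0// addr_ge0// mulr_ge0.
rewrite natrM powRM; [|by []|by []].
rewrite exprD mulrDr expRD le_eqVlt; apply/orP; left; apply/eqP.
exact: (gevrey_product_eq _ _ _ _ _ _ (lt0r_neq0 G0)).
Qed.

End packet_bound.

(** * Comparison with the multi-index seminorms *)

Section gelfand_shilov_bounds.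
Context {R : realType} (n : nat) (theta : R).
Hypothesis theta_gt0 : 0 < theta.
Implicit Types (f g : 'rV[R]_n -> R[i]) (C M rho : R) (s : seq 'I_n).
Implicit Types (alpha beta : 'I_n -> nat).
Local Notation D := (foldr (@pderiv R n)).

Lemma mderivE beta f :
  mderiv beta f = D f (flatten [seq nseq (beta i) i | i <- enum 'I_n]).
Proof.
rewrite /mderiv; elim: (enum 'I_n) => //= i s ->.
rewrite foldr_cat; set g := foldr _ _ _.
by elim: (beta i) => //= k ->.
Qed.

Lemma size_mderiv_seq beta :
  size (flatten [seq nseq (beta i) i | i <- enum 'I_n]) = mdeg beta.
Proof.
rewrite size_flatten /shape -map_comp sumnE big_map big_enum /=.
by apply: eq_bigr => i _; rewrite size_nseq.
Qed.

Lemma norm_mpow_le (x : 'rV[R]_n) alpha : `|mpow x alpha| <= `|x| ^+ mdeg alpha.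
Proof.
rewrite /mpow /mdeg normr_prod -prodrXr.
by apply: ler_prod => i _; rewrite normr_ge0 normrX lerXn2r ?nnegrE ?coord_le_norm.
Qed.

Lemma bin_le_exp2 m k : ('C(m, k) <= 2 ^ m)%N.
Proof.
elim: m k => [|m IH] [|k]//; first by rewrite bin0 expn_gt0.
by rewrite binS expnS mul2n -addnn leq_add.
Qed.

Lemma fact_add_le k m : ((k + m)`! <= 2 ^ (k + m) * (k`! * m`!))%N.
Proof.
have kk := leq_addr m k.
by rewrite -(bin_fact kk) addKn leq_mul2r bin_le_exp2 orbT.
Qed.

(** Repeated use of (k + m)! <= 2^(k+m) k! m!, once per coordinate. *)
Lemma fact_mdeg_le alpha : ((mdeg alpha)`! <= 2 ^ (n * mdeg alpha) * mfact alpha)%N.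
Proof.
suff H (s : seq 'I_n) : ((\sum_(i <- s) alpha i)`! <=
    2 ^ (size s * \sum_(i <- s) alpha i) * \prod_(i <- s) (alpha i)`!)%N.
  by have := H (enum 'I_n); rewrite size_enum_ord !big_enum.
elim: s => [|i s IH]; first by rewrite !big_nil.
rewrite !big_cons /=; apply: leq_trans (fact_add_le _ _) _.
rewrite mulSn [(2 ^ (_ + size s * _))%N]expnD -!mulnA leq_mul2l; apply/orP; right.
rewrite mulnCA leq_mul2l; apply/orP; right; apply: leq_trans IH _.
by rewrite leq_mul2r leq_exp2l// leq_mul2l leq_addl !orbT.
Qed.

Definition gs_bounded C M f := forall alpha beta x,
  `|mpow x alpha| * normc (mderiv beta f x) <=
  M * C ^+ (mdeg alpha + mdeg beta) * (mfact alpha * mfact beta)%:R `^ theta.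

Lemma gs_bounded_norm C M f : 0 < C -> gs_bounded C M f -> (gs_norm theta C f <= M%:E)%E.
Proof.
move=> C0 H; apply: ge_ereal_sup => _ [alpha [beta [x ->]]]; rewrite lee_fin.
set F := (mfact alpha * mfact beta)%:R.
have F0 : 0 < F `^ theta by rewrite powR_gt0// ltr0n muln_gt0 !prodn_gt0// => i; exact: fact_gt0.
rewrite powRN -invfM mulrC ler_pdivrMr ?mulr_gt0 ?exprn_gt0// mulrA.
exact: H.
Qed.

Lemma gs_bounded_step C M f : 0 < C -> smooth f -> gs_bounded C M f ->
  gs_step theta C f.
Proof.
move=> C0 sf H; split => //; exact: le_lt_trans (gs_bounded_norm C0 H) (ltry _).
Qed.

(** The loss per order when the factorial of the total degree is replaced by the product of the
    factorials, both raised to the power theta. *)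
Definition gs_dim_cst : R := (2 ^ n)%:R `^ theta.

Lemma gs_dim_cst_ge1 : 1 <= gs_dim_cst.
Proof.
rewrite /gs_dim_cst -[leLHS](powRr0 (2 ^ n)%:R); apply: ler_powR; last exact: ltW.
by rewrite -[1]/(1%:R) ler_nat expn_gt0.
Qed.

Lemma gevrey_bound_gs C M f : 0 <= C -> 0 <= M -> gevrey_bound theta C M f ->
  gs_bounded (gs_dim_cst * C) M f.
Proof.
move=> C0 M0 H alpha beta x; set k := mdeg alpha; set m := mdeg beta.
apply: (@le_trans _ _ (`|x| ^+ k * normc (mderiv beta f x))).
  by rewrite ler_wpM2r ?normc_ge0// norm_mpow_le.
rewrite mderivE; apply: le_trans (H _ _ _) _; rewrite size_mderiv_seq -/m.
rewrite exprMn [gs_dim_cst ^+ _ * _]mulrC -!(mulrA M) -!mulrA.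
apply: ler_wpM2l; first exact: M0.
apply: ler_wpM2l; first exact: exprn_ge0.
rewrite /gs_dim_cst -powR_mulrn ?powR_ge0// powRAC -powRM ?exprn_ge0//.
rewrite powR_mulrn//; apply: ge0_ler_powR; rewrite ?nnegrE ?mulr_ge0 ?exprn_ge0//.
  exact: ltW.
rewrite -natrX -natrM ler_nat -expnM mulnDr expnD.
by rewrite mulnACA leq_mul// fact_mdeg_le.
Qed.

Lemma gevrey_bound_gelfand_shilov C M f : 0 < C -> 0 <= M -> smooth f ->
  gevrey_bound theta C M f -> gelfand_shilov theta f.
Proof.
move=> C0 M0 sf /(gevrey_bound_gs (ltW C0) M0) fb.
have c0 : 0 < gs_dim_cst * C by rewrite mulr_gt0// (lt_le_trans ltr01)// gs_dim_cst_ge1.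
by exists (gs_dim_cst * C); [exact: c0|exact: gs_bounded_step fb].
Qed.

Lemma gevrey_bound_lin C M M' c f g : smooth f -> smooth g ->
  gevrey_bound theta C M f -> gevrey_bound theta C M' g ->
  gevrey_bound theta C (normc c * M + M') (fun y => c * f y + g y).
Proof.
move=> sf sg Hf Hg s k y; rewrite foldr_pderiv_lin//.
rewrite !mulrDl; apply: (@le_trans _ _ (normc c * (`|y| ^+ k * normc (D f s y)) +
    `|y| ^+ k * normc (D g s y))).
  rewrite mulrCA -normcM -mulrDr ler_wpM2l ?exprn_ge0//; exact: le_normcD.
apply: lerD; last exact: Hg.
by rewrite -!mulrA ler_wpM2l ?normc_ge0// mulrA; exact: Hf.
Qed.

Lemma gevrey_bound_le C M M' f : 0 <= C -> M <= M' -> gevrey_bound theta C M f ->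
  gevrey_bound theta C M' f.
Proof.
move=> C0 MM' H s k y; apply: le_trans (H s k y) _.
by rewrite ler_wpM2r ?powR_ge0// ler_wpM2r// exprn_ge0.
Qed.

Lemma gevrey_bound_sum C (I : Type) (r : seq I) (c : I -> R[i]) (F : I -> 'rV[R]_n -> R[i])
    (M : I -> R) : 0 <= C ->
  (forall k, smooth (F k)) -> (forall k, gevrey_bound theta C (M k) (F k)) ->
  gevrey_bound theta C (\sum_(k <- r) normc (c k) * M k)
    (fun y => \sum_(k <- r) c k * F k y).
Proof.
move=> C0 sF HF; elim: r => [|k r IH].
  rewrite big_nil (_ : (fun _ => _) = (fun=> 0)).
    by move=> s k y; rewrite foldr_pderiv_cst0 normc0 mulr0 !mul0r.
  by apply/funext => y; rewrite big_nil.
rewrite big_cons (_ : (fun _ => _) = (fun y => c k * F k y + \sum_(k <- r) c k * F k y)).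
  apply: gevrey_bound_lin => //; apply: smooth_sum => j.
  rewrite (_ : (fun _ => _) = (fun y => c j * F j y + 0)).
    by apply: smooth_lin; [exact: sF|exact: smooth_cst].
  by apply/funext => y; rewrite addr0.
by apply/funext => y; rewrite big_cons.
Qed.

End gelfand_shilov_bounds.

(** * From uniform smallness to smallness in a larger step *)

Section landau_montel.
Context {R : realType}.

(** Two mean value points: (f(x+h) - f(x))/h = f'(c) with x < c < x+h, and f'(c) - f'(x) = f''(c')(c
    - x). *)
Lemma landau_ineq (f df ddf : R -> R) (eps B h : R) (x : R) :
  (forall t : R, is_derive t 1 f (df t)) -> (forall t : R, is_derive t 1 df (ddf t)) ->
  (forall t, `|f t| <= eps) -> (forall t, `|ddf t| <= B) -> 0 < h ->
  `|df x| <= 2 * eps / h + h * B.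
Proof.
move=> Df Ddf feps ddfB h0.
have cont (g dg : R -> R) (a b : R) : (forall t : R, is_derive t 1 g (dg t)) ->
    {within `[a, b], continuous g}.
  move=> Dg; apply: continuous_subspaceT => t.
  by apply: differentiable_continuous; apply/derivable1_diffP; have [] := Dg t.
have xh : x < x + h by rewrite ltrDl.
have [c cI fE] := MVT xh (fun t _ => Df t) (cont _ _ _ _ Df).
move: cI; rewrite in_itv /= => /andP[xc cxh].
have [c' _ dfE] := MVT xc (fun t _ => Ddf t) (cont _ _ _ _ Ddf).
have B0 : 0 <= B := le_trans (normr_ge0 _) (ddfB x).
have -> : df x = (f (x + h) - f x) / h - ddf c' * (c - x).
  rewrite fE -dfE [x + h]addrC addrK mulfK ?gt_eqF//; ring.
apply: le_trans (ler_normB _ _) _; apply: lerD.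
  rewrite normrM normfV (gtr0_norm h0) ler_wpM2r ?invr_ge0 ?(ltW h0)//.
  by apply: le_trans (ler_normB _ _) _; rewrite mulr_natl mulr2n lerD.
rewrite normrM mulrC ler_pM//.
by rewrite gtr0_norm ?subr_gt0// lerBlDl ltW.
Qed.

Variable n : nat.
Implicit Types (f g : 'rV[R]_n -> R[i]) (s : seq 'I_n) (x y : 'rV[R]_n).
Local Notation D := (foldr (@pderiv R n)).
Local Notation e_ := (delta_mx (ord0 : 'I_1)).

Lemma is_derive_along (f df : 'rV[R]_n -> R) (v y : 'rV[R]_n) :
  (forall z, is_derive z v f (df z)) ->
  forall t : R, is_derive t 1 (fun t => f (t *: v + y)) (df (t *: v + y)).
Proof.
move=> Df t; have [dz vz] := Df (t *: v + y).
have E : (fun k : R => k^-1 *: (f ((k *: (1 : R) + t) *: v + y) - f (t *: v + y))) =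
    (fun k : R => k^-1 *: (f (k *: v + (t *: v + y)) - f (t *: v + y))).
  by apply/funext => k; rewrite scalerDl addrA /GRing.scale /= mulr1.
split; first by rewrite /derivable E; exact: dz.
by rewrite /derive E; exact: vz.
Qed.

Lemma landau_pderiv f i (eps B h : R) y : smooth f ->
  (forall z, normc (f z) <= eps) ->
  (forall z, normc (pderiv i (pderiv i f) z) <= B) -> 0 < h ->
  normc (pderiv i f y) <= 2 * (2 * eps / h + h * B).
Proof.
move=> sf feps ddfB h0.
have D1 := smooth_has_pderiv i sf.
have D2 := smooth_has_pderiv i (smooth_pderiv i sf).
apply: le_trans (normc_le_ReIm _) _; rewrite mulr_natl mulr2n; apply: lerD.
  have -> : complex.Re (pderiv i f y) = complex.Re (pderiv i f (0 *: e_ i + y)).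
    by rewrite scale0r add0r.
  apply: (@landau_ineq (fun t => complex.Re (f (t *: e_ i + y)))
    (fun t => complex.Re (pderiv i f (t *: e_ i + y)))
    (fun t => complex.Re (pderiv i (pderiv i f) (t *: e_ i + y)))
    eps B h 0 (is_derive_along y (fun z => (D1 z).1))
    (is_derive_along y (fun z => (D2 z).1)) _ _ h0) => t.
    exact: le_trans (Re_le_normc _) (feps _).
  exact: le_trans (Re_le_normc _) (ddfB _).
have -> : complex.Im (pderiv i f y) = complex.Im (pderiv i f (0 *: e_ i + y)).
  by rewrite scale0r add0r.
apply: (@landau_ineq (fun t => complex.Im (f (t *: e_ i + y)))
    (fun t => complex.Im (pderiv i f (t *: e_ i + y)))
    (fun t => complex.Im (pderiv i (pderiv i f) (t *: e_ i + y)))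
    eps B h 0 (is_derive_along y (fun z => (D1 z).2))
    (is_derive_along y (fun z => (D2 z).2)) _ _ h0) => t.
  exact: le_trans (Im_le_normc _) (feps _).
exact: le_trans (Im_le_normc _) (ddfB _).
Qed.

Variables (theta C M : R).
Hypotheses (theta_gt0 : 0 < theta) (C_ge1 : 1 <= C) (M_gt0 : 0 < M).

Let bounded (g : 'rV[R]_n -> R[i]) := smooth g /\ gevrey_bound theta C M g.
Let cst (k m : nat) : R := M * C ^+ (k + m) * (k`! * m`!)%:R `^ theta.

Let cst_ge0 k m : 0 <= cst k m.
Proof.
rewrite mulr_ge0 ?powR_ge0// mulr_ge0 ?(ltW M_gt0)// exprn_ge0//.
exact: le_trans C_ge1.
Qed.

(** Induction on the order: Landau's inequality bounds one more derivative by the preceding order,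
    which is small, and by the following order, which [bounded] controls uniformly in g. *)
Lemma small_derivatives m (rho : R) : 0 < rho -> exists2 eps, 0 < eps &
  forall g, bounded g -> (forall y, normc (g y) <= eps) ->
  forall s y, size s = m -> normc (D g s y) <= rho.
Proof.
elim: m rho => [|m IH] rho rho0.
  by exists rho => // g _ grho s y /size0nil->; exact: grho.
set B := cst 0 m.+2 + 1.
have B0 : 0 < B by rewrite ltr_wpDl// cst_ge0.
(* With this h the term h B equals rho/4, and the induction hypothesis at h rho/8 contributes
   another rho/4; the factor 2 of [landau_pderiv] then gives rho. *)
set h := rho / (4 * B).
have h0 : 0 < h by rewrite divr_gt0// mulr_gt0.
have [|eps eps0 H] := IH (h * rho / 8); first by rewrite divr_gt0// mulr_gt0.
exists eps => // g gb geps [|i s] y //= [sm].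
have [sg gg] := gb.
apply: (le_trans (@landau_pderiv (D g s) i (h * rho / 8) B h y _ _ _ h0)).
- exact: smooth_foldr.
- by move=> z; exact: H.
- move=> z; have := gg (i :: i :: s) 0%N z; rewrite expr0 mul1r /= sm => gB.
  by apply: le_trans gB _; rewrite lerDl.
- rewrite le_eqVlt; apply/orP; left; apply/eqP.
  rewrite [h * rho]mulrC; rewrite /h; field.
  by rewrite (gt_eqF rho0) (gt_eqF B0).
Qed.

(** Beyond radius r the bound with k+1 powers of |y| already yields rho; inside, |y|^k <= r^k and
    [small_derivatives] suffices. *)
Lemma small_seminorm k m (rho : R) : 0 < rho -> exists2 eps, 0 < eps &
  forall g, bounded g -> (forall y, normc (g y) <= eps) ->
  forall s y, size s = m -> `|y| ^+ k * normc (D g s y) <= rho.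
Proof.
move=> rho0; set r := (cst k.+1 m + 1) / rho.
have c0 : 0 < cst k.+1 m + 1 by rewrite ltr_wpDl// cst_ge0.
have r0 : 0 < r by rewrite divr_gt0.
have [|eps eps0 H] := @small_derivatives m (rho / r ^+ k).
  by rewrite divr_gt0// exprn_gt0.
exists eps => // g gb geps s y sm; have [yr|ry] := leP `|y| r.
  apply: (@le_trans _ _ (r ^+ k * (rho / r ^+ k))).
    apply: ler_pM; [exact: exprn_ge0|exact: normc_ge0| |exact: H].
    by rewrite lerXn2r ?nnegrE ?(ltW r0).
  by rewrite mulrCA divff ?mulr1// expf_neq0// gt_eqF.
have [_ /(_ s k.+1 y)] := gb; rewrite sm => gB.
have : r * (`|y| ^+ k * normc (D g s y)) <= cst k.+1 m + 1.
  rewrite mulrA; apply: (@le_trans _ _ (cst k.+1 m)); last by rewrite lerDl.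
  apply: le_trans gB; rewrite ler_wpM2r ?normc_ge0// exprS.
  by rewrite ler_wpM2r ?exprn_ge0// ltW.
by rewrite -ler_pdivlMl// /r invf_div divfK// gt_eqF.
Qed.

Lemma small_seminorms N (rho : R) : 0 < rho -> exists2 eps, 0 < eps &
  forall g, bounded g -> (forall y, normc (g y) <= eps) ->
  forall s k y, (k + size s < N)%N -> `|y| ^+ k * normc (D g s y) <= rho.
Proof.
move=> rho0.
have [eps eps0 H] : exists2 eps, 0 < eps & forall g, bounded g ->
    (forall y, normc (g y) <= eps) -> forall p, p \in
    [seq (k, m) | k <- iota 0 N, m <- iota 0 N] ->
    forall s y, size s = p.2 -> `|y| ^+ p.1 * normc (D g s y) <= rho.
  elim: [seq _ | _ <- _, _ <- _] => [|[k m] r [eps eps0 IH]]; first by exists 1.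
  have [eps' eps'0 H] := small_seminorm k m rho0.
  exists (Num.min eps eps'); first by rewrite lt_min eps0 eps'0.
  move=> g gb geps p; rewrite in_cons => /orP[/eqP->|pr].
    apply: H => // y; apply: le_trans (geps y) _.
    by rewrite ge_min lexx orbT.
  apply: IH => // y; apply: le_trans (geps y) _.
  by rewrite ge_min lexx.
exists eps => // g gb geps s k y ksN; apply: (H g gb geps (k, size s)) => //.
apply: allpairs_f; rewrite mem_iota add0n /=.
  exact: leq_ltn_trans (leq_addr _ _) ksN.
exact: leq_ltn_trans (leq_addl _ _) ksN.
Qed.

(** A quantitative form of the compactness of the step C in the step 2C. At total order N or more,
    passing from C to 2C gains 2^N > M/rho; the finitely many lower orders are made small by
    [small_seminorms]. *)
Lemma gevrey_small (rho : R) : 0 < rho -> exists2 eps, 0 < eps &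
  forall g, smooth g -> gevrey_bound theta C M g ->
  (forall y, normc (g y) <= eps) -> gevrey_bound theta (2 * C) rho g.
Proof.
move=> rho0.
have [N MN] : exists N : nat, M / rho < N%:R.
  by exists (Num.bound (M / rho)); exact: (archi_boundP (ltW (divr_gt0 M_gt0 rho0))).
have [eps eps0 H] := small_seminorms N rho0.
exists eps => // g sg gg geps s k y.
have F1 : 1 <= ((k`! * (size s)`!)%:R : R) `^ theta.
  rewrite -[leLHS](powRr0 (k`! * (size s)`!)%:R); apply: ler_powR; last exact: ltW.
  by rewrite -[1]/(1%:R) ler_nat muln_gt0 !fact_gt0.
have C0 : 0 <= C by exact: le_trans C_ge1.
have [ksN|Nks] := ltnP (k + size s) N.
  apply: le_trans (H g (conj sg gg) geps s k y ksN) _.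
  rewrite -mulrA ler_peMr ?(ltW rho0)// mulr_ege1// exprn_ege1//.
  by rewrite (le_trans C_ge1)// ler_peMl// ler1n.
apply: le_trans (gg s k y) _.
rewrite ler_wpM2r ?powR_ge0// exprMn mulrA ler_wpM2r ?exprn_ge0//.
rewrite -ler_pdivrMl// mulrC; apply: le_trans (ltW MN) _.
rewrite -natrX ler_nat; apply: leq_trans (ltnW (ltn_expl N (isT : (1 < 2)%N))) _.
by rewrite leq_exp2l.
Qed.

End landau_montel.

(** * Boundedness of the functional on each step *)

Section dual_bound.
Context {R : realType} (n : nat) (theta : R).
Hypothesis theta_gt0 : 0 < theta.
Variable u : ('rV[R]_n -> R[i]) -> R[i].
Hypothesis u_dual : gs_dual theta u.
Local Notation gs := (gelfand_shilov theta).

Lemma gelfand_shilov0 : gs (fun _ : 'rV[R]_n => 0 : R[i]).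
Proof.
apply: (@gevrey_bound_gelfand_shilov _ _ _ theta_gt0 1 0) => //.
  exact: smooth_cst.
by move=> s k y; rewrite foldr_pderiv_cst0 normc0 mulr0 !mul0r.
Qed.

Lemma dual0 : u (fun=> 0) = 0.
Proof.
have [lin _] := u_dual; have := lin _ _ (- 1) gelfand_shilov0 gelfand_shilov0.
rewrite (_ : (fun _ => _) = (fun=> 0)); last by apply/funext => x; rewrite mulN1r addr0 oppr0.
by rewrite mulN1r addNr.
Qed.

Lemma dualZ c f : gs f -> u (fun y => c * f y) = c * u f.
Proof.
move=> gf; have [lin _] := u_dual; have := lin _ _ c gf gelfand_shilov0.
rewrite dual0 addr0 => <-; congr u; apply/funext => y; by rewrite addr0.
Qed.

(** Continuity at 0 with threshold 1 provides a neighbourhood whose trace on the step contains a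
    ball of radius r; scaling [g] by r/rho moves it into this ball, hence K = 1/r. *)
Lemma dual_bounded C : 1 <= C -> exists2 K : R, 0 < K & forall g (rho : R), 0 < rho ->
  smooth g -> gevrey_bound theta C rho g -> normc (u g) <= K * rho.
Proof.
move=> C1; have C0 : 0 < C := lt_le_trans ltr01 C1.
have [_ cont] := u_dual.
have [W [Wgs _ Wn Wu]] := cont _ 1 gelfand_shilov0 ltr01.
have G0 : 0 < gs_dim_cst n theta * C.
  by rewrite mulr_gt0// (lt_le_trans ltr01)// gs_dim_cst_ge1.
have [r r0 Wr] := Wn _ G0.
exists r^-1; first by rewrite invr_gt0.
move=> g rho rho0 sg gg.
have gsg : gs g by apply: gevrey_bound_gelfand_shilov gg => //; exact: ltW.
set c : R[i] := (r / rho)%:C.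
have nc : normc c = r / rho by rewrite normc_real gtr0_norm// divr_gt0.
have sh : smooth (fun y => c * g y + 0) by apply: smooth_lin; [exact: sg|exact: smooth_cst].
have gh : gevrey_bound theta C r (fun y => c * g y + 0).
  have -> : r = normc c * rho + 0 by rewrite nc addr0 divfK// gt_eqF.
  apply: gevrey_bound_lin; [exact: sg|exact: smooth_cst|exact: gg|].
  by move=> s k y; rewrite foldr_pderiv_cst0 normc0 mulr0 !mul0r.
have hb := gevrey_bound_gs theta_gt0 (ltW C0) (ltW r0) gh.
have /Wr/(_ (gs_bounded_norm G0 hb))/Wu := gs_bounded_step G0 sh hb.
rewrite /= dual0 subr0 (_ : (fun _ => _) = (fun y => c * g y)); last first.
  by apply/funext => y; rewrite add0r addr0.
rewrite (dualZ _ gsg) normcM nc -ltr_pdivlMl ?divr_gt0// invf_div mulr1 => h.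
by rewrite ltW// mulrC.
Qed.

End dual_bound.

(** * Change of window *)

Section cosh_gaussian.
Context {R : realType}.
Implicit Types (f df : R -> R) (s t a x : R) (w : R[i]) (n i : nat).

Lemma MVT_derive f df a x : a < x -> (forall t : R, is_derive t 1 f (df t)) ->
  exists2 c, a < c < x & f x - f a = df c * (x - a).
Proof.
move=> ax Df; have [|c cI fE] := MVT ax (fun t _ => Df t).
  apply: continuous_subspaceT => t.
  by apply: differentiable_continuous; apply/derivable1_diffP; have [] := Df t.
by exists c.
Qed.

Lemma derive_ge0_ndecr f df x : (forall t : R, is_derive t 1 f (df t)) ->
  (forall t, 0 < t -> 0 <= df t) -> 0 <= x -> f 0 <= f x.
Proof.
move=> Df df0; rewrite le_eqVlt => /orP[/eqP<-//|x0].
have [c /andP[c0 _] fE] := MVT_derive x0 Df.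
by rewrite -subr_ge0 fE mulr_ge0 ?df0// subr0 ltW.
Qed.

(** Integration of a Taylor remainder by the mean value theorem. The factor 1/(k+1) is given away,
    since only the order in t matters. *)
Lemma taylor_step f df (K : R) k : 0 <= K -> f 0 = 0 ->
  (forall t : R, is_derive t 1 f (df t)) ->
  (forall t, `|t| <= 1 -> `|df t| <= K * `|t| ^+ k) ->
  forall t, `|t| <= 1 -> `|f t| <= K * `|t| ^+ k.+1.
Proof.
move=> K0 f0 Df dfK t t1.
have step (c : R) : `|c| <= `|t| -> f t = df c * t -> `|f t| <= K * `|t| ^+ k.+1.
  move=> ct ->; rewrite normrM exprSr mulrA ler_wpM2r//.
  apply: le_trans (dfK _ (le_trans ct t1)) _.
  by rewrite ler_wpM2l// lerXn2r.
have [t0|t0|->] := ltgtP t 0; last by rewrite f0 normr0 mulr_ge0// exprn_ge0.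
  have [c /andP[tc c0] fE] := MVT_derive t0 Df.
  apply: (step c); first by rewrite !ltr0_norm// lerN2 ltW.
  by move: fE; rewrite f0 => fE; lra.
have [c /andP[c0 ct] fE] := MVT_derive t0 Df.
apply: (step c); first by rewrite !gtr0_norm// ltW.
by move: fE; rewrite f0 !subr0.
Qed.

Let e1 : R := expR 1.

Lemma expR_taylor2 t : `|t| <= 1 -> `|expR t - 1 - t - t ^+ 2 / 2| <= e1 * `|t| ^+ 3.
Proof.
have e0 : 0 <= e1 by exact: expR_ge0.
apply: (@taylor_step (fun t => expR t - 1 - t - t ^+ 2 / 2) (fun t => expR t - 1 - t) e1 2) => //.
- by rewrite /= expR0; field.
- by move=> {}t; apply: is_derive_eq; rewrite /GRing.scale /=; field.
apply: (@taylor_step (fun t => expR t - 1 - t) (fun t => expR t - 1) e1 1) => //.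
- by rewrite /= expR0; ring.
- by move=> {}t; apply: is_derive_eq; rewrite /GRing.scale /=; ring.
apply: (@taylor_step (fun t => expR t - 1) (fun t => expR t) e1 0) => //.
- by rewrite /= expR0; ring.
- by move=> {}t; apply: is_derive_eq; rewrite /GRing.scale /=; ring.
move=> {}t t1; rewrite expr0 mulr1 ger0_norm ?expR_ge0// ler_expR.
exact: le_trans (ler_norm _) t1.
Qed.

Lemma cos_taylor2 t : `|t| <= 1 -> `|cos t - 1 + t ^+ 2 / 2| <= `|t| ^+ 3.
Proof.
move=> t1; rewrite -[leRHS]mul1r; move: t t1.
apply: (@taylor_step (fun t => cos t - 1 + t ^+ 2 / 2) (fun t => t - sin t) 1 2) => //.
- by rewrite /= cos0; field.
- by move=> {}t; apply: is_derive_eq; rewrite /GRing.scale /=; field.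
apply: (@taylor_step (fun t => t - sin t) (fun t => 1 - cos t) 1 1) => //.
- by rewrite /= sin0; ring.
apply: (@taylor_step (fun t => 1 - cos t) (fun t => sin t) 1 0) => //.
- by rewrite /= cos0; ring.
- by move=> {}t; apply: is_derive_eq; rewrite /GRing.scale /=; ring.
by move=> {}t _; rewrite expr0 mulr1 ler_norml sin_geN1 sin_le1.
Qed.

Lemma sin_taylor2 t : `|t| <= 1 -> `|sin t - t| <= `|t| ^+ 3.
Proof.
move=> t1; rewrite -[leRHS]mul1r; move: t t1.
apply: (@taylor_step (fun t => sin t - t) (fun t => cos t - 1) 1 2) => //.
- by rewrite /= sin0; ring.
apply: (@taylor_step (fun t => cos t - 1) (fun t => - sin t) 1 1) => //.
- by rewrite /= cos0; ring.
- by move=> {}t; apply: is_derive_eq; rewrite /GRing.scale /=; ring.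
apply: (@taylor_step (fun t => - sin t) (fun t => - cos t) 1 0) => //.
- by rewrite /= sin0 oppr0.
by move=> {}t _; rewrite expr0 mulr1 normrN ler_norml cos_geN1 cos_le1.
Qed.

Lemma cexp_taylor2 : exists2 K : R, 0 <= K & forall s t b : R,
  `|s| <= b -> `|t| <= b -> b <= 1 ->
  normc (cexp s t - (1 + (s +i* t) + ((s ^+ 2 - t ^+ 2) / 2 +i* (s * t)))) <= K * b ^+ 3.
Proof.
exists (8 * (e1 + 1)); first by rewrite mulr_ge0// addr_ge0// expR_ge0.
move=> s t b sb tb b1.
have b0 : 0 <= b := le_trans (normr_ge0 _) sb.
have b30 : 0 <= b ^+ 3 by rewrite exprn_ge0.
have pw (x : R) : `|x| <= b -> `|x| ^+ 3 <= b ^+ 3 by move=> xb; rewrite lerXn2r.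
have E0 := @expR_ge0 R 1.
have E1 : `|expR s| <= e1.
  rewrite ger0_norm ?expR_ge0// ler_expR (le_trans (ler_norm _))//.
  exact: le_trans sb b1.
have r1 : `|expR s - 1 - s - s ^+ 2 / 2| <= e1 * b ^+ 3.
  apply: le_trans (expR_taylor2 (le_trans sb b1)) _.
  by rewrite ler_wpM2l ?expR_ge0// pw.
have r2 := le_trans (cos_taylor2 (le_trans tb b1)) (pw _ tb).
have r3 := le_trans (sin_taylor2 (le_trans tb b1)) (pw _ tb).
set p1 := expR s - 1 - s - s ^+ 2 / 2 in r1.
set p2 := cos t - 1 + t ^+ 2 / 2 in r2.
set p3 := sin t - t in r3.
have m3 (x y z : R) : `|x| <= b -> `|y| <= b -> `|z| <= b -> `|x * y * z| <= b ^+ 3.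
  move=> xb yb zb; rewrite !normrM (_ : b ^+ 3 = b * b * b); last by ring.
  by rewrite !ler_pM ?mulr_ge0.
have s1 : `|s| <= 1 := le_trans sb b1.
have t1 : `|t| <= 1 := le_trans tb b1.
have m1 (x y c d : R) : `|x| <= c -> `|y| <= d -> `|x * y| <= c * d.
  by move=> xc yd; rewrite normrM ler_pM.
have q1 := m1 _ _ _ _ E1 r2.
have q2 : `|p1 * (1 - t ^+ 2 / 2)| <= e1 * b ^+ 3 * 2.
  apply: m1 => //; have : `|t ^+ 2| <= 1 by rewrite normrX exprn_ile1.
  by rewrite !ler_norml => /andP[h1 h2]; apply/andP; split; lra.
have q3 := m3 _ _ _ sb tb tb.
have q4 : `|s * s * t * t| <= b ^+ 3 * 1 by apply: m1 => //; exact: m3.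
have q5 := m1 _ _ _ _ E1 r3.
have q6 := m1 _ _ _ _ r1 t1.
have q7 := m3 _ _ _ sb sb tb.
apply: le_trans (normc_le_ReIm _) _; rewrite cexpE /=.
(* Exact identities that isolate the three real remainders; the monomials left over have degree at
   least three and are bounded by b^3 because b <= 1. *)
have -> : expR s * cos t - (1 + s + (s ^+ 2 - t ^+ 2) / 2) =
    expR s * p2 + p1 * (1 - t ^+ 2 / 2) - s * t * t / 2 - s * s * t * t / 4.
  by rewrite /p1 /p2; field.
have -> : expR s * sin t - (0 + t + s * t) =
    expR s * p3 + p1 * t + s * s * t / 2.
  by rewrite /p1 /p3; field.
move: (expR s * p2) (p1 * (1 - t ^+ 2 / 2)) (s * t * t) (expR s * p3)
  (p1 * t) (s * s * t) (s * s * t * t) q1 q2 q3 q4 q5 q6 q7 => {p1 p2 p3 r1 r2 r3 m3 m1 pw}.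
move=> v1 v2 v3 v5 v6 v7 v4 q1 q2 q3 q4 q5 q6 q7.
have p0 : 0 <= e1 * b ^+ 3 by rewrite mulr_ge0.
rewrite (_ : 8 * (e1 + 1) * b ^+ 3 = 8 * (e1 * b ^+ 3) + 8 * b ^+ 3); last by ring.
move: (b ^+ 3) (e1 * b ^+ 3) p0 b30 q1 q2 q3 q4 q5 q6 q7 => Y X X0 Y0.
rewrite !ler_norml => /andP[? ?] /andP[? ?] /andP[? ?] /andP[? ?] /andP[? ?] /andP[? ?] /andP[? ?].
have h1 : `|v1 + v2 - v3 / 2 - v4 / 4| <= 3 * X + Y.
  by rewrite ler_norml; apply/andP; split; lra.
have h2 : `|v5 + v6 + v7 / 2| <= 3 * X + Y.
  by rewrite ler_norml; apply/andP; split; lra.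
by lra.
Qed.

Definition ccosh s t : R[i] := (cexp s t + cexp (- s) (- t)) / 2%:R.

(** With tau = s + i t, both cosh tau and exp(tau^2/2) are 1 + tau^2/2 up to order three, as the
    linear terms cancel in the half sum. Order three is enough: the error is used n times at scale
    n^(-1/2). *)
Lemma ccosh_taylor : exists2 K : R, 0 <= K & forall s t b : R,
  `|s| <= b -> `|t| <= b -> b <= 1 ->
  normc (ccosh s t - cexp ((s ^+ 2 - t ^+ 2) / 2) (s * t)) <= K * b ^+ 3.
Proof.
have [K K0 HK] := cexp_taylor2; exists (2 * K + 2); first by rewrite addr_ge0// mulr_ge0.
move=> s t b sb tb b1.
have b0 : 0 <= b := le_trans (normr_ge0 _) sb.
have b2b : b ^+ 2 <= b by rewrite expr2 ler_piMl.
have b21 := le_trans b2b b1.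
have m2 (x y : R) : `|x| <= b -> `|y| <= b -> `|x * y| <= b ^+ 2.
  by move=> xb yb; rewrite normrM expr2 ler_pM.
set s' := (s ^+ 2 - t ^+ 2) / 2; set t' := s * t.
have s'b : `|s'| <= b ^+ 2.
  have := m2 _ _ sb sb; have := m2 _ _ tb tb; rewrite -!expr2 /s' !ler_norml.
  by move=> /andP[? ?] /andP[? ?]; apply/andP; split; lra.
have t'b : `|t'| <= b ^+ 2 by exact: m2.
have h1 := HK _ _ _ sb tb b1.
have h2 : normc (cexp (- s) (- t) - (1 + (- s +i* - t) + (s' +i* t'))) <= K * b ^+ 3.
  have := HK (- s) (- t) b; rewrite !normrN !sqrrN mulrNN; exact.
have h3 := HK _ _ _ s'b t'b b21.
set A := cexp s t - _ in h1; set B := cexp (- s) (- t) - _ in h2.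
set C := cexp s' t' - _ in h3.
(* The second order term of the exponential at tau^2/2: it has degree four in tau and counts as
   error. *)
set Q := (s' ^+ 2 - t' ^+ 2) / 2 +i* (s' * t') in C h3.
have -> : ccosh s t - cexp s' t' = (A + B) / 2%:R - C - Q.
  have nz : 2%:R != 0 :> R[i] by rewrite pnatr_eq0.
  rewrite /ccosh /A /B /C -/s' -/t'.
  have -> : - s +i* - t = - (s +i* t) by [].
  by field.
have b4 : b ^+ 2 ^+ 2 <= b ^+ 3.
  by rewrite -exprM (_ : (2 * 2 = 3 + 1)%N)// exprD expr1 ler_piMr ?exprn_ge0.
have b6 : b ^+ 2 ^+ 3 <= b ^+ 3.
  by rewrite lerXn2r ?nnegrE ?exprn_ge0.
have hQ : normc Q <= 2 * b ^+ 3.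
  apply: le_trans (normc_le_ReIm _) _ => /=.
  have p2 (x y : R) : `|x| <= b ^+ 2 -> `|y| <= b ^+ 2 -> `|x * y| <= b ^+ 3.
    move=> xb yb; apply: le_trans b4; rewrite normrM expr2.
    by rewrite ler_pM.
  have := p2 _ _ s'b s'b; have := p2 _ _ t'b t'b; have := p2 _ _ s'b t'b.
  rewrite -!expr2 => q1.
  have q2 : `|(s' ^+ 2 - t' ^+ 2) / 2| <= b ^+ 3 -> `|(s' ^+ 2 - t' ^+ 2) / 2| + `|s' * t'| <= 2 * b ^+ 3.
    by move: q1; lra.
  move: (s' ^+ 2) (t' ^+ 2) q2 => x y q2; rewrite !ler_norml.
  move=> /andP[? ?] /andP[? ?]; apply: q2; rewrite ler_norml.
  by apply/andP; split; lra.
have n2 : normc (2%:R^-1 : R[i]) = 2^-1.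
  rewrite normcV; congr (_^-1).
  have -> : 2%:R = 2%:R%:C :> R[i] by rewrite rmorph_nat.
  by rewrite normc_real normr_nat.
apply: le_trans (le_normcD _ _) _; rewrite normcN.
apply: (@le_trans _ _ ((K * b ^+ 3 + K * b ^+ 3) / 2 + K * b ^+ 3 + 2 * b ^+ 3)).
  apply: lerD => //; apply: le_trans (le_normcD _ _) _; rewrite normcN.
  apply: lerD.
    rewrite normcM n2 ler_wpM2r ?invr_ge0//.
    by apply: le_trans (le_normcD _ _) _; exact: lerD.
  by apply: le_trans h3 _; rewrite ler_wpM2l.
by lra.
Qed.

(** exp(-x^2/2) cosh x decreases for x >= 0: its derivative has the sign of sinh x - x cosh x, while
    x cosh x - sinh x vanishes at 0 and has derivative x sinh x >= 0. [f] carries a minus sign so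
    that it increases. *)
Lemma cosh_le_gauss x : (expR x + expR (- x)) / 2 <= expR (x ^+ 2 / 2).
Proof.
wlog x0 : x / 0 <= x.
  move=> H; case: (leP 0 x) => [/H//|/ltW]; rewrite -oppr_ge0 => /H.
  by rewrite opprK sqrrN [expR (- x) + _]addrC.
pose f t : R := - (expR (- (t ^+ 2 / 2)) * ((expR t + expR (- t)) / 2)).
pose df t : R := expR (- (t ^+ 2 / 2)) * (t * ((expR t + expR (- t)) / 2) - (expR t - expR (- t)) / 2).
have Df (t : R) : is_derive t 1 f (df t).
  have De : is_derive t 1 (fun t : R => expR (- t)) (- expR (- t)).
    by apply: is_derive_eq; rewrite /GRing.scale /=; ring.
  have Dg : is_derive t 1 (fun t : R => expR (- (t ^+ 2 / 2))) (- t * expR (- (t ^+ 2 / 2))).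
    by apply: is_derive_eq; rewrite /GRing.scale /=; field.
  by rewrite /f /df; apply: is_derive_eq; rewrite /GRing.scale /=; field.
have df0 t : 0 < t -> 0 <= df t.
  move=> t0; rewrite mulr_ge0 ?expR_ge0//.
  pose g s : R := s * ((expR s + expR (- s)) / 2) - (expR s - expR (- s)) / 2.
  have -> : t * ((expR t + expR (- t)) / 2) - (expR t - expR (- t)) / 2 = g t by [].
  have <- : g 0 = 0 by rewrite /g oppr0 expR0; field.
  apply: (@derive_ge0_ndecr _ (fun s => s * ((expR s - expR (- s)) / 2))); last exact: ltW.
    move=> s; have De : is_derive s 1 (fun t : R => expR (- t)) (- expR (- s)).
      by apply: is_derive_eq; rewrite /GRing.scale /=; ring.
    by rewrite /g; apply: is_derive_eq; rewrite /GRing.scale /=; field.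
  move=> s s0; rewrite mulr_ge0 ?(ltW s0)// divr_ge0// subr_ge0 ler_expR.
  by rewrite (@le_trans _ _ 0)// ?oppr_le0 ltW.
have := derive_ge0_ndecr Df df0 x0; rewrite /f lerN2.
rewrite expr0n /= mul0r oppr0 !expR0 expRN mul1r.
rewrite ler_pdivrMl ?expR_gt0//.
by move=> h; apply: le_trans h _; rewrite ler_piMr ?expR_ge0//; lra.
Qed.

Lemma normc_ccosh_le s t : normc (ccosh s t) <= expR (s ^+ 2 / 2).
Proof.
apply: le_trans (cosh_le_gauss s); rewrite /ccosh normcM normcV.
have -> : 2%:R = 2%:R%:C :> R[i] by rewrite rmorph_nat.
rewrite normc_real normr_nat ler_wpM2r ?invr_ge0//.
by apply: le_trans (le_normcD _ _) _; rewrite !normc_cexp.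
Qed.

Lemma normc_subrXX (z w : R[i]) (r : R) n : normc z <= r -> normc w <= r ->
  normc (z ^+ n - w ^+ n) <= normc (z - w) * (n%:R * r ^+ n.-1).
Proof.
move=> zr wr; rewrite subrXX normcM ler_wpM2l ?normc_ge0//.
apply: le_trans (normc_sum _ _ _) _.
apply: (@le_trans _ _ (\sum_(i < n) r ^+ n.-1)).
  apply: ler_sum => i _; rewrite normcM !normcX.
  have iE : n.-1 = (n.-1 - i + i)%N.
    by rewrite subnK// -ltnS (ltn_predK (ltn_ord i)).
  by rewrite {2}iE exprD ler_pM ?exprn_ge0 ?normc_ge0// lerXn2r ?nnegrE ?normc_ge0// (le_trans (normc_ge0 z)).
by rewrite sumr_const card_ord -[leLHS]mulr_natl.
Qed.

End cosh_gaussian.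

(** * Moments of the symmetric binomial law *)

Section binomial_average.
Context {R : realType}.
Implicit Types (s t x : R) (n i : nat).

(* The symmetric binomial law: [bweight n i] is the mass of the point [bpoint n i],
   normalized to variance one. *)
Definition bweight n i : R := 'C(n, i)%:R / 2 ^+ n.
Definition bpoint n i : R := (n%:R - 2 * i%:R) / Num.sqrt n%:R.

Lemma bweight_ge0 n i : 0 <= bweight n i.
Proof. by rewrite divr_ge0 ?exprn_ge0. Qed.

Lemma cexpX s t n : cexp s t ^+ n = cexp (n%:R * s) (n%:R * t).
Proof.
elim: n => [|n IH]; first by rewrite !mul0r cexp0.
by rewrite exprS IH -cexpD -[n.+1]add1n natrD !mulrDl !mul1r.
Qed.

Lemma ccoshX s t n : ccosh s t ^+ n = \sum_(i < n.+1) (bweight n i)%:C *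
  cexp ((n%:R - 2 * i%:R) * s) ((n%:R - 2 * i%:R) * t).
Proof.
rewrite /ccosh exprMn exprDn mulr_suml; apply: eq_bigr => i _.
have -> : cexp s t ^+ (n - i) * cexp (- s) (- t) ^+ i =
    cexp ((n%:R - 2 * i%:R) * s) ((n%:R - 2 * i%:R) * t).
  rewrite !cexpX -cexpD natrB; last by rewrite -ltnS.
  by congr cexp; ring.
have -> : (bweight n i)%:C = 'C(n, i)%:R * (2%:R^-1) ^+ n :> R[i].
  by rewrite /bweight rmorphM fmorphV rmorphXn !rmorph_nat exprVn.
by rewrite -mulr_natr -mulrA mulrC.
Qed.

Lemma cexp_real s : cexp s 0 = (expR s)%:C.
Proof. by rewrite cexpE cos0 sin0 mulr1 mulr0. Qed.

Lemma coshX x n : ((expR x + expR (- x)) / 2) ^+ n =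
  \sum_(i < n.+1) bweight n i * expR ((n%:R - 2 * i%:R) * x).
Proof.
apply: complexI; rewrite rmorphXn rmorph_sum /=.
have -> : ((expR x + expR (- x)) / 2)%:C = ccosh x 0.
  by rewrite /ccosh oppr0 !cexp_real rmorphM rmorphD fmorphV rmorph_nat.
rewrite ccoshX; apply: eq_bigr => i _.
by rewrite mulr0 cexp_real -rmorphM.
Qed.

(** The left side is exactly cosh(l/sqrt n)^n, so [cosh_le_gauss] gives a sub-Gaussian bound uniform
    in n. *)
Lemma bmoment_exp (l : R) n : (0 < n)%N ->
  \sum_(i < n.+1) bweight n i * expR (l * bpoint n i) <= expR (l ^+ 2 / 2).
Proof.
move=> n0; have n0R : 0 < n%:R :> R by rewrite ltr0n.
set x := l / Num.sqrt n%:R.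
rewrite (eq_bigr (fun i : 'I_n.+1 => bweight n i * expR ((n%:R - 2 * i%:R) * x))).
  rewrite -coshX; apply: (@le_trans _ _ (expR (x ^+ 2 / 2) ^+ n)).
    by rewrite lerXn2r ?nnegrE ?expR_ge0 ?cosh_le_gauss// divr_ge0// addr_ge0 ?expR_ge0.
  rewrite -expRM_natr ler_expR /x expr_div_n sqr_sqrtr ?ler0n//.
  rewrite le_eqVlt; apply/orP; left; apply/eqP; field.
  by rewrite gt_eqF.
by move=> i _; rewrite /bpoint /x mulrCA -!mulrA [l / _]mulrC.
Qed.

Lemma sum_geometric_le (q : R) n : 0 <= q < 1 -> \sum_(i < n) q ^+ i <= (1 - q)^-1.
Proof.
move=> /andP[q0 q1]; have q10 : 0 < 1 - q by rewrite subr_gt0.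
rewrite -[leRHS]mulr1 -ler_pdivrMl ?invr_gt0// invrK.
have := subrX1 q n; have : 0 <= q ^+ n by rewrite exprn_ge0.
by move: (q ^+ n) (\sum_(i < n) q ^+ i) => a b; lra.
Qed.

(** A discrete linearization of the square. With m the integer part of |b|, (|b| - m)^2 <= 1 gives g
    b^2 <= g + 2 g m |b| - g m^2. The mean of exp(2 g m |b|) is at most 2 exp(2 g^2 m^2) by
    [bmoment_exp], and the sum over m of exp(-g (1 - 2g) m^2) is bounded because g < 1/2. *)
Lemma bmoment_sqr (g : R) : 0 < g < 2^-1 -> exists2 K : R, 0 <= K &
  forall n, (0 < n)%N -> \sum_(i < n.+1) bweight n i * expR (g * bpoint n i ^+ 2) <= K.
Proof.
move=> /andP[g0 g12].
set c := g * (1 - 2 * g); have c0 : 0 < c by rewrite mulr_gt0//; lra.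
set q := expR (- c).
have q1 : 0 <= q < 1 by rewrite expR_ge0 /q expR_lt1 oppr_lt0.
exists (expR g * (2 * (1 - q)^-1)).
  by rewrite mulr_ge0 ?expR_ge0// mulr_ge0// invr_ge0 subr_ge0 ltW; case/andP: q1.
move=> n n0; have n0R : 0 < n%:R :> R by rewrite ltr0n.
pose f (m i : nat) : R := expR (2 * g * m%:R * bpoint n i) + expR (- (2 * g * m%:R) * bpoint n i).
have f0 m i : 0 <= f m i by rewrite addr_ge0// expR_ge0.
have pt i : (i < n.+1)%N -> expR (g * bpoint n i ^+ 2) <=
    expR g * \sum_(m < n.+1) expR (- (g * m%:R ^+ 2)) * f m i.
  move=> lein; set b := bpoint n i.
  have bn : `|b| <= n%:R.
    rewrite /b /bpoint normrM normfV (ger0_norm (sqrtr_ge0 _)).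
    have s1 : 1 <= Num.sqrt n%:R :> R by rewrite -[leLHS]sqrtr1 ler_wsqrtr// ler1n.
    rewrite ler_pdivrMr ?(lt_le_trans ltr01)//.
    apply: (@le_trans _ _ n%:R); last by rewrite ler_peMr.
    have : i%:R <= n%:R :> R by rewrite ler_nat -ltnS.
    have : 0 <= i%:R :> R by [].
    by move=> ? ?; rewrite ler_norml; apply/andP; split; lra.
  have /andP[m1 m2] := Num.Theory.truncn_itv (normr_ge0 b).
  set m := Num.truncn `|b| in m1 m2.
  (* The bound |b| <= n keeps the term of index m inside the finite sum. *)
  have mn : (m < n.+1)%N by rewrite ltnS -(ler_nat R) (le_trans m1).
  rewrite (bigD1 (Ordinal mn))//= mulrDr.
  apply: (@le_trans _ _ (expR g * (expR (- (g * m%:R ^+ 2)) * f m i))); last first.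
    rewrite lerDl mulr_ge0 ?expR_ge0// sumr_ge0// => j _.
    by rewrite mulr_ge0 ?expR_ge0.
  apply: (@le_trans _ _ (expR g * (expR (- (g * m%:R ^+ 2)) * expR (2 * g * m%:R * `|b|)))).
    rewrite -!expRD ler_expR.
    have : (`|b| - m%:R) ^+ 2 <= 1.
      rewrite expr_le1// ?subr_ge0// lerBlDr addrC natr1.
      exact: ltW.
    rewrite -[b ^+ 2]real_normK ?num_real//.
    move: (`|b|) (m%:R) => B M h.
    have : g * ((B - M) ^+ 2) <= g by rewrite ler_piMr// ltW.
    by rewrite sqrrB; lra.
  rewrite ler_wpM2l ?expR_ge0// ler_wpM2l ?expR_ge0// /f -/b.
  case: (leP 0 b) => b0; first by rewrite ger0_norm// lerDl expR_ge0.
  by rewrite ltr0_norm// mulrN -mulNr lerDr expR_ge0.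
apply: (@le_trans _ _ (\sum_(i < n.+1) bweight n i *
    (expR g * \sum_(m < n.+1) expR (- (g * m%:R ^+ 2)) * f m i))).
  by apply: ler_sum => i _; rewrite ler_wpM2l ?bweight_ge0// pt.
rewrite (eq_bigr (fun i : 'I_n.+1 => expR g * \sum_(m < n.+1)
    expR (- (g * m%:R ^+ 2)) * (bweight n i * f m i))); last first.
  move=> i _; rewrite mulrCA mulr_sumr; congr (_ * _).
  by apply: eq_bigr => m _; rewrite mulrCA.
rewrite -mulr_sumr ler_wpM2l ?expR_ge0// exchange_big /=.
apply: (@le_trans _ _ (\sum_(m < n.+1) 2 * q ^+ m)); last first.
  by rewrite -mulr_sumr ler_wpM2l// sum_geometric_le.
apply: ler_sum => m _; rewrite -mulr_sumr.
apply: (@le_trans _ _ (expR (- (g * m%:R ^+ 2)) * (2 * expR ((2 * g * m%:R) ^+ 2 / 2)))).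
  rewrite ler_wpM2l ?expR_ge0// /f.
  under eq_bigr do rewrite mulrDr.
  rewrite big_split /= [leRHS]mulr_natl [leRHS]mulr2n lerD ?bmoment_exp//.
  by rewrite -[in leRHS](sqrrN (2 * g * m%:R)) bmoment_exp.
rewrite mulrCA ler_wpM2l// -expRD -expRM_natl ler_expR /c.
have mm : (m%:R : R) <= m%:R ^+ 2 by case: (m : nat) => [|k]; rewrite ?expr0n// ler_eXnr// ler1n.
have : c * m%:R <= c * m%:R ^+ 2 by rewrite ler_wpM2l// ltW.
by rewrite /c; move: (m%:R) mm => M mm; lra.
Qed.

End binomial_average.

(** * One step in the space of windows *)

Section window_step.
Context {R : realType} (d : nat).
Implicit Types (x xi y p q l : 'rV[R]_d) (A B : 'M[R]_d) (t eta : R).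

Definition rank1 l : 'M[R]_d := l^T *m l.

Lemma rank1_sym l : (rank1 l)^T = rank1 l.
Proof. by rewrite /rank1 trmx_mul trmxK. Qed.

Lemma mulmx_rank1 y l : y *m rank1 l = dot y l *: l.
Proof.
rewrite /rank1 mulmxA; apply/rowP => j; rewrite !mxE big_ord1 !mxE.
by congr (_ * _); apply: eq_bigr => i _; rewrite !mxE.
Qed.

Lemma qform_rank1 l y : qform (rank1 l) y = dot l y ^+ 2.
Proof. by rewrite /qform mulmx_rank1 dotZl [dot y l]dotC expr2. Qed.

Lemma qformBm A B y : qform (A - B) y = qform A y - qform B y.
Proof. by rewrite /qform mulmxBr dotDl dotNl. Qed.

(** Completion of the square. Moving the centre by eta p with p A = t1 l produces the real part of
    the exponent; this also moves the quadratic phase, and the frequency shift eta q corrects the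
    imaginary part. The constant t1 l.p in the remaining factor is the kappa of the estimates. *)
Lemma packet_shift A B x xi y p q l (t1 t2 eta : R) : A^T = A -> B^T = B ->
  p *m A = t1 *: l -> q = p *m B - t2 *: l ->
  cexp (eta * (t1 * dot l (y - x))) (eta * (t2 * dot l (y - x))) * packet A B x xi y =
  cexp (eta ^+ 2 * (t1 * dot l p / 2)) (eta * dot q x + eta ^+ 2 * qform B p / 2) *
  packet A B (x + eta *: p) (xi + eta *: q) y.
Proof.
move=> As Bs pA qE; rewrite /packet -!cexpD.
set Y := y - x.
have -> : y - (x + eta *: p) = Y + (- eta) *: p by rewrite scaleNr opprD addrA.
rewrite (qformD _ _ As) (qformD _ _ Bs) !qformZ !sqrrN.
have -> : dot (Y *m A) ((- eta) *: p) = - eta * (t1 * dot l Y).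
  by rewrite dotZr [dot (Y *m A) p]dot_mulmx As pA dotZr dotC.
have -> : qform A p = t1 * dot l p by rewrite /qform pA dotZl.
have -> : dot (Y *m B) ((- eta) *: p) = - eta * (dot q Y + t2 * dot l Y).
  rewrite dotZr [dot (Y *m B) p]dot_mulmx Bs [dot Y _]dotC qE.
  by rewrite dotDl dotNl dotZl subrK.
have -> : dot (xi + eta *: q) y = dot xi y + eta * (dot q Y + dot q x).
  by rewrite dotDl dotZl -dotDr /Y subrK.
by congr cexp; field.
Qed.

(** With [step_im], the real and imaginary parts of A + iB - tau^2 l^T l for tau = t1 + i t2. *)
Definition step_re A l (t1 t2 : R) := A - (t1 ^+ 2 - t2 ^+ 2) *: rank1 l.
Definition step_im B l (t1 t2 : R) := B - (2 * t1 * t2) *: rank1 l.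

Lemma packet_step A B x xi y l (t1 t2 : R) :
  packet (step_re A l t1 t2) (step_im B l t1 t2) x xi y =
  cexp (((t1 * dot l (y - x)) ^+ 2 - (t2 * dot l (y - x)) ^+ 2) / 2)
       ((t1 * dot l (y - x)) * (t2 * dot l (y - x))) * packet A B x xi y.
Proof.
rewrite /packet -cexpD /step_re /step_im !qformBm !qformZm !qform_rank1.
by congr cexp; field.
Qed.

(* [cosh (tau a / sqrt n) ^ n] tends to [exp (tau ^ 2 a ^ 2 / 2)], where
   [tau = t1 + i t2] and [a = dot l (y - x)]. *)
Definition window_avg A B x xi l (t1 t2 : R) n y : R[i] :=
  ccosh (t1 * dot l (y - x) / Num.sqrt n%:R) (t2 * dot l (y - x) / Num.sqrt n%:R) ^+ n *
  packet A B x xi y.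

Lemma window_avgE A B x xi p q l (t1 t2 : R) n : A^T = A -> B^T = B ->
  p *m A = t1 *: l -> q = p *m B - t2 *: l ->
  window_avg A B x xi l t1 t2 n = fun y => \sum_(i < n.+1)
    ((bweight n i)%:C * cexp (bpoint n i ^+ 2 * (t1 * dot l p / 2))
      (bpoint n i * dot q x + bpoint n i ^+ 2 * qform B p / 2)) *
    packet A B (x + bpoint n i *: p) (xi + bpoint n i *: q) y.
Proof.
move=> As Bs pA qE; apply/funext => y; rewrite /window_avg ccoshX mulr_suml.
apply: eq_bigr => i _.
rewrite -[RHS]mulrA -(packet_shift _ _ _ _ As Bs pA qE) -[LHS]mulrA.
by rewrite /bpoint; congr (_ * (cexp _ _ * _)); ring.
Qed.

Lemma half_subr_le (a b c : R) : a + b <= c -> a / 2 - 2^-1 * c <= - (b / 2).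
Proof. lra. Qed.

Lemma half_chain_le (a b c : R) : b <= c -> 4 / a <= b -> 2 / a <= c / 2.
Proof. by rewrite !(mulrC _ a^-1); lra. Qed.

(** Where |y - x| is large, both functions are below exp(-m |y - x|^2/2) by positivity of A - t1^2
    l^T l. On the remaining ball the arguments have size n^(-1/2), and n times the cubic error of
    [ccosh_taylor] tends to 0. *)
Lemma window_avg_cvg A B x xi l (t1 t2 : R) :
  posdef (A - t1 ^+ 2 *: rank1 l) -> forall rho : R, 0 < rho ->
  exists2 n, (0 < n)%N & forall y,
    normc (window_avg A B x xi l t1 t2 n y -
      packet (step_re A l t1 t2) (step_im B l t1 t2) x xi y) <= rho.
Proof.
move=> [_ [m m0 Am]] rho rho0.
have Aq y : (t1 * dot l y) ^+ 2 + m * `|y| ^+ 2 <= qform A y.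
  have := Am y; rewrite qformBm qformZm qform_rank1 => h.
  have : m * `|y| ^+ 2 <= m * dot y y by rewrite ler_wpM2l ?sqr_norm_le_dot// ltW.
  by rewrite exprMn; lra.
have [K K0 HK] := @ccosh_taylor R.
set T := `|t1| + `|t2|.
have T0 : 0 <= T by rewrite addr_ge0.
(* m r >= 4/rho makes the tail at most rho, and r >= 1 allows |y - x| <= |y - x|^2 there. *)
pose r : R := (4 / rho + 1) / m + 1.
have r1 : 1 <= r.
  by rewrite lerDr divr_ge0 ?(ltW m0)// addr_ge0// divr_ge0// ltW.
have r0 : 0 < r := lt_le_trans ltr01 r1.
pose a0 : R := T * (d%:R * `|l| * r).
have a00 : 0 <= a0 by rewrite mulr_ge0// mulr_ge0 ?(ltW r0)// mulr_ge0.
(* k exceeds a0, which puts the arguments in the range of the Taylor bound, and K a0^3/rho, which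
   makes the final error at most rho. With n = k^2 the square root of n is an integer. *)
pose k : nat := (Num.bound (a0 + K * a0 ^+ 3 / rho)).+1.
have kE : a0 + K * a0 ^+ 3 / rho < k%:R.
  apply: lt_trans (archi_boundP _) _; last by rewrite ltr_nat.
  by rewrite addr_ge0// divr_ge0 ?(ltW rho0)// mulr_ge0 ?exprn_ge0.
have K30 : 0 <= K * a0 ^+ 3 / rho by rewrite divr_ge0 ?(ltW rho0)// mulr_ge0 ?exprn_ge0.
have k0 : 0 < k%:R :> R by rewrite ltr0n.
exists (k ^ 2)%N; first by rewrite expn_gt0.
move=> y; rewrite /window_avg packet_step -mulrBl normcM normc_packet.
have -> : Num.sqrt (k ^ 2)%:R = k%:R :> R by rewrite natrX sqrtr_sqr ger0_norm.
set Y := y - x; set b1 := t1 * dot l Y; set b2 := t2 * dot l Y.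
set n := (k ^ 2)%N.
set w := cexp (((b1 / k%:R) ^+ 2 - (b2 / k%:R) ^+ 2) / 2) (b1 / k%:R * (b2 / k%:R)).
have nE : n%:R = k%:R ^+ 2 :> R by rewrite natrX.
have wE : cexp ((b1 ^+ 2 - b2 ^+ 2) / 2) (b1 * b2) = w ^+ n.
  by rewrite cexpX nE; congr cexp; field; rewrite gt_eqF.
rewrite wE; set E := expR (- _).
set e := expR ((b1 / k%:R) ^+ 2 / 2).
have e1 : normc (ccosh (b1 / k%:R) (b2 / k%:R)) <= e by exact: normc_ccosh_le.
have e2 : normc w <= e.
  rewrite normc_cexp ler_expR.
  have : 0 <= (b2 / k%:R) ^+ 2 by exact: sqr_ge0.
  by move: ((b1 / k%:R) ^+ 2) ((b2 / k%:R) ^+ 2) => ? ?; lra.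
have eE : e ^+ n = expR (b1 ^+ 2 / 2).
  by rewrite -expRM_natr nE; congr expR; field; rewrite gt_eqF.
have e_ge1 : 1 <= e by rewrite -expR0 ler_expR divr_ge0// sqr_ge0.
have EB : e ^+ n * E <= expR (- (m * `|Y| ^+ 2 / 2)).
  by rewrite eE /E -expRD ler_expR; exact: half_subr_le (Aq Y).
have E0 : 0 <= E by exact: expR_ge0.
have [Yr|rY] := leP `|Y| r; last first.
  apply: (@le_trans _ _ ((e ^+ n + e ^+ n) * E)).
    rewrite ler_wpM2r//; apply: le_trans (le_normcD _ _) _; rewrite normcN !normcX.
    by apply: lerD; rewrite lerXn2r ?nnegrE ?normc_ge0 ?expR_ge0.
  rewrite mulrDl -mulr2n -mulr_natl.
  apply: (@le_trans _ _ (2 * expR (- (m * `|Y| ^+ 2 / 2)))); first by rewrite ler_wpM2l.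
  have h : 2 / rho <= m * `|Y| ^+ 2 / 2.
    have : 4 / rho <= m * `|Y|.
      apply: (@le_trans _ _ (m * r)); last by rewrite ler_wpM2l ?ltW.
      have -> : m * r = 4 / rho + 1 + m by rewrite /r; field; rewrite !gt_eqF.
      by rewrite -addrA lerDl addr_ge0// ltW.
    have : m * `|Y| <= m * `|Y| ^+ 2.
      by rewrite ler_wpM2l ?(ltW m0)// ler_eXnr// (le_trans r1)// ltW.
    exact: half_chain_le.
  rewrite expRN ler_pdivrMr ?expR_gt0// -ler_pdivrMl// (mulrC rho^-1).
  apply: le_trans (_ : 1 + m * `|Y| ^+ 2 / 2 <= _); last exact: expR_ge1Dx.
  by apply: le_trans h _; rewrite lerDr.
have aY : `|dot l Y| <= d%:R * `|l| * r.
  by apply: le_trans (norm_dot_le _ _) _; rewrite ler_wpM2l ?mulr_ge0.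
have bb (t : R) : `|t| <= T -> `|t * dot l Y / k%:R| <= a0 / k%:R.
  move=> tT; rewrite normrM normfV (gtr0_norm k0) ler_wpM2r ?invr_ge0 ?(ltW k0)//.
  by rewrite normrM ler_pM.
have ak : a0 / k%:R <= 1.
  by rewrite ler_pdivrMr// mul1r ltW// (le_lt_trans _ kE)// lerDl.
have h3 : normc (ccosh (b1 / k%:R) (b2 / k%:R) - w) <= K * (a0 / k%:R) ^+ 3.
  by apply: HK => //; apply: bb; rewrite ?lerDl ?lerDr.
apply: (@le_trans _ _ (K * (a0 / k%:R) ^+ 3 * (n%:R * e ^+ n.-1) * E)).
  rewrite ler_wpM2r//; apply: le_trans (normc_subrXX n e1 e2) _.
  by rewrite ler_wpM2r// mulr_ge0// exprn_ge0// expR_ge0.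
apply: (@le_trans _ _ (K * (a0 / k%:R) ^+ 3 * n%:R)).
  rewrite mulrA -mulrA ler_piMr//.
    by rewrite mulr_ge0// mulr_ge0// exprn_ge0// divr_ge0// ltW.
  apply: (@le_trans _ _ (e ^+ n * E)).
    by rewrite ler_wpM2r// ler_weXn2l// leq_pred.
  by apply: le_trans EB _; rewrite -expR0 ler_expR oppr_le0 divr_ge0// mulr_ge0 ?(ltW m0)// exprn_ge0.
rewrite nE (_ : _ * _ = K * a0 ^+ 3 / k%:R); last by field; rewrite gt_eqF.
rewrite ler_pdivrMr// -ler_pdivrMl// (mulrC rho^-1) ltW//.
by apply: le_lt_trans kE; rewrite lerDr.
Qed.

End window_step.

Section window_step_dual.
Context {R : realType} (d : nat) (theta : R).
Hypothesis theta_ge : 2^-1 <= theta.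
Variable u : ('rV[R]_d -> R[i]) -> R[i].
Hypothesis u_dual : gs_dual theta u.
Implicit Types (x xi y p q l : 'rV[R]_d) (A B : 'M[R]_d) (t eta : R).
Local Notation gs := (gelfand_shilov theta).

Let theta_gt0 : 0 < theta.
Proof. by apply: lt_le_trans theta_ge; rewrite invr_gt0. Qed.

Lemma theta_inv_le2 : 0 <= theta^-1 <= 2.
Proof.
rewrite invr_ge0 (ltW theta_gt0)/= -[leRHS]invrK lef_pV2 ?posrE ?invr_gt0//.
Qed.

Lemma packet_gs A B x xi : posdef A -> B^T = B -> gs (packet A B x xi).
Proof.
move=> pA Bs; have [C [M [C1 M0 H]]] := gevrey_bound_packet theta_ge ltr01 pA Bs.
apply: (gevrey_bound_gelfand_shilov theta_gt0 _ _ _ (H x xi)).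
- exact: lt_le_trans ltr01 C1.
- by rewrite mulr_ge0 ?expR_ge0// ltW.
- by apply: smooth_packet => //; have [] := pA.
Qed.

Lemma dual_sum (I : Type) (r : seq I) (c : I -> R[i]) (F : I -> 'rV[R]_d -> R[i]) :
  (forall k, gs (F k)) ->
  (forall r', gs (fun y => \sum_(k <- r') c k * F k y)) ->
  u (fun y => \sum_(k <- r) c k * F k y) = \sum_(k <- r) c k * u (F k).
Proof.
move=> gF gS; have [lin _] := u_dual; elim: r => [|k r IH].
  rewrite big_nil (_ : (fun _ => _) = (fun=> 0)); first exact: dual0 u_dual.
  by apply/funext => y; rewrite big_nil.
rewrite big_cons -IH -(lin _ _ (c k) (gF k) (gS r)); congr u.
by apply/funext => y; rewrite big_cons.
Qed.

Lemma dual_packet_le A B (delta : R) : posdef A -> B^T = B -> 0 < delta ->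
  exists2 M : R, 0 < M & forall x xi, normc (u (packet A B x xi)) <=
    M * expR (delta * (`|x| `^ theta^-1 + `|xi| `^ theta^-1)).
Proof.
move=> pA Bs d0; have [C [M [C1 M0 H]]] := gevrey_bound_packet theta_ge d0 pA Bs.
have [K K0 HK] := dual_bounded theta_gt0 u_dual C1.
exists (K * M); first exact: mulr_gt0.
move=> x xi; rewrite -mulrA; apply: HK; last exact: H.
  by rewrite mulr_gt0// expR_gt0.
by apply: smooth_packet => //; have [] := pA.
Qed.

Lemma gevrey_bound_leC C C' M (f : 'rV[R]_d -> R[i]) : 0 <= C -> C <= C' -> 0 <= M ->
  gevrey_bound theta C M f -> gevrey_bound theta C' M f.
Proof.
move=> C0 CC M0 H s k y; apply: le_trans (H s k y) _.
apply: ler_wpM2r; first exact: powR_ge0.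
by apply: ler_wpM2l => //; rewrite lerXn2r ?nnegrE ?(le_trans C0).
Qed.

Lemma powR_shift_le x p eta (r : R) : 0 <= r -> r <= 2 ->
  `|x + eta *: p| `^ r <= 1 + 2 * `|x| ^+ 2 + 2 * (eta ^+ 2 * `|p| ^+ 2).
Proof.
move=> r0 r2; apply: le_trans (powR_le1sqr _ r0 r2) _ => //.
rewrite -addrA lerD2l; apply: (@le_trans _ _ ((`|x| + `|eta| * `|p|) ^+ 2)).
  rewrite lerXn2r ?nnegrE ?addr_ge0 ?mulr_ge0// -normrZ; exact: ler_normD.
rewrite -[eta ^+ 2]real_normK ?num_real// -exprMn.
move: (`|x|) (`|eta| * `|p|) => a b.
by have := sqr_ge0 (a - b); rewrite sqrrB sqrrD; lra.
Qed.

(** [delta] is chosen so that moving the packet by the shift costs at most (1 - kappa) eta^2/4 in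
    the exponent. With the factor exp(kappa eta^2/2) this amounts to g = kappa/4 + 1/4 < 1/2, whose
    moments are bounded uniformly in n. *)
Lemma window_avg_bounded A B p q l (t1 t2 : R) x xi : posdef A -> B^T = B ->
  p *m A = t1 *: l -> q = p *m B - t2 *: l ->
  0 <= t1 * dot l p < 1 ->
  exists C M : R, [/\ 1 <= C, 0 < M & forall n, (0 < n)%N ->
    smooth (window_avg A B x xi l t1 t2 n) /\
    gevrey_bound theta C M (window_avg A B x xi l t1 t2 n)].
Proof.
move=> pA Bs pl qE; set kappa := t1 * dot l p => /andP[kappa0 kappa1].
have [As _] := pA.
set P := `|p| ^+ 2 + `|q| ^+ 2.
have P0 : 0 <= P by rewrite addr_ge0 ?sqr_ge0.
set delta := (1 - kappa) / (8 * (P + 1)).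
have d0 : 0 < delta by rewrite divr_gt0 ?subr_gt0// mulr_gt0// ltr_wpDl.
have [C [M [C1 M0 H]]] := gevrey_bound_packet theta_ge d0 pA Bs.
set g := kappa / 4 + 4^-1.
have [|K K0 HK] := @bmoment_sqr R g; first by apply/andP; split; rewrite /g; lra.
set Q := M * expR (delta * (2 + 2 * `|x| ^+ 2 + 2 * `|xi| ^+ 2)).
have Q0 : 0 < Q by rewrite mulr_gt0 ?expR_gt0.
have C0 : 0 <= C by exact: le_trans C1.
exists C, (Q * (K + 1)); split=> //; first by rewrite mulr_gt0// ltr_wpDl.
have sP x' xi' := smooth_packet x' xi' As Bs.
move=> n n0; rewrite (window_avgE _ _ _ As Bs pl qE); split.
  apply: smooth_sum => i; set F := packet _ _ _ _; set c := (_ * cexp _ _).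
  rewrite (_ : (fun _ => _) = (fun y => c * F y + 0)).
    by apply: smooth_lin; [exact: sP|exact: smooth_cst].
  by apply/funext => y; rewrite addr0.
apply: (@gevrey_bound_le _ _ theta C _ _ _ C0); last first.
  apply: gevrey_bound_sum; [exact: C0|by move=> i; exact: sP|].
  by move=> i; exact: H.
have [r0 r2] := andP theta_inv_le2.
apply: (@le_trans _ _ (\sum_(i < n.+1) Q * (bweight n i * expR (g * bpoint n i ^+ 2)))).
  apply: ler_sum => i _; rewrite normcM normc_cexp normc_real ger0_norm ?bweight_ge0//.
  set e := bpoint n i; rewrite -/kappa.
  rewrite [leRHS]mulrCA -mulrA ler_wpM2l ?bweight_ge0//.
  rewrite mulrCA /Q -(mulrA M) ler_wpM2l ?(ltW M0)// -!expRD ler_expR.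
  have h1 := powR_shift_le x p e r0 r2.
  have h2 := powR_shift_le xi q e r0 r2.
  have h3 : delta * (`|x + e *: p| `^ theta^-1 + `|xi + e *: q| `^ theta^-1) <=
      delta * (2 + 2 * `|x| ^+ 2 + 2 * `|xi| ^+ 2) + 2 * delta * P * e ^+ 2.
    apply: (@le_trans _ _ (delta * ((1 + 2 * `|x| ^+ 2 + 2 * (e ^+ 2 * `|p| ^+ 2)) +
       (1 + 2 * `|xi| ^+ 2 + 2 * (e ^+ 2 * `|q| ^+ 2))))).
      by rewrite ler_wpM2l ?(ltW d0)// lerD.
    by rewrite le_eqVlt; apply/orP; left; apply/eqP; rewrite /P; ring.
  have h4 : 2 * delta * P * e ^+ 2 <= (1 - kappa) / 4 * e ^+ 2.
    rewrite ler_wpM2r ?sqr_ge0// /delta.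
    rewrite (_ : 2 * _ * P = (1 - kappa) / 4 * (P / (P + 1))); last first.
      by field; rewrite gt_eqF// ltr_wpDl.
    rewrite ler_piMr ?divr_ge0 ?subr_ge0 ?(ltW kappa1)//.
    by rewrite ler_pdivrMr ?ltr_wpDl// mul1r lerDl.
  have h5 : e ^+ 2 * (kappa / 2) + (1 - kappa) / 4 * e ^+ 2 = g * e ^+ 2.
    by rewrite /g; field.
  apply: le_trans (lerD (lexx _) h3) _.
  by rewrite addrCA lerD2l -h5 lerD2l.
rewrite -mulr_sumr ler_wpM2l ?(ltW Q0)//.
by apply: le_trans (HK n n0) _; rewrite lerDl.
Qed.

(** The new packet differs from the binomial mean by [h], which is uniformly small and has Gevrey
    bounds independent of n; hence it is small in the step 2C, where [u] is bounded. The mean is a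
    finite sum, estimated term by term with the moment bound. *)
Lemma window_step_le A B p q l (t1 t2 g K : R) : posdef (A - t1 ^+ 2 *: rank1 l) ->
  posdef A -> posdef (step_re A l t1 t2) -> B^T = B ->
  p *m A = t1 *: l -> q = p *m B - t2 *: l -> 0 <= t1 * dot l p < 1 ->
  (forall n, (0 < n)%N -> \sum_(i < n.+1) bweight n i * expR (g * bpoint n i ^+ 2) <= K) ->
  forall x xi (Q : R), 0 <= Q ->
  (forall eta, expR (eta ^+ 2 * (t1 * dot l p / 2)) *
     normc (u (packet A B (x + eta *: p) (xi + eta *: q))) <= Q * expR (g * eta ^+ 2)) ->
  normc (u (packet (step_re A l t1 t2) (step_im B l t1 t2) x xi)) <= Q * K.
Proof.
move=> pAl pA pA' Bs pl qE kappa HK x xi Q Q0 HQ.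
have [As _] := pA; have [As' _] := pA'.
have Bs' : (step_im B l t1 t2)^T = step_im B l t1 t2.
  by rewrite /step_im !raddfB /= Bs linearZ /= rank1_sym.
have [C1 [M1 [C11 M10 H1]]] := window_avg_bounded x xi pA Bs pl qE kappa.
have [C2 [M2 [C21 M20 H2]]] := gevrey_bound_packet theta_ge ltr01 pA' Bs'.
set P' := packet _ _ x xi; have sP' : smooth P' by exact: smooth_packet.
set C := C1 + C2.
have C1C : C1 <= C by rewrite lerDl (le_trans ler01).
have C2C : C2 <= C by rewrite lerDr (le_trans ler01).
have Cge1 : 1 <= C := le_trans C11 C1C.
set L := M2 * expR (1 * (`|x| `^ theta^-1 + `|xi| `^ theta^-1)).
have L0 : 0 <= L by rewrite mulr_ge0 ?expR_ge0// ltW.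
have C2ge1 : 1 <= 2 * C by rewrite (le_trans Cge1)// ler_peMl ?ler1n// (le_trans ler01 Cge1).
have [K' K'0 HK'] := dual_bounded theta_gt0 u_dual C2ge1.
have ML : 0 < L + M1 by rewrite ltr_wpDl.
apply/ler_addgt0Pr => rho rho0.
have rK : 0 < rho / K' by rewrite divr_gt0.
have [eps eps0 small] := gevrey_small d theta_gt0 Cge1 ML rK.
have [n n0 close] := window_avg_cvg B x xi t2 pAl eps0.
have [sf gf] := H1 n n0.
set f := window_avg A B x xi l t1 t2 n in close sf gf.
pose h y : R[i] := - 1 * P' y + f y.
have sh : smooth h by exact: smooth_lin.
have gh : gevrey_bound theta C (L + M1) h.
  rewrite -[L]mul1r; have {1}-> : 1 = normc (- 1 : R[i]) by rewrite normcN normc1.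
  apply: gevrey_bound_lin; [exact: sP'|exact: sf| |].
    apply: (gevrey_bound_leC _ C2C L0); last exact: H2.
    exact: le_trans ler01 C21.
  apply: (gevrey_bound_leC _ C1C (ltW M10)) => //.
  exact: le_trans ler01 C11.
have hsmall : gevrey_bound theta (2 * C) (rho / K') h.
  apply: small => // y; rewrite /h mulN1r addrC; exact: close.
have uh : normc (u h) <= rho.
  by apply: le_trans (HK' _ _ rK sh hsmall) _; rewrite mulrC divfK ?gt_eqF.
have gsP' : gs P' by exact: packet_gs.
have gsf : gs f.
  apply: (gevrey_bound_gelfand_shilov theta_gt0 _ (ltW M10) sf gf).
  exact: lt_le_trans ltr01 C11.
have uE : u P' = u f - u h.
  by have [lin _] := u_dual; rewrite /h (lin _ _ _ gsP' gsf); ring.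
rewrite uE; apply: le_trans (le_normcD _ _) _; rewrite normcN; apply: lerD => //.
(* Linearity of [u] is available on the Gelfand-Shilov space only, so all partial sums must be shown
   to lie in it. *)
have gsum r : gs (fun y => \sum_(i <- r : seq 'I_n.+1)
    ((bweight n i)%:C * cexp (bpoint n i ^+ 2 * (t1 * dot l p / 2))
      (bpoint n i * dot q x + bpoint n i ^+ 2 * qform B p / 2)) *
    packet A B (x + bpoint n i *: p) (xi + bpoint n i *: q) y).
  have [C3 [M3 [C31 M30 H3]]] := gevrey_bound_packet theta_ge ltr01 pA Bs.
  have sP x' xi' := smooth_packet x' xi' As Bs.
  apply: (gevrey_bound_gelfand_shilov theta_gt0); last first.
  - apply: gevrey_bound_sum; [exact: le_trans ler01 C31|by move=> i; exact: sP|].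
    by move=> i; exact: H3.
  - apply: smooth_sum => i; set F := packet _ _ _ _; set c := (_ * cexp _ _).
    rewrite (_ : (fun _ => _) = (fun y => c * F y + 0)).
      by apply: smooth_lin; [exact: sP|exact: smooth_cst].
    by apply/funext => y; rewrite addr0.
  - apply: sumr_ge0 => i _; apply: mulr_ge0; first exact: normc_ge0.
    by apply: mulr_ge0; [exact: ltW M30|exact: expR_ge0].
  - exact: lt_le_trans ltr01 C31.
rewrite /f (window_avgE _ _ _ As Bs pl qE) dual_sum;
  [|by move=> i; exact: packet_gs|exact: gsum].
apply: le_trans (normc_sum _ _ _) _.
apply: (@le_trans _ _ (\sum_(i < n.+1) Q * (bweight n i * expR (g * bpoint n i ^+ 2)))).
  apply: ler_sum => i _; rewrite normcM normcM normc_cexp normc_real ger0_norm ?bweight_ge0//.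
  by rewrite -mulrA [leRHS]mulrCA ler_wpM2l ?bweight_ge0//; exact: HQ.
by rewrite -mulr_sumr ler_wpM2l// HK.
Qed.

End window_step_dual.

(** * Positive definite matrices and sums of rank one matrices *)

Section posdef_matrices.
Context {R : realType} (d : nat).
Implicit Types (x y p l : 'rV[R]_d) (A B S : 'M[R]_d) (c t : R) (L : seq 'rV[R]_d).
Local Notation e_ := (delta_mx (ord0 : 'I_1)).

(** Polarization at e_i, e_j and e_i + e_j. It reduces identities between sums of rank one matrices
    to scalar ones. *)
Lemma qform_sym_inj A B : A^T = A -> B^T = B -> (forall y, qform A y = qform B y) -> A = B.
Proof.
move=> As Bs AB.
have E (C : 'M[R]_d) i j : C^T = C ->
    2 * C i j = qform C (e_ i + e_ j) - qform C (e_ i) - qform C (e_ j).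
  by move=> Cs; rewrite qformD// -rowE dot_delta mxE; ring.
apply/matrixP => i j; have := E A i j As; rewrite !AB -(E B i j Bs) => h.
by apply: (@mulfI _ (2 : R)).
Qed.

Lemma dot_eq0 x : dot x x <= 0 -> x = 0.
Proof.
move=> x0; have : `|x| ^+ 2 <= 0 := le_trans (sqr_norm_le_dot x) x0.
by rewrite exprn_even_le0//= normr_eq0 => /eqP.
Qed.

Lemma posdef_surj A w : posdef A -> exists p, p *m A = w.
Proof.
move=> [As [m m0 Am]].
suff Au : A \in unitmx by exists (w *m invmx A); rewrite mulmxKV.
rewrite -row_free_unit -kermx_eq0; apply/eqP/row_matrixP => i; rewrite row0.
have kA : row i (kermx A) *m A = 0 by apply/sub_kermxP; exact: row_sub.
apply: dot_eq0; have := Am (row i (kermx A)); rewrite /qform kA dot0l.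
by rewrite pmulr_rle0.
Qed.

Lemma posdef_subrank1 A l c c' : c' <= c -> posdef (A - c *: rank1 l) ->
  posdef (A - c' *: rank1 l).
Proof.
move=> cc [As [m m0 Am]].
have trB k : (A - k *: rank1 l)^T = A^T - k *: rank1 l.
  by rewrite linearB linearZ /= rank1_sym.
have AT : A^T = A by apply: (@addIr _ (- (c *: rank1 l))); rewrite -trB.
split; first by rewrite trB AT.
exists m => // y; apply: le_trans (Am y) _.
by rewrite !qformBm !qformZm qform_rank1 lerD2l lerN2 ler_wpM2r ?sqr_ge0.
Qed.

Lemma posdef_rank1 A l c : posdef (A - c *: rank1 l) -> 0 <= c -> posdef A.
Proof.
move=> pA c0; have := posdef_subrank1 c0 pA; by rewrite scale0r subr0.
Qed.

(** kappa = t l.p is the value of the form A at p. Positivity of A - t^2 l^T l at p reads m p.p <=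
    kappa - kappa^2, so kappa >= 1 would force p = 0 and then kappa = 0. *)
Lemma posdef_slope_lt1 A l p t : posdef (A - t ^+ 2 *: rank1 l) -> p *m A = t *: l ->
  0 <= t * dot l p < 1.
Proof.
move=> pAl pl; have [_ [m m0 Am]] := pAl.
have [_ [m' m'0 Am']] := posdef_rank1 pAl (sqr_ge0 t).
have kE : qform A p = t * dot l p by rewrite /qform pl dotZl.
have k0 : 0 <= t * dot l p.
  by rewrite -kE; apply: le_trans (Am' p); rewrite mulr_ge0 ?dotxx_ge0// ltW.
rewrite k0 /= ltNge; apply/negP => k1.
have := Am p; rewrite qformBm qformZm qform_rank1 kE -exprMn => h.
have : t * dot l p - (t * dot l p) ^+ 2 <= 0.
  by rewrite subr_le0 expr2 ler_peMr.
move=> /(le_trans h); rewrite pmulr_rle0// => /dot_eq0 p0.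
by move: k1; rewrite p0 dot0r mulr0 ler10.
Qed.

Definition rank1_sum L : 'M[R]_d := \sum_(l <- L) rank1 l.

Lemma rank1_sum_sym L : (rank1_sum L)^T = rank1_sum L.
Proof.
by rewrite /rank1_sum raddf_sum; apply: eq_bigr => l _; exact: rank1_sym.
Qed.

Lemma qform_rank1_sum L y : qform (rank1_sum L) y = \sum_(l <- L) dot l y ^+ 2.
Proof.
rewrite /rank1_sum; elim: L => [|l L IH].
  by rewrite !big_nil /qform mulmx0 dot0l.
by rewrite !big_cons qformDm IH qform_rank1.
Qed.

Lemma posdefD A L : posdef A -> posdef (A + rank1_sum L).
Proof.
move=> [As [m m0 Am]]; split; first by rewrite raddfD /= As rank1_sum_sym.
exists m => // y; apply: le_trans (Am y) _.
by rewrite qformDm qform_rank1_sum lerDl sumr_ge0// => l _; rewrite sqr_ge0.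
Qed.

(* Diagonal dominance: [N I + S] is the sum over [i, j] of the squares
   [|S i j| / 2 (y i + sg (S i j) y j) ^ 2] plus a nonnegative diagonal form. *)
Lemma dominant_rank1_sum S : S^T = S -> exists2 N0 : R, 0 <= N0 &
  forall N, N0 <= N -> exists L, N%:M + S = rank1_sum L.
Proof.
move=> Ss; pose D i : R := \sum_j `|S i j|.
have D0 i : 0 <= D i by exact: sumr_ge0.
exists (\sum_i D i); first by rewrite sumr_ge0.
move=> N ND.
have DN i : 0 <= N - D i.
  by rewrite subr_ge0 (le_trans _ ND)// (bigD1 i)//= lerDl sumr_ge0.
pose v i j : 'rV[R]_d := Num.sqrt (`|S i j| / 2) *: (e_ i + Num.sg (S i j) *: e_ j).
exists ([seq v i j | i <- enum 'I_d, j <- enum 'I_d] ++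
        [seq Num.sqrt (N - D i) *: e_ i | i <- enum 'I_d]).
apply: qform_sym_inj; first by rewrite raddfD /= Ss tr_scalar_mx.
  exact: rank1_sum_sym.
move=> y; rewrite qform_rank1_sum big_cat big_allpairs_dep /= big_map !big_enum /=.
have vE i j : dot (v i j) y ^+ 2 =
    `|S i j| * y ord0 i ^+ 2 / 2 + `|S i j| * y ord0 j ^+ 2 / 2 + S i j * (y ord0 i * y ord0 j).
  rewrite /v dotZl dotDl dotZl exprMn sqr_sqrtr; last by rewrite divr_ge0.
  rewrite ![dot (e_ _) _]dotC !dot_delta.
  have [s0|s0|->] := ltgtP (S i j) 0.
  - by rewrite ltr0_sg// ltr0_norm//; field.
  - by rewrite gtr0_sg// gtr0_norm//; field.
  - by rewrite sgr0 normr0; field.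
under eq_bigr do (rewrite big_enum /=; under eq_bigr do rewrite vE).
have -> : \sum_i dot (Num.sqrt (N - D i) *: e_ i) y ^+ 2 =
    \sum_i (N - D i) * y ord0 i ^+ 2.
  apply: eq_bigr => i _; rewrite dotZl dotC dot_delta exprMn sqr_sqrtr//.
have -> : \sum_i \sum_j (`|S i j| * y ord0 i ^+ 2 / 2 + `|S i j| * y ord0 j ^+ 2 / 2
     + S i j * (y ord0 i * y ord0 j)) =
    \sum_i D i * y ord0 i ^+ 2 + qform S y.
  under eq_bigr do rewrite !big_split /=.
  rewrite !big_split /=; congr (_ + _); last first.
    rewrite /qform /dot exchange_big /=; apply: eq_bigr => i _.
    by rewrite mxE mulr_suml; apply: eq_bigr => j _; ring.
  rewrite [X in _ + X]exchange_big /= -big_split /=; apply: eq_bigr => i _.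
  rewrite /D mulr_suml -big_split /=; apply: eq_bigr => j _.
  have -> : S j i = S i j by rewrite -[in LHS]Ss mxE.
  by field.
rewrite qformDm addrAC; congr (_ + _).
rewrite -big_split /= /qform mul_mx_scalar dotZl /dot mulr_sumr.
by apply: eq_bigr => i _; ring.
Qed.

Lemma posdef_scalar_subrank1 A l N : posdef A -> d%:R ^+ 2 * `|l| ^+ 2 <= N ->
  posdef (A + N%:M - rank1 l).
Proof.
move=> [As [m m0 Am]] lN; split.
  by rewrite raddfB raddfD /= As tr_scalar_mx rank1_sym.
exists m => // y; rewrite qformBm qformDm qform_rank1 -addrA.
apply: le_trans (Am y) _; rewrite lerDl subr_ge0 /qform mul_mx_scalar dotZl.
apply: (@le_trans _ _ (d%:R ^+ 2 * `|l| ^+ 2 * dot y y)); last first.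
  by rewrite ler_wpM2r ?dotxx_ge0.
apply: (@le_trans _ _ (d%:R ^+ 2 * `|l| ^+ 2 * `|y| ^+ 2)); last first.
  by rewrite ler_wpM2l ?sqr_norm_le_dot// mulr_ge0 ?sqr_ge0.
rewrite -!exprMn -[leLHS]real_normK ?num_real// lerXn2r ?nnegrE ?mulr_ge0//.
exact: norm_dot_le.
Qed.

End posdef_matrices.

(** * Decay in cones under one step *)

Section window_change.
Context {R : realType} (d : nat) (theta : R).
Hypothesis theta_ge : 2^-1 <= theta.
Variable u : ('rV[R]_d -> R[i]) -> R[i].
Hypothesis u_dual : gs_dual theta u.
Variable z0 : 'rV[R]_(d + d).
Hypothesis z0_neq0 : z0 != 0.
Implicit Types (z b v : 'rV[R]_(d + d)) (p q l : 'rV[R]_d) (A B : 'M[R]_d).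

(** The cone is given by the positive multiples of a ball around [z0], and the weight by the sup
    norm of the whole vector, so that shrinking a cone is a matter of radii. [F] is arbitrary in
    order to treat [u] and its image under [U] alike. *)
Definition cone_decay (F : 'rV[R]_(d + d) -> R) := exists r C e : R,
  [/\ 0 < r, 0 < C, 0 < e & forall t b, 0 < t -> `|b - z0| < r ->
     F (t *: b) <= C * expR (- e * `|t *: b| `^ theta^-1)].

Definition gwin A B z : R := normc (u (packet A B (lsubmx z) (rsubmx z))).

Lemma norm_lsubmx_le z : `|lsubmx z| <= `|z|.
Proof. by apply: norm_le_coord => // i; rewrite mxE coord_le_norm. Qed.

Lemma norm_rsubmx_le z : `|rsubmx z| <= `|z|.
Proof. by apply: norm_le_coord => // i; rewrite mxE coord_le_norm. Qed.

Lemma lsubmx_addZ z w (t : R) : lsubmx (z + t *: w) = lsubmx z + t *: lsubmx w.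
Proof. by apply/rowP => i; rewrite !mxE. Qed.

Lemma rsubmx_addZ z w (t : R) : rsubmx (z + t *: w) = rsubmx z + t *: rsubmx w.
Proof. by apply/rowP => i; rewrite !mxE. Qed.

Lemma near_exponent_le (a e f g h k l : R) : f <= g -> h <= k -> a <= f + (e + h) ->
  k <= l -> e <= 1 -> - g <= 1 - a + l.
Proof. lra. Qed.

Lemma far_exponent_le (a e f g : R) : a <= e + f -> f <= g -> e <= 24^-1 ->
  2 * e + 2 * f <= 1 - a + 3 * g.
Proof. lra. Qed.

(** A shift with |eta v| < t r' stays in the original cone, and passing from |z| to |z + eta v|
    costs a quadratic term in eta. For larger shifts |z| <= c |eta v|, so the decay claimed in z is
    itself only a Gaussian factor in eta, and the subexponential growth of [u] on packets suffices.
    In both cases exp((1 - kappa) eta^2/8) covers the cost. *)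
Lemma cone_decay_step A B l (t1 t2 : R) : posdef (A - t1 ^+ 2 *: rank1 l) -> B^T = B ->
  cone_decay (gwin A B) -> cone_decay (gwin (step_re A l t1 t2) (step_im B l t1 t2)).
Proof.
move=> pAl Bs [r [C [e [r0 C0 e0 dec]]]].
have pA := posdef_rank1 pAl (sqr_ge0 t1).
have pA' : posdef (step_re A l t1 t2).
  by apply: posdef_subrank1 pAl; rewrite lerBlDr lerDl sqr_ge0.
have [p pl] := posdef_surj (t1 *: l) pA.
pose q := p *m B - t2 *: l.
have kk := posdef_slope_lt1 pAl pl.
set kappa := t1 * dot l p in kk *; have /andP[k0 k1] := kk.
pose v : 'rV[R]_(d + d) := row_mx p q.
have nz0 : 0 < `|z0| by rewrite normr_gt0.
(* Half of the radius is for the base point, half for the shift. *)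
set r' := Num.min r `|z0| / 2.
have r'0 : 0 < r' by rewrite divr_gt0// lt_min r0.
have r'r : r' + r' <= r.
  have : Num.min r `|z0| <= r by rewrite ge_min lexx.
  by rewrite /r'; lra.
set c := (`|z0| + r') / r'.
have c0 : 0 < c by rewrite divr_gt0// addr_gt0.
set X := (c + 1) ^+ 2 * `|v| ^+ 2.
have X0 : 0 <= X by rewrite mulr_ge0 ?sqr_ge0.
have vX : `|v| ^+ 2 <= X.
  rewrite /X ler_peMl ?sqr_ge0// exprn_ege1// lerDr ltW//.
have cX : c ^+ 2 * `|v| ^+ 2 <= X.
  by rewrite /X ler_wpM2r ?sqr_ge0// lerXn2r ?nnegrE ?addr_ge0 ?(ltW c0)// lerDl.
(* 24 = 3 * 8: far shifts produce three terms d0 X eta^2, which together may use (1 - kappa)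
   eta^2/8. *)
set d0 := (1 - kappa) / (24 * (X + 1)).
have d00 : 0 < d0 by rewrite divr_gt0 ?subr_gt0// mulr_gt0// ltr_wpDl.
have d0X : d0 * X <= (1 - kappa) / 24.
  rewrite (_ : d0 * X = (1 - kappa) / 24 * (X / (X + 1))); last first.
    by rewrite /d0; field; rewrite gt_eqF// ltr_wpDl.
  rewrite ler_piMr ?divr_ge0 ?subr_ge0 ?(ltW k1)//.
  by rewrite ler_pdivrMr ?ltr_wpDl// mul1r lerDl.
have d01 : d0 <= 24^-1.
  rewrite /d0 ler_pdivrMr; last by rewrite mulr_gt0// ltr_wpDl.
  rewrite mulrA mulVf// mul1r; apply: (@le_trans _ _ 1); last by rewrite lerDr.
  by rewrite gerBl.
set e' := Num.min e d0.
have e'0 : 0 < e' by rewrite lt_min e0.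
have e'e : e' <= e by rewrite ge_min lexx.
have e'd : e' <= d0 by rewrite ge_min lexx orbT.
have [M M0 HM] := dual_packet_le theta_ge u_dual pA Bs d00.
(* kappa/2 is the exponent of the shift factor, (1 - kappa)/8 the allowance for leaving z; the sum
   is below 1/2 because kappa < 1. *)
set g := kappa / 2 + (1 - kappa) / 8.
have [|K K0 HK] := @bmoment_sqr R g; first by apply/andP; split; rewrite /g; lra.
set Q := (C + M) * expR 1.
have Q0 : 0 < Q by rewrite mulr_gt0 ?expR_gt0// addr_gt0.
exists r', (Q * (K + 1)), (e' / 4); split=> //.
- by rewrite mulr_gt0// ltr_wpDl.
- by rewrite divr_gt0.
move=> t b t0 bz; set z := t *: b.
set E := expR (- (e' / 4) * `|z| `^ theta^-1).
have E0 : 0 <= E by exact: expR_ge0.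
apply: (@le_trans _ _ (Q * E * K)); last first.
  by rewrite mulrAC ler_wpM2r// ler_wpM2l ?(ltW Q0)// lerDl.
apply: (window_step_le theta_ge u_dual pAl pA pA' Bs pl (erefl _) kk HK).
  by rewrite mulr_ge0// ltW.
move=> eta; rewrite -/kappa.
have -> : normc (u (packet A B (lsubmx z + eta *: p) (rsubmx z + eta *: q))) =
    gwin A B (z + eta *: v).
  by rewrite /gwin lsubmx_addZ rsubmx_addZ row_mxKl row_mxKr.
have /andP[s0 s2] := theta_inv_le2 theta_ge.
suff H : gwin A B (z + eta *: v) <= (C + M) * expR (1 - e' / 4 * `|z| `^ theta^-1
    + (1 - kappa) / 8 * eta ^+ 2).
  apply: (@le_trans _ _ (expR (eta ^+ 2 * (kappa / 2)) * ((C + M) * expR (1 - e' / 4 * `|z| `^ theta^-1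
    + (1 - kappa) / 8 * eta ^+ 2)))); first by rewrite ler_wpM2l ?expR_ge0.
  rewrite mulrCA /Q /E -!(mulrA (C + M)) -!expRD.
  rewrite le_eqVlt; apply/orP; left; apply/eqP; congr (_ * expR _).
  by rewrite /g; ring.
have zs0 := powR_ge0 `|z| theta^-1.
have [near|far] := ltP (`|eta| * `|v|) (t * r').
  have -> : z + eta *: v = t *: (b + (t^-1 * eta) *: v).
    by rewrite scalerDr scalerA mulrA divff ?gt_eqF// mul1r.
  apply: le_trans (dec _ _ t0 _) _.
    rewrite addrAC; apply: le_lt_trans (ler_normD _ _) _.
    apply: lt_le_trans r'r; apply: ltrD => //.
    by rewrite normrZ normrM normfV (gtr0_norm t0) -mulrA ltr_pdivrMl.
  apply: ler_pM; rewrite ?(ltW C0) ?expR_ge0// ?lerDl ?(ltW M0)// ler_expR.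
  have -> : t *: (b + (t^-1 * eta) *: v) = z + eta *: v.
    by rewrite scalerDr scalerA mulrA divff ?gt_eqF// mul1r.
  set w := `|z + eta *: v| `^ theta^-1.
  have w0 : 0 <= w by exact: powR_ge0.
  have h1 : `|z| `^ theta^-1 <= 4 * (w + (1 + eta ^+ 2 * `|v| ^+ 2)).
    apply: (@le_trans _ _ ((`|z + eta *: v| + `|eta *: v|) `^ theta^-1)).
      rewrite ge0_ler_powR ?nnegrE ?addr_ge0// -[in leLHS](addrK (eta *: v) z).
      exact: ler_normB.
    apply: le_trans (powR_add2 _ _ s0) _ => //.
    apply: ler_pM; rewrite ?powR_ge0 ?addr_ge0 ?powR_ge0//.
      have -> : (4 : R) = 2 `^ 2 by rewrite powR_mulrn// expr2; ring.
      by rewrite ler_powR// ler1n.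
    rewrite lerD2l; apply: le_trans (powR_le1sqr _ s0 s2) _ => //.
    by rewrite (normrZ eta v) exprMn real_normK ?num_real.
  have h2 : e' * w <= e * w by rewrite ler_wpM2r.
  have h3 : e' * (eta ^+ 2 * `|v| ^+ 2) <= (1 - kappa) / 24 * eta ^+ 2.
    rewrite mulrCA mulrC ler_wpM2r ?sqr_ge0//; apply: le_trans d0X.
    by apply: ler_pM; rewrite ?(ltW e'0) ?sqr_ge0.
  have h4 : e' / 4 * `|z| `^ theta^-1 <= e' * (w + (1 + eta ^+ 2 * `|v| ^+ 2)).
    rewrite -mulrA ler_wpM2l ?(ltW e'0)// mulrC ler_pdivrMr// mulrC; exact: h1.
  have h5 : (1 - kappa) / 24 * eta ^+ 2 <= (1 - kappa) / 8 * eta ^+ 2.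
    by rewrite ler_wpM2r ?sqr_ge0//; lra.
  have h6 : e' <= 1 by move: e'd d01; lra.
  move: h4; rewrite mulrDr mulrDr mulr1 => h4.
  by rewrite mulNr; exact: near_exponent_le h2 h3 h4 h5 h6.
have zc : `|z| <= c * (`|eta| * `|v|).
  apply: (@le_trans _ _ (t * (`|z0| + r'))).
    rewrite normrZ (gtr0_norm t0) ler_wpM2l ?(ltW t0)//.
    rewrite -[b](subrK z0) addrC; apply: le_trans (ler_normD _ _) _.
    by rewrite lerD2l ltW.
  rewrite /c mulrAC ler_pdivlMr// (mulrC t) -mulrA; apply: ler_wpM2l => //.
  by rewrite addr_ge0// ltW.
rewrite /gwin; apply: le_trans (HM _ _) _.
apply: ler_pM; rewrite ?(ltW M0) ?expR_ge0// ?lerDr ?(ltW C0)// ler_expR.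
set w := `|z + eta *: v| `^ theta^-1.
have hw : w <= 1 + X * eta ^+ 2.
  apply: le_trans (powR_le1sqr _ s0 s2) _ => //; rewrite lerD2l.
  rewrite (_ : X * _ = ((c + 1) * (`|eta| * `|v|)) ^+ 2); last first.
    by rewrite /X !exprMn real_normK ?num_real//; ring.
  rewrite lerXn2r ?nnegrE ?mulr_ge0 ?addr_ge0 ?(ltW c0)//.
  apply: le_trans (ler_normD _ _) _; rewrite (normrZ eta v) mulrDl mul1r.
  by rewrite lerD2r.
have hz : `|z| `^ theta^-1 <= 1 + X * eta ^+ 2.
  apply: le_trans (powR_le1sqr _ s0 s2) _ => //; rewrite lerD2l.
  apply: (@le_trans _ _ ((c * (`|eta| * `|v|)) ^+ 2)).
    have cv0 : 0 <= c * (`|eta| * `|v|) by rewrite mulr_ge0 ?(ltW c0)// mulr_ge0.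
    by rewrite lerXn2r ?nnegrE.
  have -> : (c * (`|eta| * `|v|)) ^+ 2 = c ^+ 2 * `|v| ^+ 2 * eta ^+ 2.
    by rewrite -[eta ^+ 2]real_normK ?num_real//; ring.
  by rewrite ler_wpM2r ?sqr_ge0.
have hl : `|lsubmx (z + eta *: v)| `^ theta^-1 <= w.
  by rewrite ge0_ler_powR ?nnegrE ?norm_lsubmx_le.
have hr : `|rsubmx (z + eta *: v)| `^ theta^-1 <= w.
  by rewrite ge0_ler_powR ?nnegrE ?norm_rsubmx_le.
have g1 : d0 * (`|lsubmx (z + eta *: v)| `^ theta^-1 + `|rsubmx (z + eta *: v)| `^ theta^-1)
    <= d0 * (2 * (1 + X * eta ^+ 2)).
  rewrite ler_wpM2l ?(ltW d00)// mulr_natl mulr2n; apply: lerD; exact: le_trans hw.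
have g2 : e' / 4 * `|z| `^ theta^-1 <= d0 * (1 + X * eta ^+ 2).
  apply: ler_pM; [by rewrite divr_ge0// ltW|exact: zs0| |exact: hz].
  by apply: le_trans e'd; rewrite ler_pdivrMr// ler_peMr ?(ltW e'0)// ler1n.
have g3 : d0 * X * eta ^+ 2 <= (1 - kappa) / 24 * eta ^+ 2.
  by rewrite ler_wpM2r ?sqr_ge0.
have g4 : (1 - kappa) / 8 * eta ^+ 2 = 3 * ((1 - kappa) / 24 * eta ^+ 2) by field.
rewrite g4; apply: le_trans g1 _.
have -> : d0 * (2 * (1 + X * eta ^+ 2)) = 2 * d0 + 2 * (d0 * X * eta ^+ 2) by ring.
have g2' : e' / 4 * `|z| `^ theta^-1 <= d0 + d0 * X * eta ^+ 2.
  by apply: le_trans g2 _; rewrite mulrDr mulr1 mulrA.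
exact: far_exponent_le.
Qed.

End window_change.

(** * Joining any two windows by steps *)

Section window_chain.
Context {R : realType} (d : nat) (theta : R).
Hypothesis theta_ge : 2^-1 <= theta.
Variable u : ('rV[R]_d -> R[i]) -> R[i].
Hypothesis u_dual : gs_dual theta u.
Variable z0 : 'rV[R]_(d + d).
Hypothesis z0_neq0 : z0 != 0.
Implicit Types (l : 'rV[R]_d) (A B : 'M[R]_d) (L : seq 'rV[R]_d).
Local Notation good A B := (cone_decay theta z0 (gwin u A B)).

Let step A B l (t1 t2 : R) : posdef (A - t1 ^+ 2 *: rank1 l) -> B^T = B ->
  good A B -> good (step_re A l t1 t2) (step_im B l t1 t2).
Proof. exact: cone_decay_step. Qed.

(** Steps with tau = i, for which -tau^2 = 1; since t1 = 0, the positivity condition is that of the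
    current matrix. *)
Lemma cone_decay_add A B L : posdef A -> B^T = B -> good A B -> good (A + rank1_sum L) B.
Proof.
move=> pA Bs; rewrite /rank1_sum; elim: L A pA => [|l L IH] A pA gA.
  by rewrite big_nil addr0.
rewrite big_cons addrA; apply: IH.
  by have := posdefD [:: l] pA; rewrite /rank1_sum big_seq1.
have pA0 : posdef (A - (0 : R) ^+ 2 *: rank1 l) by rewrite expr0n /= scale0r subr0.
have := step 1 pA0 Bs gA.
by rewrite /step_re /step_im expr0n /= expr1n sub0r scaleN1r opprK mulr0 mul0r scale0r subr0.
Qed.

(** Steps with tau = 1, one for each term of the sum; every intermediate matrix is [A] plus a part
    of the sum, hence positive definite. *)
Lemma cone_decay_sub A B L : posdef A -> B^T = B -> good (A + rank1_sum L) B -> good A B.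
Proof.
move=> pA Bs; rewrite /rank1_sum; elim: L => [|l L IH].
  by rewrite big_nil addr0.
rewrite big_cons => gA; apply: IH.
set A' := A + (rank1 l + _) in gA.
have A'E : A' - rank1 l = A + \sum_(l <- L) rank1 l.
  by rewrite /A' [rank1 l + _]addrC addrA addrK.
have pA1 : posdef (A' - (1 : R) ^+ 2 *: rank1 l).
  by rewrite expr1n scale1r A'E; exact: posdefD.
have := step 0 pA1 Bs gA.
by rewrite /step_re /step_im expr0n /= expr1n subr0 scale1r mulr0 scale0r subr0 A'E.
Qed.

(** Steps with tau = 1 + i s: tau^2 = 2 i s is purely imaginary, so only [B] moves. *)
Lemma cone_decay_chirp A B L (s : R) : s ^+ 2 = 1 -> B^T = B ->
  (forall l, l \in L -> posdef (A - rank1 l)) -> good A B ->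
  good A (B - (2 * s) *: rank1_sum L).
Proof.
move=> s1; rewrite /rank1_sum; elim: L B => [|l L IH] B Bs pL gA.
  by rewrite big_nil scaler0 subr0.
rewrite big_cons scalerDr opprD addrA; apply: IH.
- by rewrite linearB linearZ /= rank1_sym Bs.
- by move=> k kL; apply: pL; rewrite in_cons kL orbT.
have pA1 : posdef (A - (1 : R) ^+ 2 *: rank1 l).
  by rewrite expr1n scale1r; apply: pL; rewrite mem_head.
have := step s pA1 Bs gA.
by rewrite /step_re /step_im expr1n s1 subrr scale0r subr0 mulr1.
Qed.

Lemma scalar_rank1_sum (N : R) : 0 <= N -> exists L, N%:M = rank1_sum L :> 'M[R]_d.
Proof.
move=> N0; exists [seq Num.sqrt N *: delta_mx ord0 i | i <- enum 'I_d].
apply: qform_sym_inj; [exact: tr_scalar_mx|exact: rank1_sum_sym|].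
move=> y; rewrite qform_rank1_sum big_map big_enum /= /qform mul_mx_scalar dotZl.
rewrite /dot mulr_sumr; apply: eq_bigr => i _.
by rewrite -/(dot _ y) dotZl dotC dot_delta exprMn sqr_sqrtr.
Qed.

(* A multiple of the identity is added to [A] first, so that the rank one matrices which
   move [B] can be subtracted from [A]. *)
Lemma cone_decay_change A B A' B' : posdef A -> B^T = B -> posdef A' -> B'^T = B' ->
  good A B -> good A' B'.
Proof.
move=> pA Bs pA' Bs' gA; have [As _] := pA; have [As' _] := pA'.
have S1s : (2^-1 *: (B' - B))^T = 2^-1 *: (B' - B) by rewrite linearZ linearB /= Bs Bs'.
have S2s : (A - A')^T = A - A' by rewrite linearB /= As As'.
have [N1 N10 /(_ N1 (lexx _)) [L1 L1E]] := dominant_rank1_sum S1s.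
have [L2 L2E] := scalar_rank1_sum N10.
have [N3 N30 H3] := dominant_rank1_sum S2s.
(* [N3] makes N I + A - A' a sum of rank one matrices; the other terms make A + N I - l^T l positive
   definite for every vector l used to move [B]. *)
pose N := N3 + \sum_(l <- L1 ++ L2) d%:R ^+ 2 * `|l| ^+ 2.
have T0 L : 0 <= \sum_(l <- L) d%:R ^+ 2 * `|l : 'rV[R]_d| ^+ 2.
  by apply: sumr_ge0 => l _; rewrite mulr_ge0 ?sqr_ge0.
have N0 : 0 <= N by rewrite addr_ge0.
have [|L3 L3E] := H3 N; first by rewrite lerDl.
have [L4 L4E] := scalar_rank1_sum N0.
have pN l : l \in L1 ++ L2 -> posdef (A + N%:M - rank1 l).
  move=> lL; apply: posdef_scalar_subrank1 => //.
  apply: (@le_trans _ _ (\sum_(l <- L1 ++ L2) d%:R ^+ 2 * `|l| ^+ 2)); last by rewrite lerDr.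
  rewrite (big_rem l)//= lerDl; exact: T0.
have g1 : good (A + N%:M) B by rewrite L4E; exact: cone_decay_add.
have g2 : good (A + N%:M) (B - (2 * - 1) *: rank1_sum L1).
  apply: cone_decay_chirp => //; first by rewrite sqrrN expr1n.
  by move=> l lL; apply: pN; rewrite mem_cat lL.
have g3 : good (A + N%:M) (B - (2 * - 1) *: rank1_sum L1 - (2 * 1) *: rank1_sum L2).
  apply: cone_decay_chirp => //; first by rewrite expr1n.
    by rewrite linearB linearZ /= Bs rank1_sum_sym.
  by move=> l lL; apply: pN; rewrite mem_cat lL orbT.
apply: (@cone_decay_sub A' B' L3 pA' Bs').
have -> : A' + rank1_sum L3 = A + N%:M.
  by rewrite -L3E [N%:M + _]addrC addrA [A' + _]addrC subrK.
(* With S = (B' - B)/2, B' = B + 2 (N1 I + S) - 2 N1 I; a symmetric S is in general only a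
   difference of sums of rank one matrices. *)
have -> : B' = B - (2 * - 1) *: rank1_sum L1 - (2 * 1) *: rank1_sum L2.
  rewrite -L1E -L2E mulr1 mulrN1 scaleNr opprK scalerDr scalerA mulfV// scale1r.
  by rewrite -addrA addrAC subrr add0r addrC subrK.
exact: g3.
Qed.

End window_chain.

(** * Integration of complex functions on row vectors *)

Section lebesgue_rV_integral.
Context {R : realType}.
Local Open Scope ereal_scope.
Notation leb1 := (@lebesgue_measure R).
Notation leb n := (lebesgue_rV (R := R) n).

Lemma measurable_addr1 (a : R) : measurable_fun setT ((fun t => (t + a)%R) : measurableTypeR R -> measurableTypeR R).
Proof. by apply: measurable_funD => //; exact: measurable_cst. Qed.

Lemma lebesgue_measure_translate (a : R) (A : set (measurableTypeR R)) : measurable A ->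
  pushforward leb1 ((fun t => (t + a)%R) : measurableTypeR R -> measurableTypeR R) A = leb1 A.
Proof.
move=> mA; apply/esym/lebesgue_measure_unique => //=; first exact: measurable_addr1.
move=> _ _ [[b c]] _ <-; rewrite /pushforward.
have -> : (fun t => (t + a)%R) @^-1` `]b, c]%classic = `](b - a)%R, (c - a)%R]%classic.
  by apply/seteqP; split => t /=; rewrite !in_itv /= ltrBlDr lerBrDr.
rewrite !lebesgue_measure_itv /= !lte_fin ltrD2r; case: ifP => // _.
by rewrite -!EFinB; congr EFin; ring.
Qed.

Lemma ge0_integral_translate1 (a : R) (f : measurableTypeR R -> \bar R) :
  measurable_fun setT f -> (forall t, 0 <= f t) ->
  \int[leb1]_t f (t + a)%R = \int[leb1]_t f t.
Proof.
move=> mf f0.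
have := @ge0_integral_pushforward _ _ _ _ _ _ (measurable_addr1 a) leb1 setT f measurableT mf (fun t _ => f0 t).
rewrite preimage_setT => /esym E; rewrite -[LHS]/(\int[leb1]_t (f \o (fun t => (t + a)%R)) t).
rewrite E; apply: eq_measure_integral; first exact: measurable_addr1.
by move=> ? A mA _; exact: lebesgue_measure_translate.
Qed.

Lemma ge0_integral_cons n (f : 'rV[R]_n.+1 -> \bar R) :
  measurable_fun setT f -> (forall x, 0 <= f x) ->
  \int[leb n.+1]_x f x = \int[leb1]_t \int[leb n]_x f (cons_rV (t, x)).
Proof.
move=> mf f0.
have := @ge0_integral_pushforward _ _ _ _ _ _ (@measurable_cons_rV R n) (leb1 \x leb n)
  setT f measurableT mf (fun t _ => f0 t).
rewrite preimage_setT => E.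
transitivity (\int[(leb1 \x leb n)]_p (f \o @cons_rV R n) p) => //.
apply: (fubini_tonelli1 (f \o @cons_rV R n)); last by move=> p; exact: f0.
by apply: measurableT_comp => //; exact: measurable_cons_rV.
Qed.

Lemma measurable_pair_cons n (t : measurableTypeR R) : measurable_fun setT (fun x : 'rV[R]_n => cons_rV (t, x)).
Proof.
apply: measurableT_comp; first exact: measurable_cons_rV.
exact: pair1_measurable.
Qed.

Lemma measurable_translate n (a : 'rV[R]_n) : measurable_fun setT (fun x : 'rV[R]_n => (x + a)%R).
Proof.
apply: measurable_fun_rV => i; under eq_fun do rewrite mxE.
by apply: measurable_funD => //; exact: measurable_coord_rV.
Qed.

(** Tonelli splits off the first coordinate, where one-dimensional invariance applies; induction
    handles the others. *)
Lemma ge0_integral_translate n (a : 'rV[R]_n) (f : 'rV[R]_n -> \bar R) :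
  measurable_fun setT f -> (forall x, 0 <= f x) ->
  \int[leb n]_x f (x + a)%R = \int[leb n]_x f x.
Proof.
elim: n a f => [|n IH] a f mf f0.
  by apply: eq_integral => x _; congr f; apply/rowP => -[].
have mfa : measurable_fun setT (fun x : 'rV[R]_n.+1 => f (x + a)%R).
  by apply: measurableT_comp => //; exact: measurable_translate.
rewrite (ge0_integral_cons mf f0) (ge0_integral_cons mfa (fun x => f0 _)).
pose a' : 'rV[R]_n := (\row_j a ord0 (lift ord0 j))%R.
have E t x : (cons_rV (t, x) + a)%R = cons_rV ((t + a ord0 ord0)%R, (x + a')%R) :> 'rV[R]_n.+1.
  apply/rowP => j; rewrite !mxE; case: unliftP => [k ->|->] //=.
  by rewrite !mxE.
under eq_integral => t _ do (under eq_integral => x _ do rewrite E).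
have mg t : measurable_fun setT (fun x : 'rV[R]_n => f (cons_rV (t, x))).
  by apply: measurableT_comp => //; exact: measurable_pair_cons.
under eq_integral => t _ do rewrite (IH a' (fun x => f (cons_rV ((t + a ord0 ord0)%R, x))))//.
apply: (ge0_integral_translate1 (a ord0 ord0) (f := fun t => \int[leb n]_x f (cons_rV (t, x)))).
- apply: (@measurable_fun_fubini_tonelli_F _ _ _ _ _ (leb n) (f \o @cons_rV R n)).
    by apply: measurableT_comp => //; exact: measurable_cons_rV.
  by move=> p; exact: f0.
- by move=> t; apply: integral_ge0 => x _; exact: f0.
Qed.

End lebesgue_rV_integral.

Section complex_measurability.
Context {R : realType} d (T : measurableType d).
Implicit Types (f g : T -> R[i]).

Definition cmeasurable f := measurable_fun setT (fun x => complex.Re (f x) : R) /\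
  measurable_fun setT (fun x => complex.Im (f x) : R).

Lemma cmeasurable_cst (c : R[i]) : cmeasurable (fun=> c).
Proof. by split; exact: measurable_cst. Qed.

Lemma cmeasurableD f g : cmeasurable f -> cmeasurable g -> cmeasurable (fun x => f x + g x).
Proof.
move=> [fr fi] [gr gi]; split.
  apply: (eq_measurable_fun (fun x => complex.Re (f x) + complex.Re (g x))).
    by move=> x _; rewrite cReD.
  exact: measurable_funD.
apply: (eq_measurable_fun (fun x => complex.Im (f x) + complex.Im (g x))).
  by move=> x _; rewrite cImD.
exact: measurable_funD.
Qed.

Lemma cmeasurableM f g : cmeasurable f -> cmeasurable g -> cmeasurable (fun x => f x * g x).
Proof.
move=> [fr fi] [gr gi]; split.
  apply: (eq_measurable_fun (fun x => complex.Re (f x) * complex.Re (g x) -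
      complex.Im (f x) * complex.Im (g x))); first by move=> x _; rewrite cReM.
  by apply: measurable_funB; exact: measurable_funM.
apply: (eq_measurable_fun (fun x => complex.Re (f x) * complex.Im (g x) +
    complex.Im (f x) * complex.Re (g x))); first by move=> x _; rewrite cImM.
by apply: measurable_funD; exact: measurable_funM.
Qed.

Lemma cmeasurable_conjc f : cmeasurable f -> cmeasurable (fun x => conjc (f x)).
Proof.
move=> [fr fi]; split.
  by apply: (eq_measurable_fun (fun x => complex.Re (f x))) => // x _; case: (f x).
apply: (eq_measurable_fun (fun x => - complex.Im (f x))); last exact: measurable_funN.
by move=> x _; case: (f x).
Qed.

Lemma measurable_cos_fun (h : T -> R) : measurable_fun setT h -> measurable_fun setT (fun x => cos (h x)).
Proof. by move=> mh; apply: measurableT_comp => //; apply: continuous_measurable_fun; exact: continuous_cos. Qed.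

Lemma measurable_sin_fun (h : T -> R) : measurable_fun setT h -> measurable_fun setT (fun x => sin (h x)).
Proof. by move=> mh; apply: measurableT_comp => //; apply: continuous_measurable_fun; exact: continuous_sin. Qed.

Lemma measurable_expR_fun (h : T -> R) : measurable_fun setT h -> measurable_fun setT (fun x => expR (h x)).
Proof. by move=> mh; apply: measurableT_comp => //; exact: measurable_expR. Qed.

Lemma cmeasurable_cexp (g1 g2 : T -> R) : measurable_fun setT g1 -> measurable_fun setT g2 ->
  cmeasurable (fun x => cexp (g1 x) (g2 x)).
Proof.
move=> m1 m2; split.
  apply: (eq_measurable_fun (fun x => expR (g1 x) * cos (g2 x))).
    by move=> x _; rewrite cexpE.
  by apply: measurable_funM; [exact: measurable_expR_fun|exact: measurable_cos_fun].
apply: (eq_measurable_fun (fun x => expR (g1 x) * sin (g2 x))).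
  by move=> x _; rewrite cexpE.
by apply: measurable_funM; [exact: measurable_expR_fun|exact: measurable_sin_fun].
Qed.

Lemma measurable_normc f : cmeasurable f -> measurable_fun setT (fun x => normc (f x)).
Proof.
move=> [fr fi].
apply: (eq_measurable_fun (fun x => Num.sqrt (complex.Re (f x) ^+ 2 + complex.Im (f x) ^+ 2))).
  by move=> x _; rewrite normcE2.
apply: (@measurableT_comp _ _ _ _ _ _ (@Num.sqrt R)).
  by apply: continuous_measurable_fun; exact: sqrt_continuous.
by apply: measurable_funD; exact: measurable_funX.
Qed.

End complex_measurability.

Section complex_integrals.
Context {R : realType} d (T : measurableType d) (mu : {measure set T -> \bar R}).
Implicit Types (f g : T -> R[i]) (h : T -> R).

Definition cintegrable f := cmeasurable f /\ (\int[mu]_x (normc (f x))%:E < +oo)%E.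

Lemma cintegrable_Re f : cintegrable f -> mu.-integrable setT (EFin \o (fun x => complex.Re (f x))).
Proof.
move=> [mf foo]; have [fr fi] := mf; apply/integrableP; split; first exact/measurable_EFinP.
apply: le_lt_trans foo; apply: ge0_le_integral => //.
- by apply: measurableT_comp => //; exact/measurable_EFinP.
- by apply/measurable_EFinP; exact: measurable_normc.
- by move=> x _; rewrite /= lee_fin Re_le_normc.
Qed.

Lemma cintegrable_Im f : cintegrable f -> mu.-integrable setT (EFin \o (fun x => complex.Im (f x))).
Proof.
move=> [mf foo]; have [fr fi] := mf; apply/integrableP; split; first exact/measurable_EFinP.
apply: le_lt_trans foo; apply: ge0_le_integral => //.
- by apply: measurableT_comp => //; exact/measurable_EFinP.
- by apply/measurable_EFinP; exact: measurable_normc.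
- by move=> x _; rewrite /= lee_fin Im_le_normc.
Qed.

Lemma cintegrable_le f h : cmeasurable f -> mu.-integrable setT (EFin \o h) ->
  (forall x, normc (f x) <= h x) -> cintegrable f.
Proof.
move=> mf /integrableP[mh hoo] fh; split=> //.
apply: le_lt_trans hoo; apply: ge0_le_integral => //.
- by move=> x _; rewrite lee_fin normc_ge0.
- by apply/measurable_EFinP; exact: measurable_normc.
- exact: measurableT_comp.
- by move=> x _; rewrite /= lee_fin (le_trans (fh x))// ler_norm.
Qed.

Lemma cintegrable_normc f : cintegrable f -> mu.-integrable setT (EFin \o (fun x => normc (f x))).
Proof.
move=> [mf foo]; apply/integrableP; split.
  by apply/measurable_EFinP; exact: measurable_normc.
apply: le_lt_trans foo; apply: ge0_le_integral => //.
- by apply: measurableT_comp => //; apply/measurable_EFinP; exact: measurable_normc.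
- by apply/measurable_EFinP; exact: measurable_normc.
- by move=> x _; rewrite /= lee_fin ger0_norm// normc_ge0.
Qed.

Lemma cintegrableZ c f : cintegrable f -> cintegrable (fun x => c * f x).
Proof.
move=> fi; have [mf _] := fi.
apply: (@cintegrable_le _ (fun x => normc c * normc (f x))).
- by apply: cmeasurableM => //; exact: cmeasurable_cst.
- have := integrableZl measurableT (normc c) (cintegrable_normc fi).
  by apply: eq_integrable => // x _; rewrite /= EFinM.
- by move=> x; rewrite normcM.
Qed.

Lemma cintegrableD f g : cintegrable f -> cintegrable g -> cintegrable (fun x => f x + g x).
Proof.
move=> fi gi; have [mf _] := fi; have [mg _] := gi.
apply: (@cintegrable_le _ (fun x => normc (f x) + normc (g x))).
- exact: cmeasurableD.
- have := integrableD measurableT (cintegrable_normc fi) (cintegrable_normc gi).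
  by apply: eq_integrable => // x _; rewrite /= EFinD.
- by move=> x; exact: le_normcD.
Qed.

Lemma complex_integralZ c f : cintegrable f ->
  complex_integral mu (fun x => c * f x) = c * complex_integral mu f.
Proof.
move=> fi; have fr := cintegrable_Re fi; have fim := cintegrable_Im fi.
have Zr (a : R) h : mu.-integrable setT (EFin \o h) -> mu.-integrable setT (EFin \o (fun x => a * h x)).
  move=> hi; have := integrableZl measurableT a hi.
  by apply: eq_integrable => // x _; rewrite /= EFinM.
apply: complexP; rewrite ?cReM ?cImM /complex_integral /=.
  under eq_Rintegral do rewrite cReM.
  by rewrite RintegralB//; [rewrite !RintegralZl//|exact: Zr|exact: Zr].
under eq_Rintegral do rewrite cImM.
by rewrite RintegralD//; [rewrite !RintegralZl//|exact: Zr|exact: Zr].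
Qed.

Lemma complex_integralD f g : cintegrable f -> cintegrable g ->
  complex_integral mu (fun x => f x + g x) = complex_integral mu f + complex_integral mu g.
Proof.
move=> fi gi; apply: complexP; rewrite ?cReD ?cImD /complex_integral /=.
  under eq_Rintegral do rewrite cReD.
  by rewrite RintegralD//; exact: cintegrable_Re.
under eq_Rintegral do rewrite cImD.
by rewrite RintegralD//; exact: cintegrable_Im.
Qed.

(** Real and imaginary parts are bounded separately, hence the factor 2. *)
Lemma normc_complex_integral_le f h : cintegrable f -> mu.-integrable setT (EFin \o h) ->
  (forall x, normc (f x) <= h x) -> normc (complex_integral mu f) <= 2 * \int[mu]_x h x.
Proof.
move=> fi hi fh; apply: le_trans (normc_le_ReIm _) _; rewrite mulr_natl mulr2n /=.
have abs (k : T -> R) : mu.-integrable setT (EFin \o k) -> mu.-integrable setT (EFin \o (fun x => `|k x|)).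
  by move=> /integrable_abse.
have fr := cintegrable_Re fi; have fim := cintegrable_Im fi.
apply: lerD.
  apply: le_trans (le_normr_Rintegral _ _) _ => //.
  apply: le_Rintegral => //; first exact: abs.
  by move=> x _; exact: le_trans (Re_le_normc _) (fh x).
apply: le_trans (le_normr_Rintegral _ _) _ => //.
apply: le_Rintegral => //; first exact: abs.
by move=> x _; exact: le_trans (Im_le_normc _) (fh x).
Qed.

Lemma complex_integral_real h :
  complex_integral mu (fun x => (h x)%:C) = (\int[mu]_x h x)%:C.
Proof.
apply: complexP => //=; rewrite /complex_integral /= /Rintegral.
by under eq_integral do []; rewrite integral0.
Qed.

End complex_integrals.

Section complex_fubini.
Context {R : realType} d1 d2 (T1 : measurableType d1) (T2 : measurableType d2).
Variables (m1 : {sigma_finite_measure set T1 -> \bar R}).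
Variables (m2 : {sigma_finite_measure set T2 -> \bar R}).

(** Integrability of every slice makes each inner integral finite, so that the real-valued inner
    integral agrees pointwise with the extended one of Fubini's theorem. *)
Lemma Rintegral_prod (f : T1 * T2 -> R) :
  (m1 \x m2)%E.-integrable setT (EFin \o f) ->
  (forall x, m2.-integrable setT (EFin \o (fun y => f (x, y)))) ->
  \int[(m1 \x m2)%E]_p f p = \int[m1]_x \int[m2]_y f (x, y).
Proof.
move=> fi fs; rewrite /Rintegral -integral12_prod_meas1//; congr fine.
apply: eq_integral => x _; rewrite /fubini_F fineK//; apply: integrable_fin_num => //; exact: fs.
Qed.

Lemma complex_integral_prod (f : T1 * T2 -> R[i]) : cmeasurable f ->
  (forall x, cintegrable m2 (fun y => f (x, y))) ->
  (\int[m1]_x \int[m2]_y (normc (f (x, y)))%:E < +oo)%E ->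
  complex_integral (m1 \x m2)%E f =
  complex_integral m1 (fun x => complex_integral m2 (fun y => f (x, y))).
Proof.
move=> mf fs foo.
have fi : cintegrable (m1 \x m2)%E f.
  split=> //; rewrite fubini_tonelli1//.
    by apply/measurable_EFinP; exact: measurable_normc.
  by move=> p; rewrite lee_fin normc_ge0.
apply: complexP; rewrite /complex_integral /=.
  rewrite Rintegral_prod//; first exact: (cintegrable_Re fi).
  by move=> x; exact: (cintegrable_Re (fs x)).
rewrite Rintegral_prod//; first exact: (cintegrable_Im fi).
by move=> x; exact: (cintegrable_Im (fs x)).
Qed.

End complex_fubini.

Section lebesgue_rV_translation.
Context {R : realType} (n : nat).
Notation leb := (lebesgue_rV (R := R) n).

Lemma Rintegral_translate (a : 'rV[R]_n) (f : 'rV[R]_n -> R) :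
  measurable_fun setT f -> \int[leb]_x f (x + a) = \int[leb]_x f x.
Proof.
move=> mf; rewrite /Rintegral [in LHS]integralE [in RHS]integralE.
have mef : measurable_fun setT (EFin \o f) by exact/measurable_EFinP.
have := ge0_integral_translate a (measurable_funepos mef) (fun x => funepos_ge0 _ x).
have := ge0_integral_translate a (measurable_funeneg mef) (fun x => funeneg_ge0 _ x).
by move=> <- <-; congr (fine (_ - _)); apply: eq_integral => x _; rewrite ?funeposE ?funenegE.
Qed.

Lemma complex_integral_translate (a : 'rV[R]_n) (f : 'rV[R]_n -> R[i]) :
  cmeasurable f -> complex_integral leb (fun x => f (x + a)) = complex_integral leb f.
Proof.
move=> [fr fi]; apply: complexP; rewrite /complex_integral /=.
  exact: (Rintegral_translate a fr).
exact: (Rintegral_translate a fi).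
Qed.

Lemma cintegrable_translate (a : 'rV[R]_n) (f : 'rV[R]_n -> R[i]) :
  cintegrable leb f -> cintegrable leb (fun x => f (x + a)).
Proof.
move=> [mf foo]; have [fr fi] := mf; split.
  split.
    exact: (@measurableT_comp _ _ _ _ _ _ (fun x : 'rV[R]_n => complex.Re (f x)) _ _ fr (measurable_translate a)).
  exact: (@measurableT_comp _ _ _ _ _ _ (fun x : 'rV[R]_n => complex.Im (f x)) _ _ fi (measurable_translate a)).
have mn : measurable_fun setT (fun x : 'rV[R]_n => (normc (f x))%:E).
  by apply/measurable_EFinP; exact: measurable_normc.
by rewrite (ge0_integral_translate a mn)// => x; rewrite lee_fin normc_ge0.
Qed.

End lebesgue_rV_translation.

Section vector_measurability.
Context {R : realType} d (T : measurableType d) (n : nat).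
Implicit Types (f g : T -> 'rV[R]_n).

Lemma measurable_entry f i : measurable_fun setT f ->
  measurable_fun setT (fun t => f t ord0 i : measurableTypeR R).
Proof. by move=> mf; apply: measurableT_comp (measurable_coord_rV i) mf. Qed.

Lemma measurable_funsum (I : Type) (r : seq I) (F : I -> T -> R) :
  (forall i, measurable_fun setT (F i)) -> measurable_fun setT (fun t => \sum_(i <- r) F i t).
Proof.
move=> mF; elim: r => [|i r IH].
  apply: (eq_measurable_fun (fun=> 0 : R)); last exact: measurable_cst.
  by move=> t _; rewrite big_nil.
apply: (eq_measurable_fun (fun t => F i t + \sum_(i <- r) F i t)).
  by move=> t _; rewrite big_cons.
exact: measurable_funD.
Qed.

Lemma measurable_dot f g : measurable_fun setT f -> measurable_fun setT g ->
  measurable_fun setT (fun t => dot (f t) (g t)).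
Proof.
move=> mf mg; apply: measurable_funsum => i; apply: measurable_funM.
  exact: measurable_entry.
exact: measurable_entry.
Qed.

Lemma measurable_vecD f g : measurable_fun setT f -> measurable_fun setT g ->
  measurable_fun setT (fun t => f t + g t).
Proof.
move=> mf mg; apply: measurable_fun_rV => i.
apply: (eq_measurable_fun (fun t => f t ord0 i + g t ord0 i)).
  by move=> t _; rewrite mxE.
by apply: measurable_funD; exact: measurable_entry.
Qed.

Lemma measurable_vecZ (a : R) f : measurable_fun setT f ->
  measurable_fun setT (fun t => a *: f t).
Proof.
move=> mf; apply: measurable_fun_rV => i.
apply: (eq_measurable_fun (fun t => a * f t ord0 i)).
  by move=> t _; rewrite mxE.
by apply: measurable_funM; [exact: measurable_cst|exact: measurable_entry].
Qed.

Lemma measurable_vecB f g : measurable_fun setT f -> measurable_fun setT g ->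
  measurable_fun setT (fun t => f t - g t).
Proof.
move=> mf mg; apply: (eq_measurable_fun (fun t => f t + (- 1) *: g t)).
  by move=> t _; rewrite scaleN1r.
by apply: measurable_vecD => //; exact: measurable_vecZ.
Qed.

Lemma measurable_vec_mulmx f (A : 'M[R]_n) : measurable_fun setT f ->
  measurable_fun setT (fun t => f t *m A).
Proof.
move=> mf; apply: measurable_fun_rV => i.
apply: (eq_measurable_fun (fun t => \sum_j f t ord0 j * A j i)).
  by move=> t _; rewrite mxE.
apply: measurable_funsum => j; apply: measurable_funM; last exact: measurable_cst.
exact: measurable_entry.
Qed.

Lemma measurable_qform f (A : 'M[R]_n) : measurable_fun setT f ->
  measurable_fun setT (fun t => qform A (f t)).
Proof. by move=> mf; apply: measurable_dot => //; exact: measurable_vec_mulmx. Qed.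

End vector_measurability.

Section gaussian_integrability.
Context {R : realType}.
Notation leb n := (lebesgue_rV (R := R) n).

(** The integrand is a multiple of the normal density with variance 1/(2m). *)
Lemma integrable_gauss1 (m : R) : 0 < m ->
  (\int[@lebesgue_measure R]_t (expR (- (m * t ^+ 2)))%:E < +oo)%E.
Proof.
move=> m0; set s : R := Num.sqrt (2 * m)^-1.
have m20 : 0 < 2 * m by rewrite mulr_gt0.
have s0 : s != 0 by rewrite gt_eqF// sqrtr_gt0 invr_gt0.
have s2 : s ^+ 2 = (2 * m)^-1 by rewrite sqr_sqrtr// invr_ge0 ltW.
have pk := normal_peak_gt0 s0.
have /integrableP[_ foo] := @integrable_normal_pdf R 0 s.
have E t : expR (- (m * t ^+ 2)) = (normal_peak s)^-1 * normal_pdf 0 s t.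
  rewrite normal_pdfE// mulrA mulVf ?gt_eqF// mul1r /normal_fun subr0.
  congr expR; rewrite -[s ^+ 2 *+ 2]mulr_natl s2; field.
  by rewrite gt_eqF.
under eq_integral do rewrite E EFinM.
rewrite ge0_integralZl//=.
- rewrite lte_mul_pinfty ?lee_fin ?invr_ge0 ?(ltW pk)//.
  move: foo; apply: le_lt_trans; apply: ge0_le_integral => //.
  + by move=> t _; rewrite lee_fin normal_pdf_ge0.
  + by apply/measurable_EFinP; exact: measurable_normal_pdf.
  + by apply: measurableT_comp => //; apply/measurable_EFinP; exact: measurable_normal_pdf.
  + by move=> t _; rewrite /= lee_fin ler_norm.
- by apply/measurable_EFinP; exact: measurable_normal_pdf.
- by move=> t _; rewrite lee_fin normal_pdf_ge0.
- by rewrite lee_fin invr_ge0 ltW.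
Qed.

Lemma dot_cons n (t : R) (x : 'rV[R]_n) :
  dot (cons_rV (t, x)) (cons_rV (t, x)) = t ^+ 2 + dot x x.
Proof.
rewrite /dot big_ord_recl !mxE unlift_none /= expr2; congr (_ + _).
by apply: eq_bigr => i _; rewrite !mxE liftK.
Qed.

Lemma measurable_gauss n (m : R) :
  measurable_fun setT (fun x : 'rV[R]_n => expR (- (m * dot x x))).
Proof.
apply: measurable_expR_fun; apply: measurable_funN; apply: measurable_funM; first exact: measurable_cst.
by apply: measurable_dot; exact: measurable_id.
Qed.

Lemma gauss_integral_lty n (m : R) : 0 < m ->
  (\int[leb n]_x (expR (- (m * dot x x)))%:E < +oo)%E.
Proof.
move=> m0; elim: n => [|n IH].
  rewrite integral_dirac//; first by rewrite diracE mem_set// mul1e ltry.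
  by apply/measurable_EFinP; exact: measurable_gauss.
rewrite ge0_integral_cons; [|by apply/measurable_EFinP; exact: measurable_gauss|
  by move=> x; rewrite lee_fin expR_ge0].
under eq_integral => t _ do (under eq_integral => x _ do
  rewrite dot_cons mulrDr opprD expRD EFinM).
have mg : measurable_fun setT (fun x : 'rV[R]_n => (expR (- (m * dot x x)))%:E).
  by apply/measurable_EFinP; exact: measurable_gauss.
under eq_integral => t _.
  rewrite ge0_integralZl//.
  over.
rewrite ge0_integralZr//.
- have I0 : (0 <= \int[leb n]_x (expR (- (m * dot x x)))%:E)%E.
    by apply: integral_ge0 => x _; rewrite lee_fin expR_ge0.
  apply: lte_mul_pinfty; last exact: IH.
    by apply: integral_ge0 => x _; rewrite lee_fin expR_ge0.
  by rewrite ge0_fin_numE ?integrable_gauss1// integral_ge0// => x _; rewrite lee_fin expR_ge0.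
- apply/measurable_EFinP; apply: measurable_expR_fun; apply: measurable_funN.
  by apply: measurable_funM; [exact: measurable_cst|exact: measurable_funX].
- by apply: integral_ge0 => x _; rewrite lee_fin expR_ge0.
Qed.

Lemma integrable_gauss n (m : R) : 0 < m ->
  (leb n).-integrable setT (EFin \o (fun x => expR (- (m * dot x x)))).
Proof.
move=> m0; apply/integrableP; split; first by apply/measurable_EFinP; exact: measurable_gauss.
under eq_integral do rewrite /= ger0_norm ?expR_ge0//.
exact: gauss_integral_lty.
Qed.

End gaussian_integrability.

(** * Fourier transform of a Gaussian *)

Section gaussian_fourier.
Context {R : realType}.
Implicit Types (x t a b : R).

Lemma expR_taylor1_le x : `|expR x - 1 - x| <= (expR 1 + 3) * (x ^+ 2 * expR `|x|).
Proof.
have e0 : 0 <= expR 1 :> R by exact: expR_ge0.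
have ex1 : 1 <= expR `|x| by rewrite -expR0 ler_expR.
have [x1|x1] := leP `|x| 1.
  have h := expR_taylor2 x1.
  have h2 : `|x| ^+ 3 <= x ^+ 2.
    by rewrite -[x ^+ 2]real_normK ?num_real// exprS ler_piMl// sqr_ge0.
  have h3 : expR 1 * `|x| ^+ 3 <= expR 1 * x ^+ 2 by rewrite ler_wpM2l.
  have h4 : (expR 1 + 3) * x ^+ 2 <= (expR 1 + 3) * (x ^+ 2 * expR `|x|).
    by rewrite ler_wpM2l ?addr_ge0// ler_peMr// sqr_ge0.
  have x20 := sqr_ge0 x.
  apply: le_trans h4; move: (le_trans h h3); rewrite !ler_norml => /andP[u1 u2].
  by rewrite mulrDl; apply/andP; split; lra.
have h1 : `|expR x| <= expR `|x| by rewrite ger0_norm ?expR_ge0// ler_expR ler_norm.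
have h2 : `|x| <= expR `|x| by apply: le_trans (expR_ge1Dx _); rewrite lerDr.
have h3 : 3 * expR `|x| <= (expR 1 + 3) * (x ^+ 2 * expR `|x|).
  rewrite mulrA ler_wpM2r ?expR_ge0//.
  apply: (@le_trans _ _ (3 * x ^+ 2)); last by rewrite ler_wpM2r ?sqr_ge0// lerDr.
  by rewrite ler_peMr// -[x ^+ 2]real_normK ?num_real// exprn_ege1// ltW.
apply: le_trans h3; apply: le_trans (ler_normB _ _) _.
apply: le_trans (lerD (ler_normB _ _) (lexx _)) _; rewrite normr1.
by lra.
Qed.

Lemma cis_taylor1_le b : normc (cexp 0 b - 1 - (0 +i* b)) <= 4 * b ^+ 2.
Proof.
apply: le_trans (normc_le_ReIm _) _; rewrite cexpE expR0 !mul1r /=.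
rewrite subr0 subr0.
have b20 := sqr_ge0 b.
have [b1|b1] := leP `|b| 1.
  have h3 : `|b| ^+ 3 <= b ^+ 2.
    by rewrite -[b ^+ 2]real_normK ?num_real// exprS ler_piMl// sqr_ge0.
  have := le_trans (cos_taylor2 b1) h3; have := le_trans (sin_taylor2 b1) h3 => h1.
  move=> h2; have : `|cos b - 1| <= 2 * b ^+ 2.
    by move: h2; rewrite !ler_norml => /andP[u1 u2]; apply/andP; split; lra.
  by lra.
have b2 : 1 <= b ^+ 2 by rewrite -[b ^+ 2]real_normK ?num_real// exprn_ege1// ltW.
have bb : `|b| <= b ^+ 2.
  by rewrite -[b ^+ 2]real_normK ?num_real// expr2 ler_peMl// ltW.
have h1 : `|cos b - 1| <= 2 * b ^+ 2.
  have := cos_le1 b; have := cos_geN1 b => u1 u2.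
  by rewrite ler_norml; apply/andP; split; lra.
have h2 : `|sin b - b| <= 2 * b ^+ 2.
  have := sin_le1 b; have := sin_geN1 b => u1 u2.
  by move: bb; rewrite !ler_norml => /andP[? ?]; apply/andP; split; lra.
by lra.
Qed.

Lemma is_derive_quadratic (f : R -> R) (t l K : R) :
  (forall e, `|e| <= 1 -> `|f (t + e) - f t - l * e| <= K * e ^+ 2) ->
  is_derive t (1 : R) f l.
Proof.
move=> fK.
have K0 : 0 <= K.
  by have := fK 1; rewrite normr1 => /(_ (lexx _)) h; have := le_trans (normr_ge0 _) h; rewrite expr1n mulr1.
have c : (fun h : R => h^-1 *: (f (h *: (1 : R) + t) - f t)) @ 0^' --> l.
  apply/cvgrPdist_le => eps eps0; near=> h.
  have h0 : h != 0 by near: h; exact: nbhs_dnbhs_neq.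
  have h1 : `|h| <= 1.
    by near: h; apply: dnbhs0_le.
  have h2 : `|h| <= eps / (K + 1).
    by near: h; apply: dnbhs0_le; rewrite divr_gt0// ltr_wpDl.
  have nh : 0 < `|h| by rewrite normr_gt0.
  rewrite distrC -(ler_pM2l nh) -normrM.
  have -> : h * (h^-1 *: (f (h *: (1 : R) + t) - f t) - l) = f (t + h) - f t - l * h.
    rewrite /GRing.scale /= mulr1 [h + t]addrC mulrBr mulrA divff// mul1r.
    by rewrite [h * l]mulrC.
  apply: le_trans (fK h h1) _.
  rewrite -[h ^+ 2]real_normK ?num_real// expr2 mulrCA ler_wpM2l//.
  apply: (@le_trans _ _ (K * (eps / (K + 1)))); first by rewrite ler_wpM2l.
  by rewrite mulrCA ler_piMr ?(ltW eps0)// ler_pdivrMr ?ltr_wpDl// mul1r lerDl.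
split; first by apply/cvg_ex; exists l.
exact: (cvg_lim _ c).
Unshelve. all: by end_near. Qed.

(** The hypothesis is F' = -(t s/2) F, written with a quadratic remainder so that an integral can
    satisfy it without differentiation under the integral sign. The product of F with exp(t^2 s/4)
    then has derivative zero. *)
Lemma gaussian_ode (F : R -> R[i]) (s : R) :
  (forall t, exists K, forall e, `|e| <= 1 ->
    normc (F (t + e) - F t + ((t * e * s / 2)%:C * F t)) <= K * e ^+ 2) ->
  F 1 = (expR (- (s / 4)))%:C * F 0.
Proof.
move=> HF.
have comp (g : R -> R) : (forall t, is_derive t (1 : R) g (- (t * s / 2) * g t)) ->
    g 1 = expR (- (s / 4)) * g 0.
  move=> Dg; pose h (t : R) := expR (t ^+ 2 * (s / 4)) * g t.
  have Dh t : is_derive t (1 : R) h 0.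
    have Dg' := Dg t.
    have De : is_derive t (1 : R) (fun t : R => expR (t ^+ 2 * (s / 4)))
        (t * s / 2 * expR (t ^+ 2 * (s / 4))).
      by apply: is_derive_eq; rewrite /GRing.scale /=; field.
    by rewrite /h; apply: is_derive_eq; rewrite /GRing.scale /=; ring.
  have := is_derive_0_is_cst 1 0 Dh; rewrite /h expr1n mul1r expr0n /= mul0r expR0 mul1r => <-.
  by rewrite mulrA -expRD addNr expR0 mul1r.
apply: complexP.
  rewrite cReM /= mul0r subr0; apply: (comp (fun t => complex.Re (F t))) => t.
  have [K HK] := HF t; apply: (@is_derive_quadratic _ _ _ K) => e e1.
  apply: le_trans (HK e e1); apply: le_trans (Re_le_normc _).
  rewrite !cReD cReN cReM /= mul0r subr0.
  by rewrite le_eqVlt; apply/orP; left; apply/eqP; congr (`|_|); field.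
rewrite cImM /= mul0r addr0; apply: (comp (fun t => complex.Im (F t))) => t.
have [K HK] := HF t; apply: (@is_derive_quadratic _ _ _ K) => e e1.
apply: le_trans (HK e e1); apply: le_trans (Im_le_normc _).
rewrite !cImD cImN cImM /= mul0r addr0.
by rewrite le_eqVlt; apply/orP; left; apply/eqP; congr (`|_|); field.
Qed.

Variable n : nat.
Notation leb := (lebesgue_rV (R := R) n).
Implicit Types (P : 'M[R]_n) (v m eta : 'rV[R]_n).

(** By 0 <= (mu |eta| - 2c)^2/(2 mu), the linear exponent is absorbed by half of the quadratic
    one. *)
Lemma gauss_qform_exp_le P v : posdef P -> exists2 C : R, 0 < C & exists2 k : R, 0 < k &
  forall eta, expR (- qform P eta) * expR (2 * `|dot v eta|) <= C * expR (- (k * dot eta eta)).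
Proof.
move=> [_ [mu mu0 Pm]]; set c := n%:R * `|v|.
exists (expR (2 * c ^+ 2 / mu)); first exact: expR_gt0.
exists (mu / 2); first by rewrite divr_gt0.
move=> eta; rewrite -!expRD ler_expR.
have h1 := Pm eta; have h2 := sqr_norm_le_dot eta.
have h3 : `|dot v eta| <= c * `|eta| by exact: norm_dot_le.
have h4 : mu / 2 * `|eta| ^+ 2 <= mu / 2 * dot eta eta.
  by rewrite ler_wpM2l// divr_ge0// ltW.
have h5 : 2 * (c * `|eta|) <= 2 * c ^+ 2 / mu + mu / 2 * `|eta| ^+ 2.
  have : 0 <= (mu * `|eta| - 2 * c) ^+ 2 / (2 * mu).
    by rewrite divr_ge0 ?sqr_ge0// mulr_ge0// ltW.
  rewrite (_ : _ / (2 * mu) = 2 * c ^+ 2 / mu + mu / 2 * `|eta| ^+ 2 - 2 * (c * `|eta|)); last first.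
    by field; rewrite gt_eqF.
  by rewrite subr_ge0.
move: h1 h3 h4 h5; move: (qform P eta) (`|dot v eta|) (c * `|eta|) (2 * c ^+ 2 / mu).
move: (mu / 2 * `|eta| ^+ 2) => x1 x2 x3 x4 x5.
rewrite (_ : mu / 2 * dot eta eta = (mu * dot eta eta) / 2); last by ring.
by lra.
Qed.

Lemma measurable_expR_qform P : measurable_fun setT (fun eta => expR (- qform P eta)).
Proof.
by apply: measurable_expR_fun; apply: measurable_funN; apply: measurable_qform; exact: measurable_id.
Qed.

Lemma cmeasurable_gauss P v t : cmeasurable (fun eta => cexp (- qform P eta) (t * dot v eta)).
Proof.
apply: cmeasurable_cexp.
  by apply: measurable_funN; apply: measurable_qform; exact: measurable_id.
apply: measurable_funM; first exact: measurable_cst.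
by apply: measurable_dot; [exact: measurable_cst|exact: measurable_id].
Qed.

Lemma integrable_scale (C : R) (f : 'rV[R]_n -> R) : leb.-integrable setT (EFin \o f) ->
  leb.-integrable setT (EFin \o (fun eta => C * f eta)).
Proof.
move=> fi; have := integrableZl measurableT C fi.
by apply: eq_integrable => // x _; rewrite /= EFinM.
Qed.

Lemma integrable_gauss_qform P : posdef P ->
  leb.-integrable setT (EFin \o (fun eta => expR (- qform P eta))).
Proof.
move=> pP; have [C C0 [k k0 H]] := gauss_qform_exp_le 0 pP.
have gi := integrable_scale C (integrable_gauss n k0).
apply: (le_integrable measurableT _ _ gi).
  by apply/measurable_EFinP; exact: measurable_expR_qform.
move=> eta _; rewrite /= lee_fin ger0_norm ?expR_ge0//.
rewrite ger0_norm; last by rewrite mulr_ge0 ?expR_ge0// ltW.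
by apply: le_trans (H eta); rewrite dot0l normr0 mulr0 expR0 mulr1.
Qed.

(** A dominating function for the second order remainder in [gauss_fourier], from x^2 <= 2
    exp|x|. *)
Lemma integrable_gauss_dom P v : posdef P -> exists2 h : 'rV[R]_n -> R,
  leb.-integrable setT (EFin \o h) &
  forall eta, expR (- qform P eta) * ((dot v eta) ^+ 2 * expR `|dot v eta|) <= h eta.
Proof.
move=> pP; have [C C0 [k k0 H]] := gauss_qform_exp_le v pP.
exists (fun eta => 2 * (C * expR (- (k * dot eta eta)))).
  by apply: integrable_scale; apply: integrable_scale; exact: integrable_gauss.
move=> eta; apply: le_trans (_ : 2 * (expR (- qform P eta) * expR (2 * `|dot v eta|)) <= _); last first.
  by rewrite ler_wpM2l//; exact: H.
rewrite [leRHS]mulrCA ler_wpM2l ?expR_ge0//.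
rewrite (_ : 2 * `|dot v eta| = `|dot v eta| + `|dot v eta|); last by ring.
rewrite expRD [leRHS]mulrA ler_wpM2r ?expR_ge0//.
rewrite -[dot v eta ^+ 2]real_normK ?num_real//.
by have := exprn_le_fact_expR 2 (normr_ge0 (dot v eta)).
Qed.

Lemma qform_shift P v m eta a : P^T = P -> m *m P = v ->
  qform P (eta + a *: m) = qform P eta + 2 * a * dot v eta + a ^+ 2 * dot v m.
Proof.
move=> Ps mP; rewrite qformD// qformZ dotZr [dot (eta *m P) m]dot_mulmx Ps mP.
by rewrite [dot eta v]dotC {2}/qform mP; ring.
Qed.

Definition gauss_mass P : R := \int[leb]_eta expR (- qform P eta).

(* The integral [j t] of [exp (- qform P eta + i t v.eta)] solves [j' = - (t s / 2) j] with
   [s = v.m]: translating [eta] by [(e / 2) m] multiplies the integrand by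
   [exp (- e v.eta)] and a constant, and [exp (i e v.eta)] agrees with
   [1 + i (1 - exp (- e v.eta))] up to [O(e ^ 2)]. *)
Lemma gauss_fourier P v m : posdef P -> m *m P = v ->
  complex_integral leb (fun eta => cexp (- qform P eta) (dot v eta)) =
  (gauss_mass P * expR (- (dot v m / 4)))%:C.
Proof.
move=> pP mP; have [Ps _] := pP.
pose f t eta := cexp (- qform P eta) (t * dot v eta).
pose j t := complex_integral leb (f t).
set s := dot v m.
have fi t : cintegrable leb (f t).
  apply: (cintegrable_le _ (integrable_gauss_qform pP)); first exact: cmeasurable_gauss.
  by move=> eta; rewrite normc_cexp.
have -> : complex_integral leb (fun eta => cexp (- qform P eta) (dot v eta)) = j 1.
  by rewrite /j /f; congr complex_integral; apply/funext => eta; rewrite mul1r.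
have j0 : j 0 = (gauss_mass P)%:C.
  rewrite /j /f -complex_integral_real; congr complex_integral; apply/funext => eta.
  by rewrite mul0r cexpE cos0 sin0 mulr1 mulr0.
rewrite [RHS](_ : _ = (expR (- (s / 4)))%:C * j 0); last first.
  by rewrite j0 -rmorphM mulrC.
apply: gaussian_ode => t.
have [h hi hb] := integrable_gauss_dom v pP.
pose Kh := \int[leb]_eta h eta.
pose K1 : R := expR 1 + 7.
have K10 : 0 <= K1 by rewrite addr_ge0 ?expR_ge0.
(* [Kt] e^2 bounds exp(e^2 s/4 - i t e s/2) - 1 + i t e s/2 for |e| <= 1: the first term is for the
   oscillating factor, the others for the real one. *)
pose Kt : R := 4 * (t * s / 2) ^+ 2 + (`|s / 4| + (expR 1 + 3) * ((s / 4) ^+ 2 * expR `|s / 4|)).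
exists (Kt * normc (j t) + 2 * (K1 * Kh)) => e e1.
pose g eta := cexp (- qform P eta - e * dot v eta) (t * dot v eta).
have e21 : e ^+ 2 <= 1 by rewrite -[e ^+ 2]real_normK ?num_real// exprn_ile1.
have gE eta : g eta = cexp (- (e * dot v eta)) 0 * f t eta.
  by rewrite /g /f -cexpD; congr cexp; ring.
have mg : cmeasurable g.
  apply: cmeasurable_cexp.
    apply: measurable_funB.
      by apply: measurable_funN; apply: measurable_qform; exact: measurable_id.
    apply: measurable_funM; first exact: measurable_cst.
    by apply: measurable_dot; [exact: measurable_cst|exact: measurable_id].
  apply: measurable_funM; first exact: measurable_cst.
  by apply: measurable_dot; [exact: measurable_cst|exact: measurable_id].
have gi : cintegrable leb g.
  have [C C0 [k k0 H]] := gauss_qform_exp_le v pP.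
  apply: (cintegrable_le mg (integrable_scale C (integrable_gauss n k0))) => eta.
  apply: le_trans (H eta); rewrite normc_cexp -expRD ler_expR lerD2l.
  apply: le_trans (ler_norm _) _; rewrite normrN normrM.
  apply: (@le_trans _ _ (1 * `|dot v eta|)); first by rewrite ler_wpM2r.
  by rewrite ler_wpM2r// ler1n.
have gI : complex_integral leb g = cexp (e ^+ 2 * s / 4) (- (t * e * s / 2)) * j t.
  have := complex_integral_translate ((e / 2) *: m) (fi t).1; rewrite -/(j t) => <-.
  rewrite -complex_integralZ; last by apply: (cintegrable_translate _ (fi t)).
  congr complex_integral; apply/funext => eta.
  rewrite /f (qform_shift _ _ Ps mP) dotDr dotZr -/s -cexpD /g.
  by congr cexp; field.
pose w eta := (cexp 0 (e * dot v eta) - 1 - (0 +i* (e * dot v eta))) +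
  (0 +i* 1) * (cexp (- (e * dot v eta)) 0 - 1 - ((- (e * dot v eta)) +i* 0)).
have wle eta : normc (w eta) <= e ^+ 2 * (K1 * (dot v eta ^+ 2 * expR `|dot v eta|)).
  set x := dot v eta.
  have hx : expR `|e * x| <= expR `|x|.
    by rewrite ler_expR normrM ler_piMl.
  have x1 : 1 <= expR `|x| by rewrite -expR0 ler_expR.
  apply: le_trans (le_normcD _ _) _; rewrite normcM.
  have -> : normc (0 +i* 1 : R[i]) = 1 by rewrite /= expr0n /= add0r expr1n sqrtr1.
  rewrite mul1r.
  have h1 := cis_taylor1_le (e * x).
  have h2 : normc (cexp (- (e * x)) 0 - 1 - (- (e * x) +i* 0)) <=
      (expR 1 + 3) * ((e * x) ^+ 2 * expR `|x|).
    rewrite cexpE cos0 sin0 mulr0 mulr1.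
    have -> : (expR (- (e * x)) +i* 0) - 1 - (- (e * x) +i* 0) =
        (expR (- (e * x)) - 1 - - (e * x))%:C :> R[i].
      by apply: complexP => /=; rewrite ?subr0.
    rewrite normc_real; apply: le_trans (expR_taylor1_le _) _.
    by rewrite normrN sqrrN ler_wpM2l ?addr_ge0 ?expR_ge0// ler_wpM2l ?sqr_ge0.
  have h3 : 4 * (e * x) ^+ 2 <= 4 * ((e * x) ^+ 2 * expR `|x|).
    by rewrite ler_wpM2l// ler_peMr// sqr_ge0.
  apply: le_trans (lerD (le_trans h1 h3) h2) _.
  by rewrite le_eqVlt; apply/orP; left; apply/eqP; rewrite /K1; ring.
have mw : cmeasurable (fun eta => f t eta * w eta).
  have mev : measurable_fun setT (fun eta : 'rV[R]_n => e * dot v eta).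
    apply: measurable_funM; first exact: measurable_cst.
    by apply: measurable_dot; [exact: measurable_cst|exact: measurable_id].
  apply: cmeasurableM; first exact: (fi t).1.
  have mc (a b : 'rV[R]_n -> R) (l : 'rV[R]_n -> R[i]) : measurable_fun setT a ->
      measurable_fun setT b -> cmeasurable l -> cmeasurable (fun eta => cexp (a eta) (b eta) - 1 - l eta).
    move=> ma mb ml.
    have E : (fun eta => cexp (a eta) (b eta) - 1 - l eta) =
        (fun eta => (cexp (a eta) (b eta) + - 1) + - 1 * l eta).
      by apply/funext => eta; rewrite mulN1r.
    rewrite E; apply: cmeasurableD; first apply: cmeasurableD.
    - exact: cmeasurable_cexp.
    - exact: cmeasurable_cst.
    - by apply: cmeasurableM => //; exact: cmeasurable_cst.
  apply: cmeasurableD.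
    apply: mc; [exact: measurable_cst|exact: mev|].
    by split; [exact: measurable_cst|exact: mev].
  apply: cmeasurableM; first exact: cmeasurable_cst.
  apply: mc; [exact: measurable_funN|exact: measurable_cst|].
  by split; [exact: measurable_funN|exact: measurable_cst].
have wi : cintegrable leb (fun eta => f t eta * w eta).
  apply: (cintegrable_le mw (integrable_scale (e ^+ 2 * K1) hi)) => eta.
  rewrite normcM normc_cexp; apply: le_trans (ler_wpM2l (expR_ge0 _) (wle eta)) _.
  by rewrite mulrCA -(mulrA (e ^+ 2)) ler_wpM2l ?sqr_ge0// mulrCA ler_wpM2l.
have wI : normc (complex_integral leb (fun eta => f t eta * w eta)) <= 2 * (K1 * Kh) * e ^+ 2.
  apply: le_trans (normc_complex_integral_le wi (integrable_scale (e ^+ 2 * K1) hi) _) _.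
    move=> eta; rewrite normcM normc_cexp; apply: le_trans (ler_wpM2l (expR_ge0 _) (wle eta)) _.
    by rewrite mulrCA -(mulrA (e ^+ 2)) ler_wpM2l ?sqr_ge0// mulrCA ler_wpM2l.
  rewrite RintegralZl// -/Kh.
  by rewrite le_eqVlt; apply/orP; left; apply/eqP; ring.
pose I : R[i] := 0 +i* 1.
have II : I * I = - 1 by rewrite /I; apply: complexP => /=; ring.
have jE : j (t + e) = j t - I * (complex_integral leb g - j t) +
    complex_integral leb (fun eta => f t eta * w eta).
  have -> : j (t + e) = complex_integral leb (fun eta =>
      ((1 + I) * f t eta + (- I) * g eta) + f t eta * w eta).
    congr complex_integral; apply/funext => eta.
    have -> : f (t + e) eta = cexp 0 (e * dot v eta) * f t eta.
      by rewrite /f -cexpD; congr cexp; ring.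
    rewrite gE /w -/I.
    have -> : 0 +i* (e * dot v eta) = I * (e * dot v eta)%:C.
      by rewrite /I; apply: complexP => /=; ring.
    have -> : (- (e * dot v eta)) +i* 0 = - (e * dot v eta)%:C by apply: complexP => /=; rewrite ?oppr0.
    by ring.
  have i1 := cintegrableZ (1 + I) (fi t).
  have i2 := cintegrableZ (- I) gi.
  rewrite (complex_integralD (cintegrableD i1 i2) wi) (complex_integralD i1 i2).
  rewrite (complex_integralZ _ (fi t)) (complex_integralZ _ gi) -/(j t).
  by ring.
set W := complex_integral leb (fun eta => f t eta * w eta) in wI jE.
have -> : j (t + e) - j t + (t * e * s / 2)%:C * j t =
    - I * (cexp (e ^+ 2 * s / 4) (- (t * e * s / 2)) - 1 - I * (- (t * e * s / 2))%:C) * j t + W.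
  rewrite jE gI.
  have -> : (- (t * e * s / 2))%:C = - (t * e * s / 2)%:C :> R[i] by rewrite rmorphN.
  set c := cexp _ _; set y := (t * e * s / 2)%:C.
  have -> : - I * (c - 1 - I * - y) * j t = - I * (c - 1) * j t - (I * I) * y * j t by ring.
  by rewrite II; ring.
apply: le_trans (le_normcD _ _) _; rewrite [leRHS]mulrDl; apply: lerD => //.
rewrite normcM normcM normcN.
have -> : normc I = 1 by rewrite /I /= expr0n /= add0r expr1n sqrtr1.
rewrite mul1r [leRHS]mulrAC; apply: ler_wpM2r; first exact: normc_ge0.
set a := e ^+ 2 * s / 4; set b := - (t * e * s / 2).
have -> : cexp a b - 1 - I * b%:C = (cexp 0 b - 1 - (0 +i* b)) + (expR a - 1)%:C * cexp 0 b.
  have -> : cexp a b = (expR a)%:C * cexp 0 b.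
    by rewrite !cexpE expR0 !mul1r; apply: complexP => /=; ring.
  have -> : I * b%:C = 0 +i* b by rewrite /I; apply: complexP => /=; ring.
  by rewrite rmorphB rmorph1; ring.
apply: le_trans (le_normcD _ _) _; rewrite normcM normc_cexp expR0 mulr1 normc_real.
rewrite [leRHS]mulrDl; apply: lerD.
  apply: le_trans (cis_taylor1_le b) _.
  by rewrite /b le_eqVlt; apply/orP; left; apply/eqP; field.
have aE : `|a| = e ^+ 2 * `|s / 4|.
  by rewrite /a -mulrA normrM ger0_norm// sqr_ge0.
have -> : expR a - 1 = (expR a - 1 - a) + a by ring.
apply: le_trans (ler_normD _ _) _; rewrite addrC mulrDl; apply: lerD.
  by rewrite aE mulrC.
apply: le_trans (expR_taylor1_le a) _.
rewrite -(mulrA (expR 1 + 3)) ler_wpM2l ?addr_ge0 ?expR_ge0//.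
rewrite [leRHS]mulrAC; apply: ler_pM; rewrite ?sqr_ge0 ?expR_ge0//.
  rewrite /a -mulrA exprMn mulrC ler_wpM2l ?sqr_ge0//.
  by rewrite expr2 ler_piMl// sqr_ge0.
by rewrite ler_expR aE ler_piMl.
Qed.

End gaussian_fourier.

(** * Weyl quantization of Gaussian symbols *)

Section square_integrable.
Context {R : realType} (d : nat).
Notation leb := (lebesgue_rV (R := R) d).
Implicit Types (f g : 'rV[R]_d -> R[i]) (A B P Pi S : 'M[R]_d) (x xi y : 'rV[R]_d).

(** The integrand is at least exp(-K) on the unit cube, which has measure one. *)
Lemma gauss_mass_gt0 P : posdef P -> 0 < gauss_mass P.
Proof.
move=> pP; pose K : R := d%:R * 1 * (d%:R * 1 * `|P|).
pose A (i : 'I_d) : set (measurableTypeR R) := `[0, 1]%classic.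
have mA i : measurable (A i) by exact: measurable_itv.
pose box := [set x : 'rV[R]_d | forall i, A i (x ord0 i)].
have mbox : measurable box by exact: measurable_box.
have lbox : leb box = 1%E.
  by rewrite lebesgue_rV_box// big1// => i _; rewrite /A lebesgue_measure_itv /= lte_fin ltr01 sube0.
have bP y : box y -> expR (- K) <= expR (- qform P y).
  move=> by_; have y1 : `|y| <= 1.
    apply: norm_le_coord => // i; have := by_ i; rewrite /A /= in_itv /= => /andP[u1 u2].
    by rewrite ger0_norm.
  rewrite ler_expR lerN2; apply: le_trans (ler_norm _) _.
  apply: le_trans (norm_dot_le _ _) _.
  rewrite mulrAC; apply: ler_pM; rewrite ?mulr_ge0//.
    by rewrite ler_wpM2l.
  apply: le_trans (norm_mulmx_le _ _) _.
  by rewrite ler_wpM2r// ler_wpM2l.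
have /integrableP[mq qoo] := integrable_gauss_qform pP.
have I0 : ((expR (- K))%:E <= \int[leb]_y (expR (- qform P y))%:E)%E.
  have -> : ((expR (- K))%:E = \int[leb]_(y in box) (expR (- K))%:E)%E.
    by rewrite integral_cst// [X in (_ * X)%E](_ : _ = 1%E) ?mule1.
  apply: (@le_trans _ _ (\int[leb]_(y in box) (expR (- qform P y))%:E)%E).
    apply: ge0_le_integral => //.
    exact: measurable_funTS mq.
  exact: ge0_subset_integral.
rewrite /gauss_mass /Rintegral -lte_fin fineK.
  by apply: lt_le_trans I0; rewrite lte_fin expR_gt0.
by apply: integrable_fin_num => //; exact: integrable_gauss_qform.
Qed.

Lemma L2_cmeasurable f : L2 f -> cmeasurable f.
Proof. by move=> [? ? _]. Qed.

Lemma L2_sqr_integrable f : L2 f -> leb.-integrable setT (EFin \o (fun x => normc (f x) ^+ 2)).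
Proof.
move=> fL; have [_ _ foo] := fL; apply/integrableP; split.
  by apply/measurable_EFinP; apply: measurable_funX; apply: measurable_normc; exact: L2_cmeasurable.
under eq_integral do rewrite /= ger0_norm ?sqr_ge0//.
exact: foo.
Qed.

Lemma cintegrable_L2M f g : L2 f -> L2 g -> cintegrable leb (fun x => f x * conjc (g x)).
Proof.
move=> fL gL.
apply: (@cintegrable_le _ _ _ _ _ (fun x => normc (f x) ^+ 2 + normc (g x) ^+ 2)).
- by apply: cmeasurableM; [exact: L2_cmeasurable|apply: cmeasurable_conjc; exact: L2_cmeasurable].
- have := integrableD measurableT (L2_sqr_integrable fL) (L2_sqr_integrable gL).
  by apply: eq_integrable => // x _; rewrite /= EFinD.
move=> x; rewrite normcM normc_conjc.
have := sqr_ge0 (normc (f x) - normc (g x)).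
have := mulr_ge0 (normc_ge0 (f x)) (normc_ge0 (g x)).
rewrite sqrrB; move: (normc (f x)) (normc (g x)) => a b; rewrite -mulr_natl; nra.
Qed.

Lemma measurable_packet A B x xi : cmeasurable (packet A B x xi).
Proof.
have mY : measurable_fun setT (fun y : 'rV[R]_d => y - x).
  by apply: measurable_vecB; [exact: measurable_id|exact: measurable_cst].
apply: cmeasurable_cexp.
  apply: measurable_funN; apply: measurable_funM; first exact: measurable_cst.
  exact: measurable_qform.
apply: measurable_funN; apply: measurable_funD.
  by apply: measurable_dot; [exact: measurable_cst|exact: measurable_id].
by apply: measurable_funM; [exact: measurable_cst|exact: measurable_qform].
Qed.

Lemma sqr_normc_packet A B x xi y :
  normc (packet A B x xi y) ^+ 2 = expR (- qform A (y - x)).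
Proof.
rewrite normc_packet -expRM_natl; congr expR; rewrite mulrN; congr (- _).
by rewrite mulrA divff// mul1r.
Qed.

Lemma Rintegral_sqr_packet A B x xi : 
  \int[leb]_y (normc (packet A B x xi y) ^+ 2) = gauss_mass A.
Proof.
under eq_Rintegral do rewrite sqr_normc_packet.
exact: (Rintegral_translate (- x) (measurable_expR_qform A)).
Qed.

Lemma packet_L2 A B x xi : posdef A -> L2 (packet A B x xi).
Proof.
move=> pA; have [mr mi] := measurable_packet A B x xi; split=> //.
under eq_integral do rewrite sqr_normc_packet.
rewrite (ge0_integral_translate (- x) (f := fun y => (expR (- qform A y))%:E)).
- have /integrableP[_] := integrable_gauss_qform pA.
  by under eq_integral do rewrite /= ger0_norm ?expR_ge0//.
- by apply/measurable_EFinP; exact: measurable_expR_qform.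
- by move=> y; rewrite lee_fin expR_ge0.
Qed.

Lemma posdefZ A (c : R) : 0 < c -> posdef A -> posdef (c *: A).
Proof.
move=> c0 [As [m m0 Am]]; split; first by rewrite linearZ /= As.
exists (c * m); first exact: mulr_gt0.
by move=> y; rewrite qformZm -mulrA ler_wpM2l// ltW.
Qed.

End square_integrable.

Section weyl_gaussian.
Context {R : realType} (d : nat).
Notation leb := (lebesgue_rV (R := R) d).
Variables (P Pi S : 'M[R]_d) (x0 xi0 : 'rV[R]_d).
Hypotheses (pP : posdef P) (pPi : posdef Pi) (Ss : S^T = S) (PiP : Pi *m P = 1%:M).
Implicit Types (f : 'rV[R]_d -> R[i]) (x y xi : 'rV[R]_d).

(** The common shape of both symbols: P = Pi = 1 and S = 0 give exp(-|z - w|^2), and composition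
    with chi gives the general case by [symplectic_gram]. *)
Definition gauss_symbol (z : 'rV[R]_(d + d)) : R[i] :=
  (expR (- (qform Pi (lsubmx z - x0) +
    qform P (rsubmx z - xi0 + (lsubmx z - x0) *m S))))%:C.

Local Notation Phi := (packet Pi S x0 (- xi0)).
Let mid x y : 'rV[R]_d := 2^-1 *: (x + y) - x0.
Let off x y : 'rV[R]_d := mid x y *m S - xi0.
Let gauss eta v := cexp (- qform P eta) (dot v eta).

(** The shift by [off] centres the symbol in the frequency variable, so that integrating over it
    yields the Fourier transform of a centred Gaussian. *)
Let kernelE x y xi : cis (dot (x - y) xi) * gauss_symbol (row_mx (2^-1 *: (x + y)) xi) =
  cexp (- qform Pi (mid x y)) (- dot (x - y) (off x y)) * gauss (xi + off x y) (x - y).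
Proof.
rewrite /gauss_symbol row_mxKl row_mxKr /gauss -cexpD -/(mid x y).
rewrite -[LHS]/(cexp (- (qform Pi (mid x y) + qform P (xi - xi0 + mid x y *m S))) (dot (x - y) xi)).
congr cexp; last by rewrite [dot _ (xi + _)]dotDr addrCA addNr addr0.
by rewrite opprD; congr (_ + - qform P _); rewrite /off -addrA [mid x y *m S - _]addrC.
Qed.

(** Parallelogram identity: Pi at the midpoint plus a quarter of Pi at the difference is half the
    sum of Pi at [x] and at [y]. That quarter is the exponent in the Fourier transform of exp(-P),
    because Pi = P^-1; this match separates the variables and makes the operator rank one. The phase
    separates as the difference of the forms S at [x] and at [y]. *)
Let kernel_rank1 x y :
  (cexp (- qform Pi (mid x y)) (- dot (x - y) (off x y))) *
    (expR (- (dot (x - y) ((x - y) *m Pi) / 4)))%:C = Phi x * conjc (Phi y).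
Proof.
have [Pis _] := pPi.
rewrite /packet conjc_cexp -cexpD -cexp_real -cexpD addr0.
set u := x - x0; set w := y - x0.
have vE : x - y = u - w by rewrite /u /w opprB addrA subrK.
have mE : mid x y = 2^-1 *: (u + w).
  by rewrite /mid /u /w; apply/rowP => i; rewrite !mxE; field.
have e1 : qform Pi (mid x y) + dot (x - y) ((x - y) *m Pi) / 4 =
    2^-1 * qform Pi u + 2^-1 * qform Pi w.
  rewrite dotC -/(qform Pi (x - y)) mE vE; clearbody u w.
  by rewrite qformZ !qformD// -(scaleN1r w) qformZ dotZr; field.
have e2 : dot (x - y) (mid x y *m S) = 2^-1 * (qform S u - qform S w).
  rewrite mE vE -scalemxAl dotZr mulmxDl /qform; clearbody u w; rewrite !dotE.
  have -> : dot u (w *m S) = dot w (u *m S) by rewrite dotC dot_mulmx Ss.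
  rewrite !(dotC u (u *m S)) !(dotC w (w *m S)); ring.
congr cexp; first by rewrite -opprD e1 opprD.
rewrite /off dotDr dotNr e2 dotDl !dotNl !(dotC xi0); ring.
Qed.

Let cmeasurable_kernel x f : cmeasurable f ->
  cmeasurable (fun p : 'rV[R]_d * 'rV[R]_d =>
    cexp (- qform Pi (mid x p.1)) (- dot (x - p.1) (off x p.1)) *
    gauss (p.2 + off x p.1) (x - p.1) * f p.1).
Proof.
move=> mf.
have m1 : measurable_fun setT (fun p : 'rV[R]_d * 'rV[R]_d => p.1) by exact: measurable_fst.
have m2 : measurable_fun setT (fun p : 'rV[R]_d * 'rV[R]_d => p.2) by exact: measurable_snd.
have mm : measurable_fun setT (fun p : 'rV[R]_d * 'rV[R]_d => mid x p.1).
  apply: measurable_vecB; last exact: measurable_cst.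
  by apply: measurable_vecZ; apply: measurable_vecD => //; exact: measurable_cst.
have mo : measurable_fun setT (fun p : 'rV[R]_d * 'rV[R]_d => off x p.1).
  by apply: measurable_vecB; [exact: measurable_vec_mulmx|exact: measurable_cst].
have mv : measurable_fun setT (fun p : 'rV[R]_d * 'rV[R]_d => x - p.1).
  by apply: measurable_vecB => //; exact: measurable_cst.
have m2o := measurable_vecD m2 mo.
apply: cmeasurableM; last first.
  have [fr fi] := mf; split.
    by apply: (@measurableT_comp _ _ _ _ _ _ (fun y => complex.Re (f y))).
  by apply: (@measurableT_comp _ _ _ _ _ _ (fun y => complex.Im (f y))).
apply: cmeasurableM; apply: cmeasurable_cexp.
- by apply: measurable_funN; exact: measurable_qform.
- by apply: measurable_funN; exact: measurable_dot.
- by apply: measurable_funN; exact: measurable_qform.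
- exact: measurable_dot.
Qed.

Lemma cintegrable_gauss v : cintegrable leb (gauss^~ v).
Proof.
apply: (cintegrable_le _ (integrable_gauss_qform pP)).
  have := cmeasurable_gauss P v 1; rewrite /gauss.
  by rewrite (_ : (fun eta => cexp _ (1 * _)) = (fun eta => cexp (- qform P eta) (dot v eta)))//;
    apply/funext => eta; rewrite mul1r.
by move=> eta; rewrite normc_cexp.
Qed.

Lemma weyl_gauss f x : L2 f -> weyl gauss_symbol f x =
  ((2 * pi) ^- d * gauss_mass P)%:C * (Phi x * L2_inner f Phi).
Proof.
move=> fL; have mf := L2_cmeasurable fL.
rewrite /weyl rmorphM -mulrA; congr (_ * _).
pose k y := cexp (- qform Pi (mid x y)) (- dot (x - y) (off x y)).
pose F (p : 'rV[R]_d * 'rV[R]_d) := k p.1 * gauss (p.2 + off x p.1) (x - p.1) * f p.1.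
have -> : (fun p : 'rV[R]_d * 'rV[R]_d => let: (y, xi) := p in
    cis (dot (x - y) xi) * gauss_symbol (row_mx (2^-1 *: (x + y)) xi) * f y) = F.
  by apply/funext => -[y xi]; rewrite kernelE.
have gi y := cintegrable_translate (off x y) (cintegrable_gauss (x - y)).
(* For absolute integrability: in modulus the kernel is, as a function of y, a real Gaussian centred
   at 2 x0 - x, the reflection of x in x0; it is in L^2, hence integrable against [f]. *)
have nF y xi : normc (F (y, xi)) =
    normc (f y * conjc (packet (2^-1 *: Pi) 0 (2 *: x0 - x) 0 y)) * expR (- qform P (xi + off x y)).
  rewrite /F /k /gauss [LHS]normcM [normc (cexp _ _ * cexp _ _)]normcM.
  rewrite [normc (f y * _)]normcM !normc_cexp normc_conjc normc_packet.
  rewrite [LHS]mulrC [LHS]mulrA; congr (_ * expR (- _) * _).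
  have -> : mid x y = 2^-1 *: (y - (2 *: x0 - x)).
    by rewrite /mid; apply/rowP => i; rewrite !mxE; field.
  by rewrite qformZ qformZm mulrA -expr2.
have mP : measurable_fun setT (fun eta : 'rV[R]_d => (expR (- qform P eta))%:E).
  by apply/measurable_EFinP; exact: measurable_expR_qform.
have massE : (\int[leb]_eta (expR (- qform P eta))%:E = (gauss_mass P)%:E)%E.
  by rewrite /gauss_mass /Rintegral fineK//; apply: integrable_fin_num => //; exact: integrable_gauss_qform.
have FE y xi : F (y, xi) = (k y * f y) * gauss (xi + off x y) (x - y).
  by rewrite /F /= mulrAC.
rewrite complex_integral_prod; first last.
- have p2 : posdef (2^-1 *: Pi) by apply: posdefZ => //; rewrite invr_gt0.
  have fpi := cintegrable_L2M fL (packet_L2 0 (2 *: x0 - x) 0 p2).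
  have [_ foo] := fpi.
  rewrite (_ : (fun y => \int[leb]_xi (normc (F (y, xi)))%:E)%E = (fun y => (gauss_mass P)%:E *
      (normc (f y * conjc (packet (2^-1 *: Pi) 0 (2 *: x0 - x) 0 y)))%:E)%E).
    rewrite ge0_integralZl; [|exact: measurableT
      |by apply/measurable_EFinP; apply: measurable_normc; case: fpi
      |by move=> y _; rewrite lee_fin normc_ge0|by rewrite lee_fin ltW// gauss_mass_gt0].
    by rewrite lte_mul_pinfty// lee_fin ltW// gauss_mass_gt0.
  apply/funext => y.
  under eq_integral => xi _ do rewrite nF EFinM.
  rewrite ge0_integralZl; [|exact: measurableT
    |exact: (@measurableT_comp _ _ _ _ _ _ _ _ _ mP (measurable_translate (off x y)))
    |by move=> eta _; rewrite lee_fin expR_ge0|by rewrite lee_fin normc_ge0].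
  rewrite (ge0_integral_translate (off x y) mP); last by move=> eta; rewrite lee_fin expR_ge0.
  by rewrite massE muleC.
- move=> y; have := cintegrableZ (k y * f y) (gi y).
  by congr cintegrable; apply/funext => xi; rewrite FE.
- exact: cmeasurable_kernel.
have -> : (fun y => complex_integral leb (fun xi => F (y, xi))) =
    (fun y => ((gauss_mass P)%:C * Phi x) * (f y * conjc (Phi y))).
  apply/funext => y.
  under eq_fun do rewrite FE.
  rewrite complex_integralZ; last exact: gi.
  have [mg _] := cintegrable_gauss (x - y).
  rewrite (complex_integral_translate (off x y) mg).
  rewrite (gauss_fourier pP (m := (x - y) *m Pi)); last by rewrite -mulmxA PiP mulmx1.
  rewrite rmorphM; transitivity ((gauss_mass P)%:C * f y *
    (k y * (expR (- (dot (x - y) ((x - y) *m Pi) / 4)))%:C)); first by ring.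
  by rewrite /k (kernel_rank1 x y); ring.
by rewrite complex_integralZ ?mulrA//; exact: cintegrable_L2M fL (packet_L2 _ _ _ pPi).
Qed.

End weyl_gaussian.

(** * The Gram matrix of a symplectic map *)

Section symplectic_gram.
Context {R : realType}.

Lemma dot_mulmx_le n k (A : 'M[R]_(n, k)) : exists2 K : R, 0 < K &
  forall x : 'rV[R]_n, dot (x *m A) (x *m A) <= K * dot x x.
Proof.
pose s : R := \sum_i \sum_j `|A i j|.
have s0 : 0 <= s by apply: sumr_ge0 => i _; exact: sumr_ge0.
have cA i j : `|A i j| <= s.
  rewrite /s (bigD1 i)//= (bigD1 j)//= -addrA lerDl addr_ge0 ?sumr_ge0//.
  by move=> ? _; exact: sumr_ge0.
have E (x : 'rV[R]_n) : `|x *m A| <= n%:R * s * `|x|.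
  apply: norm_le_coord => [|j]; first by rewrite !mulr_ge0.
  rewrite mxE; apply: le_trans (ler_norm_sum _ _ _) _.
  apply: (@le_trans _ _ (\sum_(i < n) s * `|x|)).
    by apply: ler_sum => i _; rewrite normrM mulrC ler_pM ?coord_le_norm.
  by rewrite sumr_const card_ord -[leLHS]mulr_natl mulrA.
exists (k%:R * (n%:R * s) ^+ 2 + 1); first by rewrite ltr_wpDl// mulr_ge0 ?sqr_ge0.
move=> x; apply: le_trans (ler_norm _) _; apply: le_trans (norm_dot_le _ _) _.
apply: (@le_trans _ _ (k%:R * (n%:R * s) ^+ 2 * dot x x)); last first.
  by rewrite mulrDl mul1r lerDl dotxx_ge0.
rewrite -[leLHS]mulrA -expr2 -[leRHS]mulrA; apply: ler_wpM2l => //.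
apply: (@le_trans _ _ ((n%:R * s) ^+ 2 * `|x| ^+ 2)).
  by rewrite -exprMn lerXn2r ?nnegrE ?mulr_ge0.
by apply: ler_wpM2l; [exact: sqr_ge0|exact: sqr_norm_le_dot].
Qed.

Lemma posdef_gram n (X Y : 'M[R]_n) : X *m Y = 1%:M -> posdef (X *m X^T).
Proof.
move=> XY; split; first by rewrite trmx_mul trmxK.
have [K K0 HK] := dot_mulmx_le Y; exists K^-1; first by rewrite invr_gt0.
move=> z; rewrite ler_pdivrMl//; have := HK (z *m X).
by rewrite -mulmxA XY mulmx1 /qform mulmxA [dot (_ *m X^T) _]dot_mulmx trmxK.
Qed.

Lemma posdef_invl n (p Pi : 'M[R]_n) : posdef p -> Pi *m p = 1%:M -> posdef Pi.
Proof.
move=> [ps [m m0 pm]] Pip; have pPi := mulmx1C Pip.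
have Pis : Pi^T = Pi.
  have h : Pi^T *m p = 1%:M by rewrite -{1}ps -trmx_mul pPi trmx1.
  by rewrite -[LHS]mulmx1 -pPi mulmxA h mul1mx.
split=> //; have [K K0 HK] := dot_mulmx_le p; exists (m / K); first exact: divr_gt0.
move=> x; have := HK (x *m Pi); rewrite -mulmxA Pip mulmx1 => h.
have := pm (x *m Pi); rewrite /qform -mulmxA Pip mulmx1 dotC; apply: le_trans.
by rewrite -mulrA ler_wpM2l ?(ltW m0)// ler_pdivrMl.
Qed.

Lemma dot_row_mx d (a b a' b' : 'rV[R]_d) :
  dot (row_mx a b) (row_mx a' b') = dot a a' + dot b b'.
Proof.
rewrite /dot big_split_ord /=; congr (_ + _).
  by apply: eq_bigr => i _; rewrite !row_mxEl.
by apply: eq_bigr => i _; rewrite !row_mxEr.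
Qed.

Definition symp_mx d : 'M[R]_(d + d) := block_mx 0 (- 1%:M) 1%:M 0.

Lemma symplectic_formE d (z w : 'rV[R]_(d + d)) : symplectic_form z w = dot (z *m symp_mx d) w.
Proof.
rewrite -{2}[z]hsubmxK -{2}[w]hsubmxK /symp_mx mul_row_block !mulmx0 mulmx1 add0r addr0.
by rewrite mulmxN mulmx1 dot_row_mx dotNl.
Qed.

Lemma symp_mx_sqr d : symp_mx d *m symp_mx d = - 1%:M.
Proof.
rewrite /symp_mx mulmx_block !mul0mx !mulmx0 !add0r !addr0 mulmx1 mul1mx.
by rewrite (@scalar_mx_block R d d 1) opp_block_mx !oppr0.
Qed.

Lemma eq_bilinear_mx n (A B : 'M[R]_n) :
  (forall z w, dot (z *m A) w = dot (z *m B) w) -> A = B.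
Proof.
move=> AB; apply/matrixP => i j.
by have := AB (delta_mx ord0 i) (delta_mx ord0 j); rewrite !dot_delta -!rowE !mxE.
Qed.

Section symplectic_map.
Variables (d : nat) (chi : {linear 'rV[R]_(d + d) -> 'rV[R]_(d + d)}).
Hypothesis chi_symp : symplectic chi.
Let X := lin1_mx chi.
Let J := symp_mx d.

Let XJX : X *m J *m X^T = J.
Proof.
apply: eq_bilinear_mx => z w.
rewrite mulmxA dot_mulmx trmxK mulmxA !mul_rV_lin1 -!symplectic_formE; exact: chi_symp.
Qed.

Let XinvE : X *m (J *m X^T *m (- J)) = 1%:M.
Proof. by rewrite !mulmxA XJX mulmxN symp_mx_sqr opprK. Qed.

(** The transpose of a symplectic matrix is symplectic: the right inverse - J X^T J of X is also a
    left inverse. *)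
Let XtJX : X^T *m J *m X = J.
Proof.
have h := mulmx1C XinvE.
have : J *m (J *m X^T *m (- J) *m X) = J by rewrite h mulmx1.
by rewrite !mulmxA symp_mx_sqr !mulNmx mul1mx mulmxN mulNmx opprK.
Qed.

Lemma symplectic_inv : exists Y : 'M[R]_(d + d),
  (forall z, chi (z *m Y) = z) /\ (forall z, chi z *m Y = z).
Proof.
exists (J *m X^T *m (- J)); split=> z; rewrite -mul_rV_lin1 -/X -mulmxA.
  by rewrite (mulmx1C XinvE) mulmx1.
by rewrite XinvE mulmx1.
Qed.

(** The Gram matrix M = X X^T is positive definite and M J M = J. With blocks a, b, b^T, p this
    gives p b = b^T p and a p = 1 + b b. Completing the square in the frequency leads to S = b p^-1;
    the first relation makes S symmetric, and the second leaves exactly p^-1 as the form in the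
    position. *)
Lemma symplectic_gram : exists p Pi S : 'M[R]_d,
  [/\ posdef p, posdef Pi, S^T = S, Pi *m p = 1%:M &
   forall z, dot (chi z) (chi z) =
     qform Pi (lsubmx z) + qform p (rsubmx z + lsubmx z *m S)].
Proof.
pose M := X *m X^T.
have MJM : M *m J *m M = J by rewrite /M !mulmxA -(mulmxA X) -(mulmxA X) XtJX XJX.
have pM : posdef M := posdef_gram XinvE.
have [Ms _] := pM.
have ME z : qform M z = dot (chi z) (chi z).
  by rewrite /qform /M mulmxA dot_mulmx trmxK !mul_rV_lin1.
set a := ulsubmx M; set b := ursubmx M; set p := drsubmx M.
have Mb : M = block_mx a b b^T p.
  by rewrite -[LHS]submxK; congr block_mx; rewrite /b trmx_ursub Ms.
have pp : posdef p.
  split; first by rewrite /p trmx_drsub Ms.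
  have [_ [m m0 Mm]] := pM; exists m => // xi.
  have := Mm (row_mx 0 xi); rewrite /qform Mb mul_row_block !mul0mx !add0r.
  by rewrite !dot_row_mx !dot0l !dot0r !add0r.
have [ps _] := pp.
move: (MJM); rewrite {1 2}Mb /J /symp_mx !mulmx_block !mulmx0 !mulmx1 !add0r !addr0.
rewrite !mulmxN !mulmx1 !mulNmx => /eq_block_mx[_ e2 e3 e4].
have [Pi Pip] : exists Pi : 'M[R]_d, Pi *m p = 1%:M.
  have [Y HY] := fin_all_exists (fun i : 'I_d => posdef_surj (row i 1%:M) pp).
  exists (\matrix_i Y i); apply/row_matrixP => i; by rewrite row_mul rowK HY.
have pPi := mulmx1C Pip.
have pPi' := posdef_invl pp Pip; have [Pis _] := pPi'.
have pb : p *m b = b^T *m p by apply/eqP; rewrite -subr_eq0 e4.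
have Ss : (b *m Pi)^T = b *m Pi.
  by rewrite trmx_mul Pis -[b^T]mulmx1 -pPi [b^T *m _]mulmxA -pb !mulmxA Pip mul1mx.
have Sp : b *m Pi *m p = b by rewrite -mulmxA Pip mulmx1.
have aE : a = b *m (b *m Pi) + Pi.
  have : b *m b - a *m p = - 1%:M := e2.
  move=> /(congr1 (mulmx^~ Pi)); rewrite mulmxBl -!mulmxA pPi mulmx1 mulNmx mul1mx.
  by move=> /eqP; rewrite subr_eq addrC eq_sym subr_eq => /eqP.
exists p, Pi, (b *m Pi); split=> //.
move=> z; rewrite -ME; set x := lsubmx z; set xi := rsubmx z.
have -> : qform M z = dot (x *m a) x + dot xi (x *m b) + dot (x *m b) xi + dot (xi *m p) xi.
  rewrite /qform -[z]hsubmxK -/x -/xi Mb mul_row_block dot_row_mx !dotDl.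
  by rewrite [dot (_ *m b^T) _]dot_mulmx trmxK !addrA.
rewrite /qform mulmxDl !dotDl !dotDr -[x *m _ *m p]mulmxA Sp.
rewrite [dot (xi *m p) (x *m _)]dot_mulmx ps -[x *m _ *m p]mulmxA Sp.
rewrite [dot (x *m b) (x *m _)]dotC [dot (x *m (b *m Pi)) _]dot_mulmx Ss -mulmxA aE mulmxDr dotDl.
by rewrite [dot x (x *m _)]dotC; ring.
Qed.

End symplectic_map.
End symplectic_gram.

(** * The metaplectic operator on Gaussian packets *)

Section L2_theory.
Context {R : realType} (d : nat).
Notation leb := (lebesgue_rV (R := R) d).
Implicit Types (f g h : 'rV[R]_d -> R[i]) (c : R[i]).

Lemma aeq_refl f : aeq f f.
Proof. by apply: aeW. Qed.

Lemma aeq_sym f g : aeq f g -> aeq g f.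
Proof. by apply: filterS => x ->. Qed.

Lemma aeq_trans g f h : aeq f g -> aeq g h -> aeq f h.
Proof. by apply: filterS2 => x -> ->. Qed.

Lemma aeqZ c f g : aeq f g -> aeq (fun x => c * f x) (fun x => c * g x).
Proof. by apply: filterS => x ->. Qed.

Lemma L2_lin c f g : L2 f -> L2 g -> L2 (fun x => c * f x + g x).
Proof.
move=> fL gL.
have [mr mi] : cmeasurable (fun x => c * f x + g x).
  apply: cmeasurableD; last exact: L2_cmeasurable.
  by apply: cmeasurableM; [exact: cmeasurable_cst|exact: L2_cmeasurable].
split=> //.
pose k x := 2 * normc c ^+ 2 * normc (f x) ^+ 2 + 2 * normc (g x) ^+ 2.
have ki : leb.-integrable setT (EFin \o k).
  have := integrableD measurableT (integrable_scale (2 * normc c ^+ 2) (L2_sqr_integrable fL))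
    (integrable_scale 2 (L2_sqr_integrable gL)).
  by apply: eq_integrable => // x _; rewrite /= EFinD.
have /integrableP[mk koo] := ki.
apply: le_lt_trans koo; apply: ge0_le_integral => //.
- by move=> x _; rewrite lee_fin sqr_ge0.
- by apply/measurable_EFinP; apply: measurable_funX; exact: measurable_normc.
- exact: measurableT_comp.
move=> x _; rewrite /= lee_fin; apply: le_trans (ler_norm _); rewrite /k.
have := le_normcD (c * f x) (g x); rewrite normcM.
have := normc_ge0 (c * f x + g x).
move: (normc (c * f x + g x)) (normc c) (normc (f x)) (normc (g x)) => s p q b s0 sab.
have : s ^+ 2 <= (p * q + b) ^+ 2 by rewrite lerXn2r ?nnegrE// (le_trans s0 sab).
by move=> h; apply: le_trans h _; have := sqr_ge0 (p * q - b); nra.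
Qed.

Lemma L2Z c f : L2 f -> L2 (fun x => c * f x).
Proof.
move=> fL; have L0 : L2 (fun _ : 'rV[R]_d => 0 : R[i]).
  have -> : (fun _ => 0 : R[i]) = (fun x => (- 1) * f x + f x).
    by apply/funext => x; rewrite mulN1r addNr.
  exact: L2_lin.
have := L2_lin c fL L0; rewrite (_ : (fun _ => _) = (fun x => c * f x))//.
by apply/funext => x; rewrite addr0.
Qed.

Lemma aeq_Rintegral (f g : 'rV[R]_d -> R) : measurable_fun setT f -> measurable_fun setT g ->
  {ae leb, forall x, f x = g x} -> \int[leb]_x f x = \int[leb]_x g x.
Proof.
move=> mf mg fg; congr fine; apply: ae_eq_integral => //; try exact/measurable_EFinP.
by apply: filterS fg => x -> _.
Qed.

Lemma L2_inner_aeq f f' g g' : L2 f -> L2 f' -> L2 g -> L2 g' ->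
  aeq f f' -> aeq g g' -> L2_inner f g = L2_inner f' g'.
Proof.
move=> fL fL' gL gL' ff gg.
have [[m1 m2] _] := cintegrable_L2M fL gL; have [[m1' m2'] _] := cintegrable_L2M fL' gL'.
by apply: complexP; apply: aeq_Rintegral => //; apply: filterS2 ff gg => x -> ->.
Qed.

Lemma mulr_conjc (z : R[i]) : z * conjc z = (normc z ^+ 2)%:C.
Proof.
case: z => a b; rewrite normcE2 /= sqr_sqrtr ?addr_ge0 ?sqr_ge0//.
by apply: complexP; rewrite ?cReM ?cImM /=; ring.
Qed.

Lemma L2_inner_self f : L2_inner f f = (\int[leb]_x (normc (f x) ^+ 2))%:C.
Proof.
by rewrite -complex_integral_real; congr complex_integral; apply/funext => x; exact: mulr_conjc.
Qed.

Lemma L2_inner_self_eq0 f : L2 f -> L2_inner f f = 0 -> aeq f (fun=> 0).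
Proof.
move=> fL; rewrite L2_inner_self => -[I0].
have fi := L2_sqr_integrable fL; have /integrableP[mf _] := fi.
have : (\int[leb]_x `|(EFin \o (fun x => (normc (f x) ^+ 2)%R)) x| = 0)%E.
  under eq_integral do rewrite /= ger0_norm ?sqr_ge0//.
  rewrite -[LHS]fineK; first by rewrite -/(Rintegral _ _ _) I0.
  exact: integrable_fin_num fi.
move=> /(ae_eq_integral_abs leb measurableT mf).
apply: filterS => x /(_ I) /= [] /eqP; rewrite sqrf_eq0 => /eqP; exact: eq0_normc.
Qed.

End L2_theory.

Section unitary_maps.
Context {R : realType} (d : nat) (U : ('rV[R]_d -> R[i]) -> ('rV[R]_d -> R[i])).
Hypothesis U_unitary : unitary_L2 U.
Notation leb := (lebesgue_rV (R := R) d).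
Implicit Types (f g h : 'rV[R]_d -> R[i]) (c : R[i]) (P Pi S : 'M[R]_d).

Lemma inv_L2P g : L2 g -> L2 (inv_L2 U g) /\ aeq (U (inv_L2 U g)) g.
Proof.
move=> gL; have [_ _ _ _ surj] := U_unitary; have [f fL Uf] := surj g gL.
exact: (@xgetPex _ (fun=> 0 : R[i]) [set f | L2 f /\ aeq (U f) g] (ex_intro _ f (conj fL Uf))).
Qed.

Lemma unitary_inj f g : L2 f -> L2 g -> aeq (U f) (U g) -> aeq f g.
Proof.
move=> fL gL fg; have [UL _ lin inner _] := U_unitary.
have hL := L2_lin (- 1) fL gL; have UhL := UL _ hL.
have L0 : L2 (fun _ : 'rV[R]_d => 0 : R[i]).
  have := L2Z 0 fL; rewrite (_ : (fun _ => _) = (fun=> 0))//.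
  by apply/funext => x; rewrite mul0r.
have Uh0 : aeq (U (fun x => - 1 * f x + g x)) (fun=> 0).
  apply: aeq_trans (lin _ _ (- 1) fL gL) _; apply: filterS fg => x ->.
  by rewrite mulN1r addNr.
have : aeq (fun x => - 1 * f x + g x) (fun=> 0).
  apply: L2_inner_self_eq0 => //; rewrite -inner// (L2_inner_aeq UhL L0 UhL L0 Uh0 Uh0).
  rewrite L2_inner_self; under eq_Rintegral do rewrite normc0 expr0n /=.
  by rewrite /Rintegral integral0.
by apply: filterS => x /eqP; rewrite mulN1r addrC subr_eq0 => /eqP.
Qed.

(** Writing c f as (c - 1) f + f makes the linearity clause apply directly, without first treating
    the image of 0. *)
Lemma unitaryZ c f : L2 f -> aeq (U (fun x => c * f x)) (fun x => c * U f x).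
Proof.
move=> fL; have [_ _ lin _ _] := U_unitary; have := lin f f (c - 1) fL fL.
rewrite (_ : (fun x => (c - 1) * f x + f x) = (fun x => c * f x)).
  by apply: filterS => x ->; rewrite mulrBl mul1r subrK.
by apply/funext => x; rewrite mulrBl mul1r subrK.
Qed.

Lemma real_complex_neq0 (r : R) : r != 0 -> r%:C != 0.
Proof. by apply: contraNN => /eqP[->]. Qed.

Lemma Rintegral_sqr_packetZ c A B (x xi : 'rV[R]_d) : posdef A ->
  \int[leb]_y (normc (c * packet A B x xi y) ^+ 2) = normc c ^+ 2 * gauss_mass A.
Proof.
move=> pA; rewrite -(Rintegral_sqr_packet A B x xi) -RintegralZl; [|exact: measurableT|].
  by apply: eq_Rintegral => y _; rewrite normcM exprMn.
exact: L2_sqr_integrable (packet_L2 B x xi pA).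
Qed.

(* Both Weyl operators have rank one, so the intertwining relation, applied to the
   preimage of the first packet, determines this preimage up to a factor; the modulus
   of the factor is then given by unitarity. *)
Lemma inv_L2_packet P Pi S x xi x1 xi1 : posdef P -> posdef Pi -> S^T = S -> Pi *m P = 1%:M ->
  (forall f, L2 f -> aeq (inv_L2 U (weyl (gauss_symbol 1%:M 1%:M 0 x xi) (U f)))
    (weyl (gauss_symbol P Pi S x1 xi1) f)) ->
  exists2 c : R[i], normc c = Num.sqrt (gauss_mass (1%:M : 'M[R]_d) / gauss_mass Pi) &
    aeq (inv_L2 U (packet 1%:M 0 x (- xi))) (fun y => c * packet Pi S x1 (- xi1) y).
Proof.
move=> pP pPi Ss PiP H.
have [UL Uae lin inner _] := U_unitary.
have p1 : posdef (1%:M : 'M[R]_d).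
  by split; [exact: trmx1|exists 1 => // y; rewrite qform1 mul1r].
set phi := packet _ _ x _; set Phi := packet _ _ x1 _.
have phiL : L2 phi by exact: packet_L2.
have PhiL : L2 Phi by exact: packet_L2.
have [psiL Upsi] := inv_L2P phiL; set psi := inv_L2 U phi in psiL Upsi *.
have UpsiL := UL _ psiL.
have m10 := gauss_mass_gt0 p1; have mPi0 := gauss_mass_gt0 pPi.
have phi2 : L2_inner phi phi = (gauss_mass (1%:M : 'M[R]_d))%:C.
  by rewrite L2_inner_self Rintegral_sqr_packet.
pose w : R := (2 * pi) ^- d.
have w0 : 0 < w by rewrite invr_gt0 exprn_gt0// mulr_gt0// pi_gt0.
pose lam : R[i] := (w * gauss_mass (1%:M : 'M[R]_d))%:C * (gauss_mass (1%:M : 'M[R]_d))%:C.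
have lam0 : lam != 0.
  rewrite /lam; clearbody w; apply: mulf_neq0; apply: real_complex_neq0.
    exact: lt0r_neq0 (mulr_gt0 w0 m10).
  exact: lt0r_neq0 m10.
(* [U psi] equals [phi] almost everywhere, and [phi] is an eigenvector of the rank one operator;
   dividing later requires its eigenvalue [lam] to be nonzero. *)
have E1 : weyl (gauss_symbol 1%:M 1%:M 0 x xi) (U psi) = (fun y => lam * phi y).
  apply/funext => y; rewrite (weyl_gauss x xi p1 p1 (trmx0 _ _ _) (mulmx1 _)) // -/phi.
  by rewrite (L2_inner_aeq UpsiL phiL phiL phiL Upsi (aeq_refl _)) phi2 /lam mulrA mulrAC.
pose c1 : R[i] := (w * gauss_mass P)%:C * L2_inner psi Phi.
have E2 : weyl (gauss_symbol P Pi S x1 xi1) psi = (fun y => c1 * Phi y).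
  apply/funext => y; rewrite (weyl_gauss x1 xi1 pP pPi Ss PiP) // -/Phi /c1 mulrA mulrAC.
  by [].
have lphiL := L2Z lam phiL; have cPhiL := L2Z c1 PhiL.
have [gL Ug] := inv_L2P lphiL.
have gc := H _ psiL; rewrite E1 E2 in gc.
have psic : aeq (fun y => lam * psi y) (fun y => c1 * Phi y).
  apply: unitary_inj => //; first exact: L2Z.
  apply: aeq_trans (unitaryZ lam psiL) _; apply: aeq_trans (aeqZ lam Upsi) _.
  apply: aeq_trans (aeq_sym Ug) _; exact: Uae.
have kE : aeq psi (fun y => c1 / lam * Phi y).
  by apply: filterS psic => y e; rewrite mulrAC -e mulrAC mulfV// mul1r.
exists (c1 / lam) => //.
(* Comparing the norms of [psi] and of its image determines the modulus; the norms of packets do not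
   depend on their centres. *)
have : (gauss_mass (1%:M : 'M[R]_d))%:C = (normc (c1 / lam) ^+ 2 * gauss_mass Pi)%:C.
  rewrite -phi2 -(L2_inner_aeq UpsiL phiL UpsiL phiL Upsi Upsi) inner//.
  have kL := L2Z (c1 / lam) PhiL.
  rewrite (L2_inner_aeq psiL kL psiL kL kE kE) L2_inner_self.
  by rewrite (Rintegral_sqr_packetZ _ _ _ _ pPi).
by move=> -[->]; rewrite mulfK ?gt_eqF// sqrtr_sqr ger0_norm// normc_ge0.
Qed.

End unitary_maps.

Section continuous_representatives.
Context {R : realType} (d : nat).
Notation leb := (lebesgue_rV (R := R) d).

(** The set where continuous functions differ is open; if nonempty, it contains a box of measure
    (2e)^d > 0. *)
Lemma ae_continuous_eq (h k : 'rV[R]_d -> R) : continuous h -> continuous k ->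
  {ae leb, forall x, h x = k x} -> forall x, h x = k x.
Proof.
move=> ch ck [N [mN N0 hkN]] x; apply/eqP; rewrite -subr_eq0; apply/negPn/negP => hk0.
have chk := continuous_funD ch (continuous_funN ck).
have : \forall y \near x, h y - k y != 0 by exact: cvgr_neq0 (chk x) hk0.
move=> /nbhs_ballP[e /= e0 He].
pose A (i : 'I_d) : set (measurableTypeR R) := `]x ord0 i - e, x ord0 i + e[%classic.
have mA i : measurable (A i) by exact: measurable_itv.
have mbox := measurable_box mA.
have boxN : [set y : 'rV[R]_d | forall i, A i (y ord0 i)] `<=` N.
  move=> y yA; apply: hkN => /= hk; move: (He y); rewrite hk subrr eqxx => /(_ _)/negP; apply => //.
  split=> [|i j]; first exact: e0.
  rewrite ord1; have := yA j; rewrite /A /= in_itv /= => /andP[u v].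
  by rewrite /ball /= distrC ltr_distl u v.
have : (leb [set y : 'rV[R]_d | forall i, A i (y ord0 i)] <= leb N)%E.
  by apply: le_measure; rewrite ?inE.
rewrite lebesgue_rV_box// [X in (_ <= X)%E]N0 leNgt => /negP; apply.
have -> : (\prod_(i < d) lebesgue_measure (A i) = ((2 * e) ^+ d)%:E)%E.
  rewrite (eq_bigr (fun=> (2 * e)%:E)); last first.
    move=> i _; rewrite /A lebesgue_measure_itv /= lte_fin ltrD2l.
    have -> : - e < e by rewrite gtrN.
    by rewrite -EFinB; congr EFin; ring.
  by rewrite prodEFin prodr_const card_ord.
by rewrite lte_fin exprn_gt0// mulr_gt0.
Qed.

Lemma aeq_continuous (f g : 'rV[R]_d -> R[i]) : ccontinuous f -> ccontinuous g ->
  aeq f g -> f = g.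
Proof.
move=> [fr fi] [gr gi] fg; apply/funext => x; apply: complexP.
  by apply: ae_continuous_eq fr gr _ x; apply: filterS fg => y ->.
by apply: ae_continuous_eq fi gi _ x; apply: filterS fg => y ->.
Qed.

End continuous_representatives.

Section gelfand_shilov_closure.
Context {R : realType} (n : nat) (theta : R).
Hypothesis theta_gt0 : 0 < theta.
Implicit Types f : 'rV[R]_n -> R[i].

Lemma gs_step_bounded C f : 0 < C -> gs_step theta C f ->
  exists2 M : R, 0 <= M & gs_bounded theta C M f.
Proof.
move=> C0 [_ foo]; pose e alpha beta x := C ^- (mdeg alpha + mdeg beta)
  * (mfact alpha * mfact beta)%:R `^ (- theta) * (`|mpow x alpha| * normc (mderiv beta f x)).
have eN alpha beta x : ((e alpha beta x)%:E <= gs_norm theta C f)%E.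
  by apply: ereal_sup_ubound; exists alpha, beta, x.
have Nge : (0 <= gs_norm theta C f)%E.
  apply: le_trans (eN (fun=> 0%N) (fun=> 0%N) 0); rewrite lee_fin /e.
  by rewrite !mulr_ge0 ?normc_ge0 ?powR_ge0// invr_ge0 exprn_ge0// ltW.
have Nfin : gs_norm theta C f \is a fin_num by rewrite ge0_fin_numE.
exists (fine (gs_norm theta C f)); first exact: fine_ge0.
move=> alpha beta x; have := eN alpha beta x; rewrite -(fineK Nfin) lee_fin /e /=.
set F := (mfact alpha * mfact beta)%:R.
have F0 : 0 < F `^ theta by rewrite powR_gt0// ltr0n muln_gt0 !prodn_gt0// => i; exact: fact_gt0.
by rewrite powRN -invfM mulrC ler_pdivrMr ?mulr_gt0 ?exprn_gt0// mulrA.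
Qed.

Lemma gelfand_shilovZ c f : gelfand_shilov theta f -> gelfand_shilov theta (fun y => c * f y).
Proof.
move=> [C C0 fC]; have [sf _] := fC; have [M M0 fM] := gs_step_bounded C0 fC.
have cE : (fun y => c * f y) = (fun y => c * f y + 0) by apply/funext => y; rewrite addr0.
exists C; first exact: C0.
apply: (@gs_bounded_step _ _ _ _ (normc c * M)); first exact: C0.
  by rewrite cE; apply: smooth_lin; [exact: sf|exact: smooth_cst].
move=> alpha beta x; rewrite mderivE cE foldr_pderiv_lin; [|exact: sf|exact: smooth_cst].
rewrite foldr_pderiv_cst0 addr0 normcM -mderivE mulrCA -!mulrA.
by rewrite ler_wpM2l ?normc_ge0// mulrA; exact: fM.
Qed.

Lemma gelfand_shilov_schwartz f : gelfand_shilov theta f -> schwartz f.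
Proof.
move=> [C C0 fC]; have [sf _] := fC; have [M M0 fM] := gs_step_bounded C0 fC.
by split; [exact: sf|move=> alpha beta; eexists => x; exact: fM].
Qed.

End gelfand_shilov_closure.

Lemma posdef_scalar (R : realType) n (t : R) : 0 < t -> posdef (t%:M : 'M[R]_n).
Proof.
move=> t0; split; first exact: tr_scalar_mx.
by exists t => // x; rewrite /qform mul_mx_scalar dotZl.
Qed.

Lemma qform0 (R : realType) n (x : 'rV[R]_n) : qform 0 x = 0.
Proof. by rewrite /qform mulmx0 dot0l. Qed.

(** The symbol is itself a packet in dimension d + d, with matrix 2 to offset the factor 1/2 and
    with frequency 0. So it lies in a Gelfand-Shilov space, hence in the Schwartz space. *)
Lemma gauss_symbol_schwartz (R : realType) d (x xi : 'rV[R]_d) :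
  schwartz (gauss_symbol 1%:M 1%:M 0 x xi).
Proof.
have -> : gauss_symbol 1%:M 1%:M 0 x xi = packet 2%:M 0 (row_mx x xi) 0.
  apply/funext => z; rewrite /gauss_symbol /packet !qform1 mulmx0 addr0.
  rewrite dot0l add0r qform0 mulr0 oppr0 cexp_real; congr (expR (- _))%:C.
  rewrite /qform mul_mx_scalar dotZl mulrA mulVf ?mul1r ?pnatr_eq0//.
  have -> : z - row_mx x xi = row_mx (lsubmx z - x) (rsubmx z - xi).
    by rewrite -{1}[z]hsubmxK opp_row_mx add_row_mx.
  by rewrite dot_row_mx.
apply: (@gelfand_shilov_schwartz _ _ 1) => //.
by apply: packet_gs; [rewrite invf_le1// ler1n|exact: posdef_scalar|exact: trmx0].
Qed.

Section transpose.
Context {R : realType} (d : nat) (theta : R).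
Hypothesis theta_ge : 2^-1 <= theta.

Lemma gauss_packetE (z : 'rV[R]_(d + d)) :
  gauss_packet z = packet 1%:M 0 (lsubmx z) (rsubmx z).
Proof.
apply/funext => y; rewrite /gauss_packet /packet qform1 qform0 mulr0 addr0.
by rewrite /cexp /enorm sqr_sqrtr ?dotxx_ge0// dotC.
Qed.

Lemma conjc_packet A B (x xi y : 'rV[R]_d) :
  conjc (packet A B x xi y) = packet A (- B) x (- xi) y.
Proof.
by rewrite /packet conjc_cexp /qform mulmxN !dotNl; congr cexp; ring.
Qed.

(** The two conjugations around the inverse of [U] restore the sign of the frequency and turn S into
    -S. The chosen representative is continuous, so its almost everywhere equality with an explicit
    packet is equality. *)
Lemma transpose_gs_packet U Pi S (x1 xi1 : 'rV[R]_d) (z : 'rV[R]_(d + d)) c :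
  posdef Pi -> S^T = S ->
  aeq (inv_L2 U (packet 1%:M 0 (lsubmx z) (- rsubmx z))) (fun y => c * packet Pi S x1 (- xi1) y) ->
  transpose_gs theta U (gauss_packet z) = (fun y => conjc c * packet Pi (- S) x1 xi1 y).
Proof.
move=> pPi Ss H; have theta_gt0 : 0 < theta by apply: lt_le_trans theta_ge; rewrite invr_gt0.
set g0 := fun y => _; set G := [set g | gelfand_shilov theta g /\
  aeq g (fun x => conjc (inv_L2 U (fun y => conjc (gauss_packet z y)) x))].
have gs0 : gelfand_shilov theta g0.
  by apply: gelfand_shilovZ => //; apply: packet_gs => //; rewrite linearN /= Ss.
have conjE : (fun y => conjc (gauss_packet z y)) = packet 1%:M 0 (lsubmx z) (- rsubmx z).
  by apply/funext => y; rewrite gauss_packetE conjc_packet oppr0.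
have G0 : G g0.
  split=> //; rewrite conjE; apply: aeq_sym; apply: filterS H => y ->.
  have -> : conjc (c * packet Pi S x1 (- xi1) y) = conjc c * conjc (packet Pi S x1 (- xi1) y) by exact: rmorphM.
  by rewrite conjc_packet opprK.
have [gsg gE] : G (transpose_gs theta U (gauss_packet z)) := xgetPex _ (ex_intro G g0 G0).
have [_ g0E] := G0.
apply: aeq_continuous; last exact: aeq_trans gE (aeq_sym g0E).
  by have [C _ [sf _]] := gsg; exact: smooth_ccontinuous.
by have [C _ [sf _]] := gs0; exact: smooth_ccontinuous.
Qed.

End transpose.

(** * Wave front sets and cones *)

Section wave_front_cones.
Context {R : realType} (d : nat) (theta : R).
Hypothesis theta_gt0 : 0 < theta.
Implicit Types (z b : 'rV[R]_(d + d)).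

Lemma norm_le_enorm n (x : 'rV[R]_n) : `|x| <= enorm x.
Proof. by rewrite /enorm -[leLHS]ger0_norm// -sqrtr_sqr ler_wsqrtr// sqr_norm_le_dot. Qed.

Lemma enorm_le_norm n (x : 'rV[R]_n) : enorm x <= n.+1%:R * `|x|.
Proof.
rewrite /enorm -[leRHS]ger0_norm ?mulr_ge0// -sqrtr_sqr ler_wsqrtr//.
apply: le_trans (ler_norm _) _; apply: le_trans (norm_dot_le _ _) _.
rewrite -mulrA -expr2 exprMn ler_wpM2r ?sqr_ge0//.
by rewrite -natrX ler_nat expnS expn1 mulSn (leq_trans (leqnSn n))// leq_addr.
Qed.

Lemma norm_hsubmx_le z : `|z| <= Num.max `|lsubmx z| `|rsubmx z|.
Proof.
apply: norm_le_coord => [|i]; first by rewrite le_max normr_ge0.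
rewrite -[z]hsubmxK row_mxKl row_mxKr mxE le_max; case: splitP => j _.
  by rewrite coord_le_norm.
by rewrite coord_le_norm orbT.
Qed.

Let theta_inv_ge0 : 0 <= theta^-1.
Proof. by rewrite invr_ge0 ltW. Qed.

Let powR_mono (s t : R) : 0 <= s -> s <= t -> s `^ theta^-1 <= t `^ theta^-1.
Proof.
by move=> s0 st; apply: ge0_ler_powR => //; rewrite nnegrE// (le_trans s0 st).
Qed.

(** An open conic set around [z0] contains the multiples of a ball, and such multiples form an open
    cone. The Euclidean norms of the two halves and the sup norm of the whole are comparable, which
    only affects the rate [e]. *)
Lemma WFgl_cone_decay (u : ('rV[R]_d -> R[i]) -> R[i]) z0 : z0 != 0 ->
  WFgl theta u z0 <-> ~ cone_decay theta z0 (fun z => normc (u (gauss_packet z))).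
Proof.
move=> z00; suff H : (exists G (C e : R), [/\ open G, conic G, G z0, 0 < C /\ 0 < e &
        forall z, G z -> normc (u (gauss_packet z)) <=
          C * expR (- e * (enorm (lsubmx z) `^ theta^-1
                           + enorm (rsubmx z) `^ theta^-1))]) <->
    cone_decay theta z0 (fun z => normc (u (gauss_packet z))).
  by split=> [[_ h]|h]; [rewrite -H|split=> //; rewrite H].
split=> [[G [C [e [oG [G0 cG] Gz [C0 e0] Gle]]]]|[r [C [e [r0 C0 e0 dec]]]]].
  have /nbhs_ballP[r /= r0 rG] : nbhs z0 G by exact: open_nbhs_nbhs.
  exists r, C, e; split=> // t b t0 br.
  have Gtb : G (t *: b) by apply: cG => //; apply: rG; rewrite -ball_normE /= distrC.
  apply: le_trans (Gle _ Gtb) _; rewrite ler_pM2l// ler_expR !mulNr lerN2 ler_pM2l//.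
  have [h|h] := leP `|lsubmx (t *: b)| `|rsubmx (t *: b)|.
    apply: le_trans (_ : enorm (rsubmx (t *: b)) `^ theta^-1 <= _); last by rewrite lerDr powR_ge0.
    apply: powR_mono => //; apply: le_trans (norm_hsubmx_le _) _.
    by rewrite max_r// norm_le_enorm.
  apply: le_trans (_ : enorm (lsubmx (t *: b)) `^ theta^-1 <= _); last by rewrite lerDl powR_ge0.
  apply: powR_mono => //; apply: le_trans (norm_hsubmx_le _) _.
  by rewrite max_l ?(ltW h)// norm_le_enorm.
have nz0 : 0 < `|z0| by rewrite normr_gt0.
(* A radius at most |z0| keeps the origin out of the cone. *)
pose s := Num.min r `|z0|.
have s0 : 0 < s by rewrite lt_min r0.
pose G := [set z | exists2 t : R, 0 < t & `|t^-1 *: z - z0| < s].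
pose K : R := d.+1%:R `^ theta^-1.
have K0 : 0 < K by rewrite powR_gt0.
(* Each half of z contributes at most K |z|^(1/theta), hence the division by 2 K. *)
exists G, C, (e / (2 * K)); split.
- rewrite openE => z [t t0 zs]; rewrite /interior -nbhs_ballE.
  exists (t * (s - `|t^-1 *: z - z0|)) => /=; first by rewrite mulr_gt0// subr_gt0.
  move=> z'; rewrite -ball_normE /= => zz'; exists t => //.
  have -> : t^-1 *: z' - z0 = (t^-1 *: z - z0) - t^-1 *: (z - z').
    by rewrite scalerBr opprB [RHS]addrC addrA subrK.
  apply: le_lt_trans (ler_normB _ _) _; rewrite addrC -ltrBrDr normrZ gtr0_norm ?invr_gt0//.
  by rewrite ltr_pdivrMl.
- split=> [[t t0]|z t t0 [t' t'0 zs]].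
    by rewrite scaler0 sub0r normrN lt_min ltxx andbF.
  by exists (t * t'); [exact: mulr_gt0|rewrite scalerA invfM mulrAC mulVf ?gt_eqF// mul1r].
- by exists 1 => //; rewrite invr1 scale1r subrr normr0.
- by split=> //; rewrite divr_gt0// mulr_gt0.
move=> z [t t0]; rewrite lt_min => /andP[zr _].
have := dec t _ t0 zr; rewrite scalerA mulfV ?gt_eqF// scale1r => h.
apply: le_trans h _; rewrite ler_pM2l// ler_expR !mulNr lerN2 -mulrA ler_pM2l// mulrC.
rewrite ler_pdivrMr ?mulr_gt0//.
have le1 (x : 'rV[R]_d) : `|x| <= `|z| -> enorm x `^ theta^-1 <= K * `|z| `^ theta^-1.
  move=> xz; rewrite /K -powRM//; apply: powR_mono; first exact: sqrtr_ge0.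
  by apply: le_trans (enorm_le_norm _) _; rewrite ler_wpM2l.
have := lerD (le1 _ (norm_lsubmx_le z)) (le1 _ (norm_rsubmx_le z)).
by move=> h'; apply: le_trans h' _; rewrite -mulr2n -[leLHS]mulr_natl mulrA [leLHS]mulrC.
Qed.

(** The inverse Y maps a smaller cone around z0 X into the given cone around z0, and X enlarges
    norms by a bounded factor at most, which lowers the rate; k only multiplies the constant. *)
Lemma cone_decay_linear (F G : 'rV[R]_(d + d) -> R) (k : R) (X Y : 'M[R]_(d + d)) z0 : 0 < k ->
  (forall z, z *m X *m Y = z) -> (forall z, z *m Y *m X = z) ->
  (forall z, F (z *m X) <= k * G z) -> cone_decay theta z0 G -> cone_decay theta (z0 *m X) F.
Proof.
move=> k0 XY YX FG [r [C [e [r0 C0 e0 dec]]]].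
have bound (A : 'M[R]_(d + d)) : exists2 N : R, 0 < N & forall z, `|z *m A| <= N * `|z|.
  exists ((d + d)%:R * `|A| + 1); first by rewrite ltr_wpDl// mulr_ge0.
  move=> z; apply: le_trans (norm_mulmx_le _ _) _.
  by rewrite mulrAC mulrDl mul1r lerDl.
have [NX NX0 HX] := bound X; have [NY NY0 HY] := bound Y.
have P0 : 0 < NX `^ theta^-1 by rewrite powR_gt0.
exists (r / NY), (k * C), (e / NX `^ theta^-1); split; [exact: divr_gt0|exact: mulr_gt0|exact: divr_gt0|].
move=> t b t0 br.
have b'r : `|b *m Y - z0| < r.
  rewrite -[z0]XY -mulmxBl; apply: le_lt_trans (HY _) _.
  by rewrite mulrC -ltr_pdivlMr.
have -> : t *: b = (t *: (b *m Y)) *m X by rewrite scalemxAl YX.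
set w := t *: (b *m Y).
apply: le_trans (FG w) _; rewrite -mulrA (ler_pM2l k0).
apply: le_trans (dec _ _ t0 b'r) _; rewrite -/w (ler_pM2l C0) ler_expR !mulNr lerN2 -mulrA.
rewrite (ler_pM2l e0) (ler_pdivrMl _ _ P0) -powRM; [|exact: ltW|exact: normr_ge0].
by apply: powR_mono; [exact: normr_ge0|exact: HX].
Qed.

End wave_front_cones.

Theorem corollary3p7 (R : realType) (d : nat) (theta : R)
    (htheta : 2^-1 <= theta < 1)
    (chi : {linear 'rV[R]_(d + d) -> 'rV[R]_(d + d)})
    (hchi : symplectic chi)
    (U : ('rV[R]_d -> R[i]) -> ('rV[R]_d -> R[i]))
    (hU : metaplectic chi U)
    (u : ('rV[R]_d -> R[i]) -> R[i])
    (hu : gs_dual theta u)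
    (z0 : 'rV[R]_(d + d)) (hz0 : z0 != 0) :
  WFgl theta u z0 <-> WFgl theta (dual_ext theta U u) (chi z0).
Proof.
have /andP[theta_ge _] := htheta.
have theta_gt0 : 0 < theta by apply: lt_le_trans theta_ge; rewrite invr_gt0.
have [Y [chiY Ychi]] := symplectic_inv hchi.
have [p [Pi [S [pp pPi Ss Pip gram]]]] := symplectic_gram hchi.
have [U_unitary egorov] := hU.
have chi0 : chi z0 != 0.
  by apply: contra_neq hz0 => h; rewrite -[z0]Ychi h mul0mx.
have p1 : posdef (1%:M : 'M[R]_d) by exact: posdef_scalar.
have S0 : (0 : 'M[R]_d)^T = 0 by exact: trmx0.
have Sn : (- S)^T = - S by rewrite linearN /= Ss.
pose k := Num.sqrt (gauss_mass (1%:M : 'M[R]_d) / gauss_mass Pi).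
have k0 : 0 < k by rewrite sqrtr_gt0 divr_gt0 ?gauss_mass_gt0.
(* Since [k] does not depend on z, decay of one side along chi is decay of the other. *)
have normE z : normc (dual_ext theta U u (gauss_packet (chi z))) = k * gwin u Pi (- S) z.
  set w := chi z.
  have symbE : gauss_symbol 1%:M 1%:M 0 (lsubmx w) (rsubmx w) \o chi =
      gauss_symbol p Pi S (lsubmx z) (rsubmx z).
    apply/funext => z' /=; rewrite /gauss_symbol !qform1 mulmx0 addr0.
    have sub (v v' : 'rV[R]_(d + d)) : lsubmx v - lsubmx v' = lsubmx (v - v') /\
        rsubmx v - rsubmx v' = rsubmx (v - v') by rewrite !linearB.
    have [-> ->] := sub (chi z') w; have [-> ->] := sub z' z.
    rewrite -dot_row_mx hsubmxK /w -linearB /= gram.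
    by [].
  have inter f : L2 f -> aeq (inv_L2 U (weyl (gauss_symbol 1%:M 1%:M 0 (lsubmx w) (rsubmx w)) (U f)))
      (weyl (gauss_symbol p Pi S (lsubmx z) (rsubmx z)) f).
    by rewrite -symbE; apply: egorov; exact: gauss_symbol_schwartz.
  have [c cE cP] := inv_L2_packet U_unitary pp pPi Ss Pip inter.
  rewrite /dual_ext (transpose_gs_packet theta_ge pPi Ss cP).
  rewrite (dualZ theta_gt0 hu) ?normcM ?normc_conjc ?cE//.
  exact: packet_gs.
rewrite !WFgl_cone_decay//.
(* Only the window differs between the two sides, (1, 0) against (Pi, -S). *)
have dec1 : cone_decay theta z0 (fun z => normc (u (gauss_packet z))) <->
    cone_decay theta z0 (gwin u Pi (- S)).
  rewrite (_ : (fun z => normc (u (gauss_packet z))) = gwin u 1%:M 0).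
    by split; exact: cone_decay_change.
  by apply/funext => z; rewrite gauss_packetE.
have Xchi z : z *m lin1_mx chi = chi z by rewrite mul_rV_lin1.
have dec2 : cone_decay theta z0 (gwin u Pi (- S)) <->
    cone_decay theta (chi z0) (fun z => normc (dual_ext theta U u (gauss_packet z))).
  have XY (z : 'rV[R]_(d + d)) : z *m lin1_mx chi *m Y = z by rewrite Xchi Ychi.
  have YX (z : 'rV[R]_(d + d)) : z *m Y *m lin1_mx chi = z by rewrite Xchi chiY.
  split=> h.
    rewrite -Xchi; apply: (cone_decay_linear theta_gt0 k0 XY YX _ h) => z.
    by rewrite Xchi normE.
  have k'0 : 0 < k^-1 by rewrite invr_gt0.
  rewrite -(Ychi z0); apply: (cone_decay_linear theta_gt0 k'0 YX XY _ h) => z.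
  by rewrite -{2}(chiY z) normE mulKf// gt_eqF.
by rewrite dec1 dec2.
Qed.
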